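(* Fix a domain $Q\subset\mathbb{R}^3$ diffeomorphic to the solid torus, a pair of smooth single-variable functions $C,p:\mathbb{R}\to\mathbb{R}$, and a volume-preserving circle-action $\Phi_\theta$ on $Q$ with nowhere vanishing infinitesimal generator $\bm{u}$. Let $\overline{g}$ be the associated averaged metric, $\rho_{\overline{g}}$ its density, and $R^2=\bm{u}\,\overline{\cdot}\,\bm{u}$. Let $\psi:Q\to\mathbb{R}$ be a $C^\infty$, $S^1$-invariant (i.e. $\psi\circ\Phi_\theta=\psi$ for all $\theta$) solution of the generalized Grad-Shafranov equation $$-\overline{\nabla}\,\overline{\cdot}\,\big(R^{-2}\rho_{\overline{g}}\,\overline{\nabla}\psi\big)+C(\psi)\,\frac{\bm{u}}{R^2}\,\overline{\cdot}\,\overline{\nabla}\,\overline{\times}\Big(\frac{\bm{u}}{R^2}\Big)=\frac{p'(\psi)+R^{-2}\,C(\psi)\,C'(\psi)}{\rho_{\overline{g}}}.$$ Then the pair $(\bm{B},\mathsf{p})$ defined by $\mathsf{p}(\bm{x})=p(\psi(\bm{x}))$ and $$\bm{B}=C(\psi)\,\frac{\bm{u}}{R^2}+\rho_{\overline{g}}\,\frac{\overline{\nabla}\psi\,\overline{\times}\,\bm{u}}{R^2}$$ satisfies $$\nabla\cdot\bm{B}=0,\qquad(\overline{\nabla}\,\overline{\times}\,\bm{B})\,\overline{\times}\,\bm{B}=\overline{\nabla}\mathsf{p}.$$ Equivalently, $\nabla\cdot\bm{B}=0$ and $$\int_0^{2\pi}\nabla\Phi_\theta(\bm{x})\cdot\big[(\nabla\times\bm{B})\times\bm{B}-\nabla\mathsf{p}\big](\Phi_\theta(\bm{x}))\,d\theta=0$$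 for each $\bm{x}\in Q$.
   Context: The solid torus is $D^2\times S^1$, where $D^2$ is the closed 2-dimensional unit disc and $S^1=\mathbb{R}\text{ mod }2\pi$. Circle-action: a one-parameter family of $C^\infty$ diffeomorphisms $\Phi_\theta:Q\to Q$ with $\Phi_{\theta+2\pi}=\Phi_\theta$, $\Phi_0=\mathrm{id}_Q$, $\Phi_{\theta_1+\theta_2}=\Phi_{\theta_1}\circ\Phi_{\theta_2}$, such that $(\bm{x},\theta)\mapsto\Phi_\theta(\bm{x})$ is $C^\infty$. It is volume-preserving if $\int_U d^3\bm{x}=\int_{\Phi_\theta(U)}d^3\bm{x}$ for every $\theta\in S^1$ and every relatively open $U\subset Q$. Its infinitesimal generator is the vector field $\bm{u}(\bm{x})=\frac{d}{d\theta}\big|_{\theta=0}\Phi_\theta(\bm{x})$. For a vector $\bm{w}$, $\nabla\Phi_\theta(\bm{x})\cdot\bm{w}$ is the vector with $i$-th component $\sum_j\partial_i\Phi_\theta^j(\bm{x})\,w_j$ (so the integrand is the pullback by $\Phi_\theta$ of the covector field $(\nabla\times\bm{B})\times\bm{B}-\nabla\mathsf{p}$). $[\bm{v}_1,\bm{v}_2]=\bm{v}_1\cdot\nabla\bm{v}_2-\bm{v}_2\cdot\nabla\bm{v}_1$ is the commutator of vector fields. Averaged vector calculus associated with a circle-action $\Phi_\theta$: with $g$ the flat Euclidean metric on $\mathbb{R}^3$, the averaged metric is $\overline{g}=\frac{1}{2\pi}\int_0^{2\pi}\Phi_\theta^*g\,d\theta$ (a smooth Riemannian metric on $Q$), and its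 density is $\rho_{\overline{g}}=\sqrt{\det(\overline{g})}$, the determinant being that of the matrix of components of $\overline{g}$ in standard Euclidean coordinates. For vector fields $\bm{w},\bm{w}_1,\bm{w}_2$ and a scalar field $\varphi$ on $Q$ (all $C^\infty$): - averaged dot product: $\bm{w}_1\,\overline{\cdot}\,\bm{w}_2=\overline{g}(\bm{w}_1,\bm{w}_2)$; - averaged cross product $\bm{w}_1\,\overline{\times}\,\bm{w}_2$: the unique vector field with $(\bm{w}_1\,\overline{\times}\,\bm{w}_2)\,\overline{\cdot}\,\bm{v}=\rho_{\overline{g}}\,(\bm{w}_1\times\bm{w}_2)\cdot\bm{v}$ for every vector field $\bm{v}$; - averaged gradient $\overline{\nabla}\varphi$: the unique vector field with $\overline{\nabla}\varphi\,\overline{\cdot}\,\bm{v}=\nabla\varphi\cdot\bm{v}$ for every vector field $\bm{v}$; - averaged divergence: $\overline{\nabla}\,\overline{\cdot}\,\bm{w}=\rho_{\overline{g}}^{-1}\nabla\cdot(\rho_{\overline{g}}\,\bm{w})$; - averaged curl $\overline{\nabla}\,\overline{\times}\,\bm{w}$: the unique vector field with $(\overline{\nabla}\,\overline{\times}\,\bm{w})\,\overline{\cdot}\,(\bm{v}_1\,\overline{\times}\,\bm{v}_2)=\bm{v}_1\,\overline{\cdot}\,\overline{\nabla}(\bm{w}\,\overline{\cdot}\,\bm{v}_2)-\bm{v}_2\,\overline{\cdot}\,\overline{\nabla}(\bm{w}\,\overline{\cdot}\,\bm{v}_1)-\bm{w}\,\overline{\cdot}\,[\bm{v}_1,\bm{v}_2]$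 for all vector fields $\bm{v}_1,\bm{v}_2$. *)

(* Defs.v *)
From mathcomp Require Import all_boot all_order all_algebra.
From mathcomp Require Import all_classical all_reals all_analysis.
Set Implicit Arguments.
Unset Strict Implicit.
Unset Printing Implicit Defensive.
Import Order.TTheory GRing.Theory Num.Theory.
Import numFieldNormedType.Exports.
Local Open Scope classical_set_scope.
Local Open Scope ring_scope.

(* Meant for an open set U and finite-dimensional V: then C^k amounts to the
   existence and continuity on U of all iterated directional derivatives of
   order at most k. *)
Fixpoint Ck (R : realType) (V W : normedModType R) (k : nat) (U : set V)
    (f : V -> W) : Prop :=
  (forall x, U x -> {for x, continuous f}) /\
  (if k is k'.+1 then
     forall v, (forall x, U x -> derivable f x v) /\ Ck k' U ('D_v f)
   else True).

Definition Cinfty (R : realType) (V W : normedModType R) (U : set V)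
    (f : V -> W) : Prop := forall k, Ck k U f.

(* g is a C^oo extension of f|_X to an open neighbourhood U of x. *)
Definition smooth_extension (R : realType) (V W : normedModType R) (X : set V)
    (f : V -> W) (x : V) (U : set V) (g : V -> W) : Prop :=
  [/\ open U, U x, Cinfty U g & forall y, U y -> X y -> g y = f y].

(* The values of f outside X are irrelevant. *)
Definition smooth_on (R : realType) (V W : normedModType R) (X : set V)
    (f : V -> W) : Prop :=
  forall x, X x -> exists U g, smooth_extension X f x U g.

(* Derivative at x, in the direction v, of the restriction of f to X: the one
   of any C^oo local extension.  At points of the closure of the interior of X
   (in particular at the boundary points of a smooth domain) it does not depend
   on the extension, by continuity of the derivatives; at interior points near
   which f is C^oo it is ['D_v f x]. *)
Definition dder (R : realType) (V W : normedModType R) (X : set V)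
    (f : V -> W) (x v : V) : W :=
  xget 0 [set l | exists U g, smooth_extension X f x U g /\ 'D_v g x = l].

Definition diffeomorphism (R : realType) (V W : normedModType R) (X : set V)
    (Y : set W) (f : V -> W) : Prop :=
  exists g : W -> V,
    [/\ smooth_on X f, smooth_on Y g, {homo f : x / X x >-> Y x},
        {homo g : y / Y y >-> X y}
      & (forall x, X x -> g (f x) = x) /\ (forall y, Y y -> f (g y) = y)].

Definition diffeomorphic (R : realType) (V W : normedModType R) (X : set V)
    (Y : set W) : Prop := exists f, diffeomorphism X Y f.

Definition dot (R : realType) (n : nat) (a b : 'rV[R]_n) : R :=
  \sum_i a 0 i * b 0 i.

(* D^2 x S^1 in R^2 x R^2; R mod 2 pi is identified with the unit circle by
   t |-> (cos t, sin t). *)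
Definition solid_torus (R : realType) : set ('rV[R]_2 * 'rV[R]_2) :=
  [set z | dot z.1 z.1 <= 1 /\ dot z.2 z.2 = 1].

Definition basis (R : realType) (i : 'I_3) : 'rV[R]_3 := delta_mx 0 i.

(* Indices are taken in 'I_3, i.e. modulo 3. *)
Definition cross (R : realType) (a b : 'rV[R]_3) : 'rV[R]_3 :=
  \row_i (a 0 (i + 1) * b 0 (i + 2) - a 0 (i + 2) * b 0 (i + 1)).

Definition partial (R : realType) (W : normedModType R) (Q : set 'rV[R]_3)
    (i : 'I_3) (f : 'rV[R]_3 -> W) (x : 'rV[R]_3) : W :=
  dder Q f x (basis R i).

Definition grad (R : realType) (Q : set 'rV[R]_3) (phi : 'rV[R]_3 -> R)
    (x : 'rV[R]_3) : 'rV[R]_3 := \row_i partial Q i phi x.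

Definition divergence (R : realType) (Q : set 'rV[R]_3)
    (w : 'rV[R]_3 -> 'rV[R]_3) (x : 'rV[R]_3) : R :=
  \sum_i (partial Q i w x) 0 i.

Definition curl (R : realType) (Q : set 'rV[R]_3)
    (w : 'rV[R]_3 -> 'rV[R]_3) (x : 'rV[R]_3) : 'rV[R]_3 :=
  \row_i ((partial Q (i + 1) w x) 0 (i + 2) - (partial Q (i + 2) w x) 0 (i + 1)).

(* [v1, v2] = v1 . grad v2 - v2 . grad v1 *)
Definition commutator (R : realType) (Q : set 'rV[R]_3)
    (v1 v2 : 'rV[R]_3 -> 'rV[R]_3) (x : 'rV[R]_3) : 'rV[R]_3 :=
  dder Q v2 x (v1 x) - dder Q v1 x (v2 x).

(* (grad F . w)_i = \sum_j (d_i F^j) w_j, the transpose of the differential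
   of F applied to w. *)
Definition grad_map_apply (R : realType) (Q : set 'rV[R]_3)
    (F : 'rV[R]_3 -> 'rV[R]_3) (x w : 'rV[R]_3) : 'rV[R]_3 :=
  \row_i \sum_j (partial Q i F x) 0 j * w 0 j.

Definition vec3 (R : realType) (t : R * R * R) : 'rV[R]_3 :=
  \row_(i < 3) [:: t.1.1; t.1.2; t.2]`_i.

Definition volume (R : realType) (A : set 'rV[R]_3) : \bar R :=
  (((@lebesgue_measure R) \x (@lebesgue_measure R)) \x (@lebesgue_measure R))%E
    (@vec3 R @^-1` A).

(* A 2 pi-periodic family Phi t, t in R, of maps Q -> Q; the values of Phi t
   outside Q are irrelevant. *)
Definition circle_action (R : realType) (Q : set 'rV[R]_3)
    (Phi : R -> 'rV[R]_3 -> 'rV[R]_3) : Prop :=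
  [/\ forall t, diffeomorphism Q Q (Phi t),
      forall t x, Q x -> Phi (t + 2 * pi) x = Phi t x,
      forall x, Q x -> Phi 0 x = x,
      forall s t x, Q x -> Phi (s + t) x = Phi s (Phi t x)
    & smooth_on (Q `*` [set: R]) (fun z : 'rV[R]_3 * R => Phi z.2 z.1)].

Definition volume_preserving (R : realType) (Q : set 'rV[R]_3)
    (Phi : R -> 'rV[R]_3 -> 'rV[R]_3) : Prop :=
  forall t (O : set 'rV[R]_3), open O ->
    volume (Q `&` O) = volume (Phi t @` (Q `&` O)).

Definition generator (R : realType) (Phi : R -> 'rV[R]_3 -> 'rV[R]_3)
    (x : 'rV[R]_3) : 'rV[R]_3 := derive1 (fun t : R => Phi t x) 0.

Definition circle_integral (R : realType) (f : R -> R) : R :=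
  \int[@lebesgue_measure R]_(t in `[0, 2 * pi]) f t.

(* (1 / 2 pi) \int_0^{2 pi} (Phi_t^* g)_x(w1, w2) dt with g Euclidean. *)
Definition avg_metric (R : realType) (Q : set 'rV[R]_3)
    (Phi : R -> 'rV[R]_3 -> 'rV[R]_3) (x w1 w2 : 'rV[R]_3) : R :=
  (2 * pi)^-1 *
  circle_integral (fun t => dot (dder Q (Phi t) x w1) (dder Q (Phi t) x w2)).

Definition avg_density (R : realType) (Q : set 'rV[R]_3)
    (Phi : R -> 'rV[R]_3 -> 'rV[R]_3) (x : 'rV[R]_3) : R :=
  Num.sqrt (\det (\matrix_(i < 3, j < 3)
    avg_metric Q Phi x (basis R i) (basis R j))).

Definition avg_dot (R : realType) (Q : set 'rV[R]_3)
    (Phi : R -> 'rV[R]_3 -> 'rV[R]_3) (w1 w2 : 'rV[R]_3 -> 'rV[R]_3)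
    (x : 'rV[R]_3) : R := avg_metric Q Phi x (w1 x) (w2 x).

(* The C^oo vector field on Q satisfying P.  In the uses below P determines the
   field on Q; its values outside Q are irrelevant. *)
Definition the_field (R : realType) (Q : set 'rV[R]_3)
    (P : ('rV[R]_3 -> 'rV[R]_3) -> Prop) : 'rV[R]_3 -> 'rV[R]_3 :=
  get [set w | smooth_on Q w /\ P w].

Definition avg_cross (R : realType) (Q : set 'rV[R]_3)
    (Phi : R -> 'rV[R]_3 -> 'rV[R]_3) (w1 w2 : 'rV[R]_3 -> 'rV[R]_3) :
    'rV[R]_3 -> 'rV[R]_3 :=
  the_field Q (fun w => forall v : 'rV[R]_3 -> 'rV[R]_3, smooth_on Q v ->
    forall x, Q x ->
      avg_dot Q Phi w v x =
      avg_density Q Phi x * dot (cross (w1 x) (w2 x)) (v x)).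

Definition avg_grad (R : realType) (Q : set 'rV[R]_3)
    (Phi : R -> 'rV[R]_3 -> 'rV[R]_3) (phi : 'rV[R]_3 -> R) :
    'rV[R]_3 -> 'rV[R]_3 :=
  the_field Q (fun w => forall v : 'rV[R]_3 -> 'rV[R]_3, smooth_on Q v ->
    forall x, Q x -> avg_dot Q Phi w v x = dot (grad Q phi x) (v x)).

Definition avg_div (R : realType) (Q : set 'rV[R]_3)
    (Phi : R -> 'rV[R]_3 -> 'rV[R]_3) (w : 'rV[R]_3 -> 'rV[R]_3)
    (x : 'rV[R]_3) : R :=
  (avg_density Q Phi x)^-1 *
  divergence Q (fun y => avg_density Q Phi y *: w y) x.

Definition avg_curl (R : realType) (Q : set 'rV[R]_3)
    (Phi : R -> 'rV[R]_3 -> 'rV[R]_3) (w : 'rV[R]_3 -> 'rV[R]_3) :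
    'rV[R]_3 -> 'rV[R]_3 :=
  the_field Q (fun c => forall v1 v2 : 'rV[R]_3 -> 'rV[R]_3,
    smooth_on Q v1 -> smooth_on Q v2 -> forall x, Q x ->
      avg_dot Q Phi c (avg_cross Q Phi v1 v2) x =
        avg_dot Q Phi v1 (avg_grad Q Phi (avg_dot Q Phi w v2)) x
        - avg_dot Q Phi v2 (avg_grad Q Phi (avg_dot Q Phi w v1)) x
        - avg_dot Q Phi w (commutator Q v1 v2) x).

(* R^2 = u .bar u, where u is the generator *)
Definition gen_norm2 (R : realType) (Q : set 'rV[R]_3)
    (Phi : R -> 'rV[R]_3 -> 'rV[R]_3) : 'rV[R]_3 -> R :=
  avg_dot Q Phi (generator Phi) (generator Phi).

(* u / R^2 *)
Definition gen_normalized (R : realType) (Q : set 'rV[R]_3)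
    (Phi : R -> 'rV[R]_3 -> 'rV[R]_3) (x : 'rV[R]_3) : 'rV[R]_3 :=
  (gen_norm2 Q Phi x)^-1 *: generator Phi x.

Definition grad_shafranov (R : realType) (Q : set 'rV[R]_3)
    (Phi : R -> 'rV[R]_3 -> 'rV[R]_3) (C p : R -> R) (psi : 'rV[R]_3 -> R) :
    Prop :=
  let rho := avg_density Q Phi in
  let R2 := gen_norm2 Q Phi in
  let eta := gen_normalized Q Phi in
  forall x, Q x ->
    - avg_div Q Phi (fun y => ((R2 y)^-1 * rho y) *: avg_grad Q Phi psi y) x
    + C (psi x) * avg_dot Q Phi eta (avg_curl Q Phi eta) x
    = (derive1 p (psi x) + (R2 x)^-1 * C (psi x) * derive1 C (psi x)) / rho x.

Definition gs_field (R : realType) (Q : set 'rV[R]_3)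
    (Phi : R -> 'rV[R]_3 -> 'rV[R]_3) (C : R -> R) (psi : 'rV[R]_3 -> R)
    (x : 'rV[R]_3) : 'rV[R]_3 :=
  C (psi x) *: gen_normalized Q Phi x
  + (avg_density Q Phi x / gen_norm2 Q Phi x) *:
      avg_cross Q Phi (avg_grad Q Phi psi) (generator Phi) x.

(* Main.v *)
(* Averaging over the circle makes the generator u a Killing field of the averaged
   metric gbar: the Lie derivative of gbar along u is the integral over a period of
   the time derivative of the pulled-back metric.  Volume preservation gives
   div u = 0: were div u < 0 at an interior point, the flow, which is close to a
   product of two triangular linear maps, would send a small box into a box of
   smaller volume; reversing time excludes div u > 0.  Hence every field built from
   gbar, u and psi is invariant under the flow.

   Let a = gbar(u, .) / R^2.  From L_u a = 0 and a(u) = 1 follows that curl a is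
   parallel to u, so curl a = l u with l = a . curl a.  With
   q = (rho^2 / R^2) gradbar psi one gets B = C u / R^2 + grad psi x a and
   gbar(B, .) = C a + q x u, all products being Euclidean, whence div B = 0 and
   curl (gbar(B, .)) = C' grad psi x a + (C l - div q) u.  The Grad-Shafranov
   equation says that this is C' B + p' u, and its cross product with B is
   p' grad psi = grad (p o psi): the averaged force balance.

   Finally B, being invariant, is transported by the flow, so the pullback by Phi_t
   of (curl B) x B is the contraction with B of the curl of the pulled-back covector
   field; averaging over t replaces the latter by gbar(B, .). *)

From HB Require Import structures.
Require Import Defs.
From mathcomp Require Import all_boot all_order all_algebra.
From mathcomp Require Import all_classical all_reals all_analysis.
From mathcomp Require Import ring lra measurable_realfun.
Set Implicit Arguments.
Unset Strict Implicit.
Unset Printing Implicit Defensive.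
Import Order.TTheory GRing.Theory Num.Theory.
Import numFieldNormedType.Exports.
Local Open Scope classical_set_scope.
Local Open Scope ring_scope.

(** * Functions of class C^k *)

Section Lines.
Context {R : realType} {V : normedModType R}.
Implicit Types (f : V -> R) (x v w : V).

(** [Ck] speaks of directional derivatives only, so linearity in the direction, the chain rule and
    the symmetry of second derivatives are drawn from the mean value theorem on segments and the
    continuity of the derivatives. Derivatives on [Q] go through an arbitrary extension and are
    meaningful only if [Q] lies in the closure of its interior. For a [Q] given by a diffeomorphism
    with the solid torus this is a form of invariance of domain, obtained here by minimising the
    distance from a nearby point to the compact set [Q]. Boxes are used because their volume needs
    only iterated integrals over intervals: a unit triangular shear keeps the length of every
    section. The error of the comparison has to be small relative to [t], hence the two-variable
    mean value estimate on the flow. Averaged fields are chosen by a defining property, so each is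
    identified with an explicit formula in the matrix of the averaged metric. Invariance is a
    vanishing Lie derivative in coordinates, whose closure properties are mostly polynomial
    identities; only the final average needs transport for finite times, recovered by uniqueness for
    a linear differential equation. *)

Lemma is_derive_line (W : normedModType R) (f : V -> W) x v (t : R) :
  derivable f (x + t *: v) v ->
  is_derive t 1 (fun s : R => f (x + s *: v)) ('D_v f (x + t *: v)).
Proof.
have E : (fun h : R => h^-1 *: (((fun s : R => f (x + s *: v)) \o shift t) (h *: 1)
           - f (x + t *: v))) =
         (fun h : R => h^-1 *: ((f \o shift (x + t *: v)) (h *: v) - f (x + t *: v))).
  apply/funext => h /=; congr (_ *: (f _ - _)).
  by rewrite scalerDl [h *: 1]mulr1 addrCA.
by move=> df; apply: DeriveDef; rewrite /derivable /derive E.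
Qed.

Lemma MVT_line f x v :
  (forall t : R, 0 <= t <= 1 -> derivable f (x + t *: v) v) ->
  exists2 t : R, 0 <= t <= 1 & f (x + v) - f x = 'D_v f (x + t *: v).
Proof.
move=> df.
have [|||c] := @MVT_segment R (fun s => f (x + s *: v))
    (fun s => 'D_v f (x + s *: v)) 0 1.
- exact: ler01.
- move=> t; rewrite in_itv /= => /andP[t0 t1]; apply: is_derive_line.
  by apply: df; rewrite !ltW.
- apply: derivable_within_continuous => t; rewrite in_itv /= => t01.
  exact: (@ex_derive _ _ _ _ _ _ _ (is_derive_line (df _ t01))).
rewrite in_itv /= => c01; rewrite scale1r scale0r addr0 subr0 mulr1 => E.
by exists c.
Qed.

(** Reduces a derivative in a direction to a one-variable derivative at 0, where the rules for
    functions of a real variable apply. *)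
Lemma is_derive_lineP (W : normedModType R) (f : V -> W) x v (df : W) :
  is_derive (0 : R) 1 (fun s : R => f (x + s *: v)) df <-> is_derive x v f df.
Proof.
have E : (fun h : R => h^-1 *: (((fun s : R => f (x + s *: v)) \o shift 0) (h *: 1)
           - f (x + 0 *: v))) =
         (fun h : R => h^-1 *: ((f \o shift x) (h *: v) - f x)).
  apply/funext => h /=; congr (_ *: (f _ - f _)).
    by rewrite addr0 [h *: 1]mulr1 addrC.
  by rewrite scale0r addr0.
have Ed := congr1 (fun F => cvg (F @ 0^')) E.
have El := congr1 (fun F => lim (F @ 0^')) E.
split=> -[H1 H2]; apply: DeriveDef.
- by rewrite -[derivable _ _ _]Ed.
- by rewrite -[derive _ _ _]El.
- by rewrite -[derivable _ _ _]/(cvg (_ @ 0^')) Ed.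
- by rewrite -[derive _ _ _]/(lim (_ @ 0^')) El.
Qed.

Lemma is_deriveZdir f x v (k : R) (df : R) :
  is_derive x v f df -> is_derive x (k *: v) f (k * df).
Proof.
move=> /is_derive_lineP df1; apply/is_derive_lineP.
have -> : (fun s : R => f (x + s *: (k *: v))) =
    (fun s => f (x + s *: v)) \o (fun s => k * s).
  by apply/funext => s /=; rewrite scalerA mulrC.
have dk : is_derive (0 : R) 1 (fun s : R => k * s) k.
  rewrite -[X in is_derive _ _ _ X](mulr1 k); exact: is_deriveZ.
rewrite mulrC; apply: is_derive1_comp => //; by rewrite mulr0.
Qed.

Lemma is_derive_derivable (W : normedModType R) (f : V -> W) x v df :
  is_derive x v f df -> derivable f x v.
Proof. by case. Qed.

Lemma is_derive_cvgP f x v (df : R) :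
  is_derive x v f df <->
  (fun h : R => h^-1 * (f (x + h *: v) - f x)) @ 0^' --> df.
Proof.
have E : (fun h : R => h^-1 *: ((f \o shift x) (h *: v) - f x)) =
         (fun h : R => h^-1 * (f (x + h *: v) - f x)).
  by apply/funext => h /=; rewrite [h *: v + x]addrC.
have Ed := congr1 (fun F => cvg (F @ 0^')) E.
have El := congr1 (fun F => lim (F @ 0^')) E.
split=> [[H1 <-]|H].
  have {}H1 : cvg ((fun h : R => h^-1 * (f (x + h *: v) - f x)) @ 0^').
    by rewrite -Ed.
  by rewrite -[derive _ _ _]/(lim (_ @ 0^')) El.
have Hl : lim ((fun h : R => h^-1 * (f (x + h *: v) - f x)) @ 0^') = df.
  exact: cvg_lim.
apply: DeriveDef.
  by rewrite -[derivable _ _ _]/(cvg (_ @ 0^')) Ed; apply/cvg_ex; exists df.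
by rewrite -[derive _ _ _]/(lim (_ @ 0^')) El.
Qed.

(** The increment along [h *: (v + w)] is the increment along [h *: v] plus the one along [h *: w]
    from the displaced point; the mean value theorem writes the latter as [h] times ['D_w f] at a
    point close to [x], where continuity applies. *)
Lemma is_deriveDdir f (U : set V) x v w :
  open U -> U x ->
  derivable f x v ->
  (forall y, U y -> derivable f y w) ->
  {for x, continuous ('D_w f)} ->
  is_derive x (v + w) f ('D_v f x + 'D_w f x).
Proof.
move=> Uo Ux dv dw cw.
apply/is_derive_cvgP/cvgrPdist_le => e e0.
have e20 : 0 < e / 2 by rewrite divr_gt0.
have /is_derive_cvgP/cvgrPdist_le/(_ _ e20) Hv : is_derive x v f ('D_v f x).
  exact: derivableP.
have /cvgrPdist_le/(_ _ e20) Hw := cw.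
have : \forall y \near x, U y /\ `|'D_w f x - 'D_w f y| <= e / 2.
  near=> y; split; last by near: y.
  by near: y; exact: open_nbhs_nbhs.
move=> /nbhs_ballP[d /= d0 Hd].
have M0 : 0 < `|v| + `|w| + 1 by rewrite ltr_wpDl// addr_ge0.
near=> h.
have h0 : h != 0 by near: h; exact: nbhs_dnbhs_neq.
have hd : `|h| * (`|v| + `|w| + 1) < d.
  rewrite -ltr_pdivlMr//; near: h.
  by apply: dnbhs0_lt; rewrite divr_gt0.
have B t : 0 <= t <= 1 -> ball x d (x + h *: v + t *: (h *: w)).
  move=> /andP[t0 t1]; rewrite -ball_normE /= -addrA opprD addNKr normrN.
  apply: le_lt_trans hd; rewrite (le_trans (ler_normD _ _))//.
  rewrite !normrZ (ger0_norm t0) !mulrDr mulr1 -addrA lerD2l.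
  by rewrite ler_wpDr// ler_piMl// mulr_ge0.
have [|t t01 E] := @MVT_line f (x + h *: v) (h *: w).
  move=> t t01; have [Ut _] := Hd _ (B _ t01).
  by apply: (is_derive_derivable (is_deriveZdir h (derivableP (dw _ Ut)))).
have [Ut Dt] := Hd _ (B _ t01).
have EZ := @derive_val _ _ _ _ _ _ _ (is_deriveZdir h (derivableP (dw _ Ut))).
have -> : h^-1 * (f (x + h *: (v + w)) - f x) =
   h^-1 * (f (x + h *: v) - f x) + 'D_w f (x + h *: v + t *: (h *: w)).
  rewrite scalerDr addrA -(subrK (f (x + h *: v)) (f (_ + h *: w))) E EZ.
  by field.
rewrite opprD addrACA (splitr e) (le_trans (ler_normD _ _))// lerD//.
by near: h.
Unshelve. all: by end_near. Qed.

End Lines.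

Section CkGeneral.
Context {R : realType}.
Implicit Types V W : normedModType R.

Lemma Ck_cont V W k (U : set V) (f : V -> W) x :
  Ck k U f -> U x -> {for x, continuous f}.
Proof. by case: k => [|k] [H _]; exact: H. Qed.

Lemma Ck_derivable V W k (U : set V) (f : V -> W) x v :
  Ck k.+1 U f -> U x -> derivable f x v.
Proof. by move=> [_ /(_ v)[H _]]; exact: H. Qed.

Lemma Ck_derive V W k (U : set V) (f : V -> W) v :
  Ck k.+1 U f -> Ck k U ('D_v f).
Proof. by move=> [_ /(_ v)[_ H]]. Qed.

Lemma Ck_subset V W k (U U' : set V) (f : V -> W) :
  U' `<=` U -> Ck k U f -> Ck k U' f.
Proof.
move=> UU'; elim: k f => [|k IH] f [cf df]; split=> //.
- by move=> x /UU'/cf.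
- by move=> x /UU'/cf.
- by move=> v; have [d c] := df v; split; [move=> x /UU'/d|exact: IH].
Qed.

Lemma Ck_pred V W k (U : set V) (f : V -> W) : Ck k.+1 U f -> Ck k U f.
Proof.
elim: k f => [|k IH] f [cf df]; split=> // v.
by have [d c] := df v; split=> //; exact: IH.
Qed.

Lemma eq_Ck V W k (U : set V) (f g : V -> W) : open U ->
  {in U, f =1 g} -> Ck k U f -> Ck k U g.
Proof.
move=> Uo; elim: k f g => [|k IH] f g fg [cf df].
  split=> // x Ux; rewrite /prop_for /continuous_at -(fg x) ?inE//.
  apply: cvg_trans (cf _ Ux); apply: near_eq_cvg; near=> y.
  by rewrite /= fg// inE; near: y; exact: open_nbhs_nbhs.
have nfg x : U x -> \near x, f x = g x.
  move=> Ux; near=> y; apply: fg; rewrite inE; near: y.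
  exact: open_nbhs_nbhs.
split=> [x Ux|v].
  rewrite /prop_for /continuous_at -(fg x) ?inE//.
  apply: cvg_trans (cf _ Ux); apply: near_eq_cvg; near=> y.
  by rewrite /= fg// inE; near: y; exact: open_nbhs_nbhs.
have [d c] := df v; split=> [x Ux|].
  by apply: near_eq_derivable (d _ Ux); exact: nfg.
apply: IH c => x; rewrite inE => Ux.
by apply: near_eq_derive; exact: nfg.
Unshelve. all: by end_near. Qed.

Lemma Ck_cst V W k (U : set V) (c : W) : Ck k U (cst c).
Proof.
elim: k c => [|k IH] c; split=> //; try by move=> x _; exact: cst_continuous.
move=> v; split=> [x _|]; first exact: derivable_cst.
have -> : 'D_v (cst c : V -> W) = cst 0 by apply/funext => x; exact: derive_cst.
exact: IH.
Qed.

Lemma CkD V W k (U : set V) (f g : V -> W) : open U ->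
  Ck k U f -> Ck k U g -> Ck k U (f + g).
Proof.
move=> Uo; elim: k f g => [|k IH] f g [cf df] [cg dg]; split=> //.
- by move=> x Ux; apply: continuousD; [exact: cf|exact: cg].
- by move=> x Ux; apply: continuousD; [exact: cf|exact: cg].
- move=> v; have [df1 df2] := df v; have [dg1 dg2] := dg v; split=> [x Ux|].
    by apply: derivableD; [exact: df1|exact: dg1].
  apply: eq_Ck (IH _ _ df2 dg2) => // x; rewrite inE => Ux.
  by rewrite deriveD//; [exact: df1|exact: dg1].
Qed.

Lemma linear_map0 V W (L : V -> W) : linear L -> L 0 = 0.
Proof.
move=> lL; have /eqP := lL 1 0 0.
by rewrite !scale1r addr0 -subr_eq subrr => /eqP.
Qed.

Lemma linear_mapZ V W (L : V -> W) k x : linear L -> L (k *: x) = k *: L x.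
Proof.
by move=> lL; have := lL k x 0; rewrite (linear_map0 lL) !addr0.
Qed.

Lemma linear_mapB V W (L : V -> W) x y : linear L -> L (x - y) = L x - L y.
Proof.
by move=> lL; have := lL (-1) y x; rewrite !scaleN1r !(addrC (- _)).
Qed.

Lemma is_derive_lin V W W' (L : W -> W') (f : V -> W) x v df :
  linear L -> continuous L ->
  is_derive x v f df -> is_derive x v (L \o f) (L df).
Proof.
move=> lL cL [dfx <-].
have E : (fun h : R => h^-1 *: (((L \o f) \o shift x) (h *: v) - (L \o f) x)) =
  L \o (fun h : R => h^-1 *: ((f \o shift x) (h *: v) - f x)).
  apply/funext => h /=.
  by rewrite (linear_mapZ _ _ lL) (linear_mapB _ _ lL).
have H : (fun h : R => h^-1 *: (((L \o f) \o shift x) (h *: v) - (L \o f) x)) @ 0^'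
    --> L ('D_v f x).
  by rewrite E; apply: continuous_cvg; [exact: cL|exact: dfx].
by apply: DeriveDef; [apply/cvg_ex; exists (L ('D_v f x))|apply: cvg_lim].
Qed.

Lemma Ck_lin V W W' k (U : set V) (L : W -> W') (f : V -> W) :
  open U -> linear L -> continuous L -> Ck k U f -> Ck k U (L \o f).
Proof.
move=> Uo lL cL; elim: k f => [|k IH] f [cf df]; split=> //.
- by move=> x Ux; apply: continuous_comp; [exact: cf|exact: cL].
- by move=> x Ux; apply: continuous_comp; [exact: cf|exact: cL].
- move=> v; have [df1 df2] := df v.
  have dL x : U x -> is_derive x v (L \o f) (L ('D_v f x)).
    by move=> Ux; apply: is_derive_lin => //; exact/derivableP/df1.
  split=> [x /dL[]//|].
  apply: eq_Ck (IH _ df2) => // x; rewrite inE => /dL[_ ->] //.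
Qed.

(* [A0] is the linear part of the affine map [A]. *)
Lemma is_derive_affine V V' W (A A0 : V' -> V) (f : V -> W) x v df :
  (forall y w (h : R), A (y + h *: w) = A y + h *: A0 w) ->
  is_derive (A x) (A0 v) f df -> is_derive x v (f \o A) df.
Proof.
move=> HA /is_derive_lineP H; apply/is_derive_lineP.
by move: H; congr is_derive; apply/funext => s /=; rewrite HA.
Qed.

Lemma Ck_affine V V' W k (U : set V) (A A0 : V' -> V) (f : V -> W) :
  open U -> continuous A ->
  (forall y w (h : R), A (y + h *: w) = A y + h *: A0 w) ->
  Ck k U f -> Ck k (A @^-1` U) (f \o A).
Proof.
move=> Uo cA HA; have AUo : open (A @^-1` U) by apply: open_comp => // x _; exact: cA.
elim: k f => [|k IH] f [cf df]; split=> //.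
- by move=> x Ux; apply: continuous_comp; [exact: cA|exact: cf].
- by move=> x Ux; apply: continuous_comp; [exact: cA|exact: cf].
- move=> v; have [df1 df2] := df (A0 v).
  have dL x : U (A x) -> is_derive x v (f \o A) ('D_(A0 v) f (A x)).
    by move=> Ux; apply: is_derive_affine => //; exact/derivableP/df1.
  split=> [x /dL[]//|].
  by apply: eq_Ck (IH _ df2) => // x; rewrite inE => /dL[_ ->].
Qed.

Lemma Ck_linear V W k (U : set V) (L : V -> W) :
  linear L -> continuous L -> Ck k U L.
Proof.
move=> lL cL.
have dL x v : is_derive x v L (L v).
  have := is_derive_lin lL cL (is_derive_id x v); exact.
case: k => [|k]; split=> //; try by move=> x _; exact: cL.
move=> v; split=> [x _|]; first by case: (dL x v).
have -> : 'D_v L = cst (L v) by apply/funext => x; case: (dL x v).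
exact: Ck_cst.
Qed.

End CkGeneral.

Section CkScalar.
Context {R : realType} {V : normedModType R}.
Variable U : set V.
Hypothesis Uo : open U.
Implicit Types f g : V -> R.

Lemma CkM k f g : Ck k U f -> Ck k U g -> Ck k U (f \* g).
Proof.
elim: k f g => [|k IH] f g Cf Cg; have [cf df] := Cf; have [cg dg] := Cg; split=> //.
- by move=> x Ux; apply: continuousM; [exact: cf|exact: cg].
- by move=> x Ux; apply: continuousM; [exact: cf|exact: cg].
- move=> v; have [df1 df2] := df v; have [dg1 dg2] := dg v; split=> [x Ux|].
    by apply: (@derivableM _ _ f g); [exact: df1|exact: dg1].
  have Cf' := Ck_pred Cf; have Cg' := Ck_pred Cg.
  apply: eq_Ck (CkD Uo (IH _ _ Cf' dg2) (IH _ _ Cg' df2)) => // x.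
  rewrite inE => Ux.
  by rewrite (@deriveM _ _ f g)//; [exact: df1|exact: dg1].
Qed.

Lemma Ck_sum I (r : seq I) k (F : I -> V -> R) :
  (forall i, Ck k U (F i)) -> Ck k U (fun x => \sum_(i <- r) F i x).
Proof.
move=> CF; elim: r => [|i r IH].
  apply: eq_Ck (Ck_cst k U (0 : R)) => // x _; by rewrite big_nil.
apply: eq_Ck (CkD Uo (CF i) IH) => // x _; by rewrite big_cons.
Qed.

End CkScalar.

(** * Chain rule and symmetry of second derivatives *)

Section Chain.
Context {R : realType}.

Lemma Ck1_deriveD (V : normedModType R) (U : set V) (f : V -> R) x v w :
  open U -> Ck 1 U f -> U x -> 'D_(v + w) f x = 'D_v f x + 'D_w f x.
Proof.
move=> Uo Cf Ux.
have H : is_derive x (v + w) f ('D_v f x + 'D_w f x).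
  apply: (is_deriveDdir Uo Ux); first exact: Ck_derivable Cf Ux.
    by move=> y Uy; apply: Ck_derivable Cf Uy.
  exact: (Ck_cont (Ck_derive w Cf)).
by case: H.
Qed.

Lemma Ck1_deriveZ (V : normedModType R) (U : set V) (f : V -> R) x v k :
  Ck 1 U f -> U x -> 'D_(k *: v) f x = k * 'D_v f x.
Proof.
move=> Cf Ux.
by have [] := is_deriveZdir k (derivableP (Ck_derivable (v := v) Cf Ux)).
Qed.

Lemma Ck1_derive_sum (V : normedModType R) (U : set V) (f : V -> R) x
    n (c : 'I_n -> R) (e : 'I_n -> V) :
  open U -> Ck 1 U f -> U x ->
  'D_(\sum_i c i *: e i) f x = \sum_i c i * 'D_(e i) f x.
Proof.
move=> Uo Cf Ux; pose K (v : V) (r : R) := 'D_v f x = r.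
apply: (big_ind2 K).
- by rewrite /K derive0.
- by move=> v r w s <- <-; apply: Ck1_deriveD Cf Ux.
- by move=> i _; apply: Ck1_deriveZ Cf Ux.
Qed.

Lemma Ck1_derive_rV n (U : set 'rV[R]_n) (f : 'rV[R]_n -> R) x v :
  open U -> Ck 1 U f -> U x ->
  'D_v f x = \sum_i v 0 i * 'D_(delta_mx 0 i) f x.
Proof.
by move=> Uo Cf Ux; rewrite {1}[v]row_sum_delta; apply: Ck1_derive_sum Cf Ux.
Qed.

Lemma cvg_sumr T (F : set_system T) {FF : Filter F} I (r : seq I)
    (f : I -> T -> R) (a : I -> R) :
  (forall i, f i @ F --> a i) ->
  (fun x => \sum_(i <- r) f i x) @ F --> \sum_(i <- r) a i.
Proof.
move=> fa; elim: r => [|i r IH].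
  rewrite big_nil; under eq_fun do rewrite big_nil; exact: cvg_cst.
rewrite big_cons; under eq_fun do rewrite big_cons; exact: cvgD.
Qed.

(** The mean value theorem on the segment from [f x] to [f (x + s *: v)] gives the increment of [h]
    as a derivative at an intermediate point [z s]. Expanded in the basis, it is a sum of difference
    quotients of the coordinates of [f] times partial derivatives of [h] at [z s], and [z s] tends
    to [f x]. *)
Lemma is_derive_comp_rV (V : normedModType R) n (U : set 'rV[R]_n)
    (h : 'rV[R]_n -> R) (f : V -> 'rV[R]_n) x v df :
  open U -> Ck 1 U h -> U (f x) ->
  is_derive x v f df -> is_derive x v (h \o f) ('D_df h (f x)).
Proof.
move=> Uo Ch Ux dfx; apply/is_derive_lineP.
pose g (s : R) := f (x + s *: v).
have g0 : g 0 = f x by rewrite /g scale0r addr0.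
have dg : is_derive (0 : R) 1 g df by apply/is_derive_lineP.
rewrite -g0 in Ux *.
have cg : {for (0 : R), continuous g}.
  exact/differentiable_continuous/derivable1_diffP/(is_derive_derivable dg).
pose P (s t : R) := 0 <= t <= 1 /\ h (g s) - h (g 0) = 'D_(g s - g 0) h (g 0 + t *: (g s - g 0)).
(* A mean value parameter for each [s]; by [thP] the default 0 can stand for a missing one only when
   [s] is away from 0. *)
pose th s := xget 0 (P s).
have [d /= d0 Bd] : exists2 d, 0 < d & ball (g 0) d `<=` U.
  have /nbhs_ballP[d /= d0 Bd] : nbhs (g 0) U by exact: open_nbhs_nbhs.
  by exists d.
have nearB : \forall s \near (0 : R), `|g s - g 0| < d.
  have /cvgrPdist_lt/(_ _ d0) H := cg.
  by near=> s; rewrite distrC; near: s.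
have inB s (t : R) : `|g s - g 0| < d -> 0 <= t <= 1 -> U (g 0 + t *: (g s - g 0)).
  move=> Bs /andP[t0 t1]; apply: Bd; rewrite -ball_normE /= opprD addNKr normrN.
  by rewrite normrZ (ger0_norm t0); apply: le_lt_trans Bs; rewrite ler_piMl.
have thP s : `|g s - g 0| < d -> P s (th s).
  move=> Bs; rewrite /th; case: xgetP => [t -> //|].
  have [|t t01 E] := @MVT_line _ _ h (g 0) (g s - g 0).
    move=> t t01; apply: (Ck_derivable Ch); exact: inB.
  move=> /(_ t) []; split=> //; rewrite -E; congr (h _ - _).
  by rewrite addrC subrK.
pose z s := g 0 + th s *: (g s - g 0).
have cz : z @ (0 : R)^' --> g 0.
  apply/cvgrPdist_lt => e e0.
  near=> s; have Bs : `|g s - g 0| < d.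
    by near: s; apply: cvg_within; exact: nearB.
  have [/andP[t0 t1] _] := thP _ Bs.
  rewrite opprD addNKr normrN normrZ (ger0_norm t0).
  apply: le_lt_trans (_ : `|g s - g 0| < e); first by rewrite ler_piMl.
  near: s; apply: cvg_within; have /cvgrPdist_lt/(_ _ e0) H := cg.
  by near=> s; rewrite distrC; near: s.
apply/is_derive_cvgP.
rewrite (Ck1_derive_rV _ Uo Ch Ux).
apply: (@cvg_trans _ ((fun s => \sum_i (s^-1 * (g s - g 0) 0 i) *
    'D_(delta_mx 0 i) h (z s)) @ (0 : R)^')).
  apply: near_eq_cvg; near=> s.
  have Bs : `|g s - g 0| < d.
    by near: s; apply: cvg_within; exact: nearB.
  have [t01 E] := thP _ Bs.
  rewrite add0r [s *: 1]mulr1 /= -!/(g _) E.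
  rewrite (@Ck1_derive_rV _ _ _ _ _ Uo Ch) -/(z s); last exact: inB.
  by rewrite mulr_sumr; apply: eq_bigr => i _; rewrite mulrA.
apply: cvg_sumr => i; apply: cvgM.
  have /is_derive_cvgP : is_derive (0 : R) 1 (fun s => g s 0 i) (df 0 i).
    apply: (is_derive_lin (L := fun M : 'rV_n => M 0 i)) dg.
      by move=> a u w; rewrite !mxE.
    exact: coord_continuous.
  apply: cvg_trans; apply: near_eq_cvg; near=> s.
  by rewrite add0r [s *: 1]mulr1 !mxE.
have cD := Ck_cont (Ck_derive (delta_mx 0 i) Ch) Ux.
exact: (cvg_comp _ _ cz cD).
Unshelve. all: by end_near. Qed.

End Chain.

Section Schwarz.
Context {R : realType} {V : normedModType R}.
Variables (U : set V) (f : V -> R) (x : V).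
Hypotheses (Uo : open U) (Cf : Ck 2 U f) (Ux : U x).

(** Two mean values: for [y |-> f (y + s *: w) - f y] along [s *: v], and for ['D_v f] along
    [s *: w]. The second difference equals [s ^+ 2] times ['D_w ('D_v f)] at a point of the
    parallelogram. *)
Lemma second_difference (v w : V) (e : R) : 0 < e ->
  \forall s \near (0 : R)^',
   `|(f (x + s *: v + s *: w) - f (x + s *: v) - (f (x + s *: w) - f x)) / s ^+ 2
     - 'D_w ('D_v f) x| <= e.
Proof.
move=> e0.
have cD : {for x, continuous ('D_w ('D_v f))}.
  by apply: Ck_cont Ux; do 2! apply: Ck_derive; exact: Cf.
have /cvgrPdist_le/(_ _ e0) Hw := cD.
have : \forall y \near x, U y /\ `|'D_w ('D_v f) x - 'D_w ('D_v f) y| <= e.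
  near=> y; split; last by near: y.
  by near: y; exact: open_nbhs_nbhs.
move=> /nbhs_ballP[d /= d0 Hd].
have M0 : 0 < `|v| + `|w| + 1 by rewrite ltr_wpDl// addr_ge0.
near=> s.
have s0 : s != 0 by near: s; exact: nbhs_dnbhs_neq.
have hd : `|s| * (`|v| + `|w| + 1) < d.
  by rewrite -ltr_pdivlMr//; near: s; apply: dnbhs0_lt; rewrite divr_gt0.
have B a b : 0 <= a <= 1 -> 0 <= b <= 1 ->
    ball x d (x + a *: (s *: v) + b *: (s *: w)).
  move=> /andP[a0 a1] /andP[b0 b1]; rewrite -ball_normE /= -addrA opprD addNKr normrN.
  apply: le_lt_trans hd; rewrite (le_trans (ler_normD _ _))//.
  rewrite !normrZ (ger0_norm a0) (ger0_norm b0) !mulrDr mulr1.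
  rewrite -addrA lerD//; first by rewrite ler_piMl// mulr_ge0.
  by rewrite ler_wpDr// ler_piMl// mulr_ge0.
have UB a b : 0 <= a <= 1 -> 0 <= b <= 1 -> U (x + a *: (s *: v) + b *: (s *: w)).
  by move=> a01 b01; have [] := Hd _ (B _ _ a01 b01).
have I0 : 0 <= (0 : R) <= 1 by rewrite lexx ler01.
have I1 : 0 <= (1 : R) <= 1 by rewrite lexx ler01.
have dg a : 0 <= a <= 1 ->
  is_derive (x + a *: (s *: v)) (s *: v) (fun y => f (y + s *: w) - f y)
    (s * 'D_v f (x + a *: (s *: v) + s *: w) - s * 'D_v f (x + a *: (s *: v))).
  move=> a01; apply: is_deriveB; last first.
    apply: is_deriveZdir; apply/derivableP.
    apply: (Ck_derivable Cf); have := UB _ _ a01 I0.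
    by rewrite scale0r addr0.
  apply: (@is_derive_affine R V V R (fun y => y + s *: w) id).
    by move=> y u h; rewrite addrAC.
  apply: is_deriveZdir; apply/derivableP.
  apply: (Ck_derivable Cf); have := UB _ _ a01 I1.
  by rewrite scale1r.
have [a a01 Ea] := MVT_line (fun a a01 => is_derive_derivable (dg a a01)).
have [_ Da] := dg _ a01; rewrite Da in Ea.
have dD b : 0 <= b <= 1 ->
  is_derive (x + a *: (s *: v) + b *: (s *: w)) (s *: w) ('D_v f)
    (s * 'D_w ('D_v f) (x + a *: (s *: v) + b *: (s *: w))).
  move=> b01; apply: is_deriveZdir; apply/derivableP.
  apply: (@Ck_derivable _ _ _ 0 U); first exact: Ck_derive.
  exact: UB.
have [b b01 Eb] := MVT_line (fun b b01 => is_derive_derivable (dD b b01)).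
have [_ Db] := dD _ b01; rewrite Db in Eb.
rewrite Ea -mulrBr Eb mulrA -expr2 mulrAC mulfV ?expf_neq0// mul1r distrC.
by have [_] := Hd _ (B _ _ a01 b01).
Unshelve. all: by end_near. Qed.

End Schwarz.

(** The second difference is symmetric in [v] and [w], and after division by [s ^+ 2] it is within
    [e / 2] of both mixed derivatives. *)
Lemma Schwarz (R : realType) (V : normedModType R) (U : set V) (f : V -> R) x v w :
  open U -> Ck 2 U f -> U x -> 'D_v ('D_w f) x = 'D_w ('D_v f) x.
Proof.
move=> Uo Cf Ux; apply/eqP; rewrite -subr_eq0 -normr_le0.
apply/ler_addgt0Pr => e e0; rewrite add0r.
have e20 : 0 < e / 2 by rewrite divr_gt0.
have H1 := second_difference Uo Cf Ux v w e20.
have H2 := second_difference Uo Cf Ux w v e20.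
have [s [/= S1 S2]] := filter_ex (filterI H1 H2).
have E :
    f (x + s *: w + s *: v) - f (x + s *: w) - (f (x + s *: v) - f x) =
    f (x + s *: v + s *: w) - f (x + s *: v) - (f (x + s *: w) - f x).
  have E0 : x + s *: w + s *: v = x + s *: v + s *: w by rewrite addrAC.
  rewrite E0.
  have aux a b c d : a - b - (c - d) = a - c - (b - d) :> R by ring.
  exact: aux.
rewrite E in S2; rewrite distrC in S1.
rewrite distrC (splitr e); set A := (X in `|'D_w _ _ - X| <= _) in S1.
by rewrite -(subrKA A) (le_trans (ler_normD _ _))// lerD.
Unshelve. all: by end_near. Qed.

Section CkMore.
Context {R : realType}.

(** Induction on [k] with [h] varying and [f] fixed: the derivative is a sum of products of
    derivatives of [f] with partial derivatives of [h] composed with [f], to which the induction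
    hypothesis applies. *)
Lemma Ck_comp_rV (V : normedModType R) n k (U : set V) (O : set 'rV[R]_n)
    (h : 'rV[R]_n -> R) (f : V -> 'rV[R]_n) :
  open U -> open O -> (forall x, U x -> O (f x)) ->
  Ck k O h -> (forall i, Ck k U (fun x => f x 0 i)) ->
  {in U, continuous f} ->
  Ck k U (h \o f).
Proof.
move=> Uo Oo UO + + cf.
have chf g x : (forall y, O y -> {for y, continuous g}) -> U x ->
    {for x, continuous (g \o f : V -> R)}.
  move=> cg Ux; apply: continuous_comp; first by apply: cf; rewrite inE.
  by apply: cg; exact: UO.
elim: k h => [|k IH] h Ch Cf; split=> //; try by move=> x Ux; apply: chf Ux => y; exact: Ck_cont Ch.
move=> v.
have df x : U x -> derivable f x v.
  by move=> Ux; apply/derivable_mxP => i j; rewrite ord1; apply: Ck_derivable (Cf j) Ux.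
have D x : U x -> is_derive x v (h \o f)
    (\sum_i 'D_v (fun x => f x 0 i) x * 'D_(delta_mx 0 i) h (f x)).
  move=> Ux; have C1h : Ck 1 O h.
    by clear -Ch; elim: k Ch => // k IH /Ck_pred.
  have := is_derive_comp_rV Oo C1h (UO _ Ux) (derivableP (df _ Ux)).
  rewrite (Ck1_derive_rV _ Oo C1h (UO _ Ux)) derive_mx//; last exact: df.
  by congr is_derive; apply: eq_bigr => i _; rewrite mxE.
split=> [x /D[]//|].
apply: (@eq_Ck _ _ _ _ _ (fun x => \sum_i 'D_v (fun x => f x 0 i) x * 'D_(delta_mx 0 i) h (f x))) => //.
  by move=> x; rewrite inE => /D[_ ->].
apply: Ck_sum => // i; apply: (@CkM _ _ _ Uo); first exact: Ck_derive.
apply: (IH ('D_(delta_mx 0 i) h)); first exact: Ck_derive.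
by move=> j; exact: Ck_pred.
Qed.

Lemma Ck_comp_R (V : normedModType R) k (U : set V) (O : set R)
    (h : R -> R) (f : V -> R) :
  open U -> open O -> (forall x, U x -> O (f x)) ->
  Ck k O h -> Ck k U f -> Ck k U (h \o f).
Proof.
move=> Uo Oo UO Ch Cf.
pose A (y : 'rV[R]_1) := y 0 0.
have cA : continuous A by exact: coord_continuous.
have CA : Ck k (A @^-1` O) (h \o A).
  by apply: (@Ck_affine _ _ _ _ _ _ _ A) => // y w s; rewrite /A !mxE.
pose F x : 'rV[R]_1 := \row_i f x.
have -> : h \o f = (h \o A) \o F by apply/funext => x; rewrite /= /A mxE.
apply: Ck_comp_rV CA _ _ => //.
- exact: open_comp.
- by move=> x Ux; rewrite /A /= mxE; exact: UO.
- by move=> i; apply: eq_Ck Cf => // x _; rewrite mxE.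
- move=> x; rewrite inE => Ux; apply/cvgrPdist_le => e e0.
  have /cvgrPdist_le/(_ _ e0) := Ck_cont Cf Ux; apply: filterS => y H.
  rewrite /Num.Def.normr/= mx_normrE (bigmax_le _ (ltW e0))//= => -[i j] _.
  by rewrite !mxE.
Qed.

End CkMore.

Section Elementary.
Context {R : realType}.

Lemma open_neq0 : open [set r : R | r != 0].
Proof.
have -> : [set r : R | r != 0] = ~` [set 0].
  by apply/seteqP; split=> r /= /eqP.
exact/closed_openC/closed_eq.
Qed.

(** The derivative is a polynomial in the function itself, so the induction closes with the product
    rule. *)
Lemma Ck_inv k : Ck k [set r : R | r != 0] (fun r : R => r^-1).
Proof.
have Oo := open_neq0.
have ci r : r != 0 -> {for r, continuous (fun r : R => r^-1)} by exact: inv_continuous.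
elim: k => [|k IH]; split=> // v.
have D (r : R) : r != 0 -> is_derive r v (fun r : R => r^-1) (- v * (r^-1 * r^-1)).
  move=> r0; have := is_deriveV r0 (is_derive_id r v).
  by congr is_derive; rewrite -[_ *: _]/(_ * _) expr2 invfM !mulNr mulrC.
split=> [r /D[]//|].
apply: (@eq_Ck _ _ _ _ _ (fun r : R => - v * (r^-1 * r^-1))) => //.
  by move=> r; rewrite inE => /D[_ ->].
apply: (@CkM _ _ _ Oo _ (cst (- v))); first exact: Ck_cst.
exact: (@CkM _ _ _ Oo).
Qed.

Lemma Ck_sqrt k : Ck k [set r : R | 0 < r] (@Num.sqrt R).
Proof.
have Oo : open [set r : R | 0 < r] by exact: open_gt.
elim: k => [|k IH]; split=> //; try by move=> r _; exact: sqrt_continuous.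
move=> v.
have D (r : R) : 0 < r -> is_derive r v (@Num.sqrt R) (v / 2 * (Num.sqrt r)^-1).
  move=> r0; have := is_deriveZdir v (is_derive1_sqrt r0).
  rewrite -[v *: 1]/(v * 1) mulr1; congr is_derive.
  by rewrite invfM mulrA.
split=> [r /D[]//|].
apply: (@eq_Ck _ _ _ _ _ (fun r : R => v / 2 * (Num.sqrt r)^-1)) => //.
  by move=> r; rewrite inE => /D[_ ->].
apply: (@CkM _ _ _ Oo _ (cst (v / 2))); first exact: Ck_cst.
apply: (@Ck_comp_R _ _ _ _ [set r : R | r != 0] (fun r => r^-1)) => //.
- by move=> r /= r0; rewrite gt_eqF// sqrtr_gt0.
- exact: Ck_inv.
Qed.

End Elementary.

(** * Smooth functions on a set contained in the closure of its interior *)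

Section SmoothOn.
Context {R : realType} {V : normedModType R}.
Variable X : set V.
Hypothesis HX : X `<=` closure X°.

(** Two extensions coincide with [f] on an open set of interior points accumulating at [x], so their
    derivatives agree there; continuity of both derivatives and separation of [W] carry the equality
    to [x]. This is where [HX] makes [dder] independent of the choice. *)
Lemma dder_ext (W : normedModType R) (f : V -> W) x U g v :
  X x -> smooth_extension X f x U g -> dder X f x v = 'D_v g x.
Proof.
move=> Xx E; rewrite /dder; case: xgetP => [_ -> [U' [g' [E' <-]]]|]; last first.
  by move=> /(_ ('D_v g x)) []; exists U, g.
have [Uo Ux Cg gf] := E; have [U'o U'x Cg' gf'] := E'.
pose Y := X° `&` (U `&` U').
have YE y : Y y -> 'D_v g' y = 'D_v g y.
  move=> [Xy [Uy U'y]]; apply: near_eq_derive.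
  have Xo : open X° by exact: open_interior.
  near=> z.
  have Xz : X z by apply: interior_subset; near: z; exact: open_nbhs_nbhs.
  rewrite gf' ?gf//; near: z; exact: open_nbhs_nbhs.
have c' : 'D_v g' y @[y --> x] --> 'D_v g' x by apply: (Ck_cont (Ck_derive v (Cg' 1%N))).
have c : 'D_v g y @[y --> x] --> 'D_v g x by apply: (Ck_cont (Ck_derive v (Cg 1%N))).
have [//|ne] := pselect ('D_v g' x = 'D_v g x).
have /eqP ne' := ne; have := @norm_hausdorff R W; rewrite open_hausdorff.
move=> /(_ _ _ ne') [[A B]] /= [xA yB] [Ao Bo /eqP/disjoints_subset AB].
rewrite inE in xA; rewrite inE in yB.
have nA : nbhs x ('D_v g' @^-1` A) by apply: c'; exact: open_nbhs_nbhs.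
have nB : nbhs x ('D_v g @^-1` B) by apply: c; exact: open_nbhs_nbhs.
have nU : nbhs x (U `&` U') by apply: filterI; exact: open_nbhs_nbhs.
have [y [Xy [[Ay By] Uy]]] := HX Xx (filterI (filterI nA nB) nU).
have Ey := YE _ (conj Xy Uy).
by have /= := AB _ Ay; rewrite Ey => /(_ By).
Unshelve. all: by end_near. Qed.

Lemma smooth_extension_dder (W : normedModType R) (f : V -> W) x U g v :
  smooth_extension X f x U g -> smooth_extension X (dder X f ^~ v) x U ('D_v g).
Proof.
move=> [Uo Ux Cg gf]; split=> //.
  by move=> k; exact: Ck_derive.
by move=> y Uy Xy; rewrite (@dder_ext _ f y U g).
Qed.

Lemma smooth_on_dder (W : normedModType R) (f : V -> W) v :
  smooth_on X f -> smooth_on X (dder X f ^~ v).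
Proof.
move=> Sf x /Sf [U [g E]]; exists U, ('D_v g); exact: smooth_extension_dder.
Qed.

Lemma eq_smooth_extension (W : normedModType R) (f f' : V -> W) x U g :
  (forall y, X y -> f y = f' y) ->
  smooth_extension X f x U g -> smooth_extension X f' x U g.
Proof. by move=> ff' [? ? ? gf]; split=> // y Uy Xy; rewrite gf// ff'. Qed.

Lemma eq_smooth_on (W : normedModType R) (f f' : V -> W) :
  (forall y, X y -> f y = f' y) -> smooth_on X f -> smooth_on X f'.
Proof.
move=> ff' Sf x /Sf [U [g E]]; exists U, g; exact: eq_smooth_extension E.
Qed.

Lemma eq_dder (W : normedModType R) (f f' : V -> W) x v :
  (forall y, X y -> f y = f' y) -> dder X f x v = dder X f' x v.
Proof.
move=> ff'; rewrite /dder; congr (xget 0 _); apply/seteqP.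
by split=> l [U [g [E <-]]]; exists U, g; split=> //; apply: eq_smooth_extension E => // y /ff'.
Qed.

Lemma smooth_on_cst (W : normedModType R) (c : W) : smooth_on X (fun=> c).
Proof.
by move=> x _; exists setT, (cst c); split=> //; [exact: openT|move=> k; exact: Ck_cst].
Qed.

Lemma dder_cst (W : normedModType R) (c : W) x v : X x -> dder X (fun=> c) x v = 0.
Proof.
move=> Xx; rewrite (@dder_ext _ _ _ setT (cst c))//; first exact: derive_cst.
by split=> //; [exact: openT|move=> k; exact: Ck_cst].
Qed.

Lemma dder_linear (W : normedModType R) (L : V -> W) x v :
  linear L -> continuous L -> X x -> dder X L x v = L v.
Proof.
move=> lL cL Xx; rewrite (@dder_ext _ _ _ setT L)//; last first.
  by split=> //; [exact: openT|move=> k; exact: Ck_linear].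
by have [] := is_derive_lin lL cL (is_derive_id x v).
Qed.

Lemma smooth_ext2 (W W' : normedModType R) (f : V -> W) (f' : V -> W') x :
  smooth_on X f -> smooth_on X f' -> X x ->
  exists U g g', smooth_extension X f x U g /\ smooth_extension X f' x U g'.
Proof.
move=> Sf Sf' Xx; have [U [g [Uo Ux Cg gf]]] := Sf _ Xx.
have [U' [g' [U'o U'x Cg' gf']]] := Sf' _ Xx.
exists (U `&` U'), g, g'; split; split=> //; try exact: openI.
- by move=> k; apply: Ck_subset (Cg k) => y [].
- by move=> y [Uy _]; exact: gf.
- by move=> k; apply: Ck_subset (Cg' k) => y [].
- by move=> y [_ Uy]; exact: gf'.
Qed.

Lemma smooth_derivable (W : normedModType R) (f : V -> W) x U g v :
  smooth_extension X f x U g -> derivable g x v.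
Proof. by move=> [_ Ux Cg _]; exact: Ck_derivable (Cg 1%N) Ux. Qed.

Section Add.
Variables (W : normedModType R) (f f' : V -> W).
Hypotheses (Sf : smooth_on X f) (Sf' : smooth_on X f').

Let extD x U g g' : smooth_extension X f x U g -> smooth_extension X f' x U g' ->
  smooth_extension X (fun y => f y + f' y) x U (g + g').
Proof.
move=> [Uo Ux Cg gf] [_ _ Cg' gf']; split=> //; first by move=> k; exact: CkD.
by move=> y Uy Xy; rewrite -gf// -gf'.
Qed.

Lemma smooth_onD : smooth_on X (fun y => f y + f' y).
Proof.
move=> x Xx; have [U [g [g' [E E']]]] := smooth_ext2 Sf Sf' Xx.
exists U, (g + g'); exact: extD.
Qed.

Lemma dderD x v : X x ->
  dder X (fun y => f y + f' y) x v = dder X f x v + dder X f' x v.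
Proof.
move=> Xx; have [U [g [g' [E E']]]] := smooth_ext2 Sf Sf' Xx.
rewrite (dder_ext v Xx (extD E E')) (dder_ext v Xx E) (dder_ext v Xx E').
by rewrite deriveD//; [exact: smooth_derivable E|exact: smooth_derivable E'].
Qed.
End Add.

Section Mul.
Variables (f f' : V -> R).
Hypotheses (Sf : smooth_on X f) (Sf' : smooth_on X f').

Let extM x U g g' : smooth_extension X f x U g -> smooth_extension X f' x U g' ->
  smooth_extension X (fun y => f y * f' y) x U (g \* g').
Proof.
move=> [Uo Ux Cg gf] [_ _ Cg' gf']; split=> //; first by move=> k; exact: CkM.
by move=> y Uy Xy /=; rewrite -gf// -gf'.
Qed.

Lemma smooth_onM : smooth_on X (fun y => f y * f' y).
Proof.
move=> x Xx; have [U [g [g' [E E']]]] := smooth_ext2 Sf Sf' Xx.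
exists U, (g \* g'); exact: extM.
Qed.

Lemma dderM x v : X x ->
  dder X (fun y => f y * f' y) x v = f x * dder X f' x v + f' x * dder X f x v.
Proof.
move=> Xx; have [U [g [g' [E E']]]] := smooth_ext2 Sf Sf' Xx.
rewrite (dder_ext v Xx (extM E E')) (dder_ext v Xx E) (dder_ext v Xx E').
rewrite (@deriveM _ _ g g'); [|exact: smooth_derivable E|exact: smooth_derivable E'].
by have [_ Ux _ ->] := E => //; have [_ _ _ ->] := E'.
Qed.
End Mul.

Section Lin.
Variables (W W' : normedModType R) (L : W -> W') (f : V -> W).
Hypotheses (lL : linear L) (cL : continuous L) (Sf : smooth_on X f).

Let extL x U g : smooth_extension X f x U g ->
  smooth_extension X (fun y => L (f y)) x U (L \o g).
Proof.
move=> [Uo Ux Cg gf]; split=> //; first by move=> k; exact: Ck_lin.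
by move=> y Uy Xy /=; rewrite -gf.
Qed.

Lemma smooth_on_lin : smooth_on X (fun y => L (f y)).
Proof. by move=> x /Sf[U [g E]]; exists U, (L \o g); exact: extL. Qed.

Lemma dder_lin x v : X x -> dder X (fun y => L (f y)) x v = L (dder X f x v).
Proof.
move=> Xx; have [U [g E]] := Sf Xx.
rewrite (dder_ext v Xx (extL E)) (dder_ext v Xx E).
by have [] := is_derive_lin lL cL (derivableP (smooth_derivable E (v := v))).
Qed.
End Lin.

Section Comp.
Variables (O : set R) (h : R -> R) (f : V -> R).
Hypotheses (Oo : open O) (Ch : Cinfty O h) (Sf : smooth_on X f).
Hypothesis fO : forall x, X x -> O (f x).

Let extC x U g : X x -> smooth_extension X f x U g ->
  smooth_extension X (fun y => h (f y)) x (U `&` g @^-1` O) (h \o g).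
Proof.
move=> Xx [Uo Ux Cg gf].
have o : open (U `&` g @^-1` O).
  rewrite openE => y [Uy Oy]; apply: filterI; first exact: open_nbhs_nbhs.
  by apply: (Ck_cont (Cg 0%N) Uy); exact: open_nbhs_nbhs.
split=> //.
- by split=> //=; rewrite gf//; exact: fO.
- move=> k; apply: (@Ck_comp_R _ _ _ _ O) => //; first by move=> y [].
  by apply: Ck_subset (Cg k) => y [].
- by move=> y [Uy _] Xy /=; rewrite -gf.
Qed.

Lemma smooth_on_comp : smooth_on X (fun y => h (f y)).
Proof.
move=> x Xx; have [U [g E]] := Sf Xx.
by exists (U `&` g @^-1` O), (h \o g); exact: extC.
Qed.

Lemma dder_comp x v : X x ->
  dder X (fun y => h (f y)) x v = derive1 h (f x) * dder X f x v.
Proof.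
move=> Xx; have [U [g E]] := Sf Xx.
rewrite (dder_ext v Xx (extC Xx E)) (dder_ext v Xx E).
have [_ Ux _ gf] := E.
have dg : is_derive (0 : R) 1 (fun s : R => g (x + s *: v)) ('D_v g x).
  by apply/is_derive_lineP/derivableP; exact: (smooth_derivable E).
have dh : is_derive (g (x + 0 *: v)) 1 h (derive1 h (f x)).
  rewrite scale0r addr0 gf// derive1E; apply/derivableP.
  by apply: Ck_derivable (Ch 1%N) _; exact: fO.
have H : is_derive x v (h \o g) (derive1 h (f x) * 'D_v g x).
  by apply/is_derive_lineP; exact: is_derive1_comp dh dg.
by case: H.
Qed.
End Comp.

Lemma dder_Schwarz (f : V -> R) x v w : smooth_on X f -> X x ->
  dder X (dder X f ^~ w) x v = dder X (dder X f ^~ v) x w.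
Proof.
move=> Sf Xx; have [U [g E]] := Sf _ Xx.
rewrite !(dder_ext _ Xx (smooth_extension_dder _ E)).
by have [Uo Ux Cg _] := E; exact: Schwarz Uo (Cg 2%N) Ux.
Qed.

Lemma smooth_on_continuous (W : normedModType R) (f : V -> W) :
  smooth_on X f -> {within X, continuous f}.
Proof.
move=> Sf; apply/subspace_continuousP => x Xx.
have [U [g [Uo Ux Cg gf]]] := Sf _ Xx.
change (f @ within X (nbhs x) --> f x); rewrite -(gf x)//; apply: (@cvg_trans _ (g @ within X (nbhs x))).
  apply: near_eq_cvg; rewrite near_withinE; near=> y => Xy.
  by apply: gf => //; near: y; exact: open_nbhs_nbhs.
by apply: cvg_within_filter; exact: Ck_cont (Cg 0%N) Ux.
Unshelve. all: by end_near. Qed.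

End SmoothOn.

Section SmoothAlgebra.
Context {R : realType} {V : normedModType R}.
Variable X : set V.
Hypothesis HX : X `<=` closure X°.
Implicit Types f g : V -> R.

Lemma smooth_on_sum (W : normedModType R) I (r : seq I) (F : I -> V -> W) :
  (forall i, smooth_on X (F i)) -> smooth_on X (fun x => \sum_(i <- r) F i x).
Proof.
move=> SF; elim: r => [|i r IH].
  by apply: eq_smooth_on (smooth_on_cst (X := X) (0 : W)) => y _; rewrite big_nil.
by apply: eq_smooth_on (smooth_onD (SF i) IH) => y _; rewrite big_cons.
Qed.

Lemma dder_sum (W : normedModType R) I (r : seq I) (F : I -> V -> W) x v :
  (forall i, smooth_on X (F i)) -> X x ->
  dder X (fun x => \sum_(i <- r) F i x) x v = \sum_(i <- r) dder X (F i) x v.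
Proof.
move=> SF Xx; elim: r => [|i r IH].
  transitivity (dder X (fun=> (0 : W)) x v); last by rewrite big_nil (dder_cst HX).
  by apply: eq_dder => y _; rewrite big_nil.
rewrite big_cons -IH -dderD//; last exact: smooth_on_sum.
by apply: eq_dder => y _; rewrite big_cons.
Qed.

Lemma smooth_onN f : smooth_on X f -> smooth_on X (fun y => - f y).
Proof.
move=> Sf; apply: eq_smooth_on (smooth_onM (smooth_on_cst (X := X) (-1 : R)) Sf) => y _.
by rewrite mulN1r.
Qed.

Lemma dderZ c f x v : smooth_on X f -> X x ->
  dder X (fun y => c * f y) x v = c * dder X f x v.
Proof.
move=> Sf Xx; rewrite (dderM HX (smooth_on_cst (X := X) c) Sf)// (dder_cst HX)//.
by rewrite mulr0 addr0.
Qed.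

Lemma dderN f x v : smooth_on X f -> X x ->
  dder X (fun y => - f y) x v = - dder X f x v.
Proof.
move=> Sf Xx; rewrite -mulN1r -dderZ//; apply: eq_dder => y _.
by rewrite mulN1r.
Qed.

Lemma smooth_onB f g : smooth_on X f -> smooth_on X g ->
  smooth_on X (fun y => f y - g y).
Proof. by move=> Sf Sg; apply: smooth_onD => //; exact: smooth_onN. Qed.

Lemma dderB f g x v : smooth_on X f -> smooth_on X g -> X x ->
  dder X (fun y => f y - g y) x v = dder X f x v - dder X g x v.
Proof.
by move=> Sf Sg Xx; rewrite (dderD HX)// ?dderN//; exact: smooth_onN.
Qed.

Lemma smooth_on_inv f : smooth_on X f -> (forall x, X x -> f x != 0) ->
  smooth_on X (fun y => (f y)^-1).
Proof.
move=> Sf f0; apply: (@smooth_on_comp R V X [set r : R | r != 0] (fun r => r^-1)) => //.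
by move=> k; exact: Ck_inv.
Qed.

Lemma dder_inv f x v : smooth_on X f -> (forall x, X x -> f x != 0) -> X x ->
  dder X (fun y => (f y)^-1) x v = - dder X f x v / f x ^+ 2.
Proof.
move=> Sf f0 Xx; have Si := smooth_on_inv Sf f0.
have : dder X (fun y => f y * (f y)^-1) x v = 0.
  transitivity (dder X (fun=> (1 : R)) x v); last by rewrite (dder_cst HX).
  apply: eq_dder => y Xy.
  by rewrite mulfV// f0.
rewrite (dderM HX)// => E; have fx := f0 _ Xx.
apply: (mulfI fx); move/eqP: E; rewrite addr_eq0 => /eqP ->.
by field.
Qed.

Lemma smooth_on_sqrt f : smooth_on X f -> (forall x, X x -> 0 < f x) ->
  smooth_on X (fun y => Num.sqrt (f y)).
Proof.
move=> Sf f0; apply: (@smooth_on_comp R V X [set r : R | 0 < r] (@Num.sqrt R)) => //.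
by move=> k; exact: Ck_sqrt.
Qed.

Lemma smooth_on_coord n (w : V -> 'rV[R]_n) i :
  smooth_on X w -> smooth_on X (fun y => w y 0 i).
Proof.
apply: (@smooth_on_lin _ _ X 'rV[R]_n R (fun M : 'rV_n => M 0 i)).
  by move=> a u v; rewrite !mxE.
exact: coord_continuous.
Qed.

Lemma dder_coord n (w : V -> 'rV[R]_n) i x v :
  smooth_on X w -> X x -> dder X w x v 0 i = dder X (fun y => w y 0 i) x v.
Proof.
move=> Sw Xx; rewrite (@dder_lin _ _ X HX 'rV[R]_n R (fun M : 'rV_n => M 0 i))//.
  by move=> a u w'; rewrite !mxE.
exact: coord_continuous.
Qed.

Lemma smooth_on_rV n (w : V -> 'rV[R]_n) :
  (forall i, smooth_on X (fun y => w y 0 i)) -> smooth_on X w.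
Proof.
move=> Sw.
apply: (@eq_smooth_on _ _ _ _ (fun x => \sum_(i < n) w x 0 i *: delta_mx 0 i)).
  by move=> y _; rewrite -row_sum_delta.
apply: smooth_on_sum => i.
apply: (@smooth_on_lin _ _ X R 'rV[R]_n (fun r : R => r *: delta_mx 0 i)) => //.
  by move=> a u v; rewrite scalerDl -scalerA.
exact: scalel_continuous.
Qed.

End SmoothAlgebra.

Section SmoothMaps.
Context {R : realType}.

Lemma smooth_on_affine (V V' W : normedModType R) (X : set V) (X' : set V')
    (A A0 : V' -> V) (f : V -> W) :
  continuous A -> (forall y w (h : R), A (y + h *: w) = A y + h *: A0 w) ->
  (forall x, X' x -> X (A x)) -> smooth_on X f -> smooth_on X' (f \o A).
Proof.
move=> cA HA XA Sf x X'x; have [U [g [Uo Ux Cg gf]]] := Sf _ (XA _ X'x).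
exists (A @^-1` U), (g \o A); split=> //.
- by apply: open_comp => // y _; exact: cA.
- by move=> k; exact: Ck_affine HA (Cg k).
- by move=> y Uy X'y /=; rewrite gf//; exact: XA.
Qed.

Lemma dder_affine (V V' W : normedModType R) (X : set V) (X' : set V')
    (A A0 : V' -> V) (f : V -> W) x v :
  X `<=` closure X° -> X' `<=` closure X'° ->
  continuous A -> (forall y w (h : R), A (y + h *: w) = A y + h *: A0 w) ->
  (forall x, X' x -> X (A x)) -> smooth_on X f -> X' x ->
  dder X' (f \o A) x v = dder X f (A x) (A0 v).
Proof.
move=> HX HX' cA HA XA Sf X'x; have [U [g E]] := Sf _ (XA _ X'x).
rewrite (dder_ext HX _ (XA _ X'x) E).
rewrite (@dder_ext _ _ _ HX' _ _ _ (A @^-1` U) (g \o A))//.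
  have dg := derivableP (smooth_derivable E (v := A0 v)).
  by have [] := is_derive_affine HA dg.
have [Uo Ux Cg gf] := E; split=> //.
- by apply: open_comp => // y _; exact: cA.
- by move=> k; exact: Ck_affine HA (Cg k).
- by move=> y Uy X'y /=; rewrite gf//; exact: XA.
Qed.

Section CompRV.
Variables (V : normedModType R) (n : nat) (X : set V) (Y : set 'rV[R]_n).
Variables (h : 'rV[R]_n -> R) (f : V -> 'rV[R]_n).
Hypotheses (HX : X `<=` closure X°) (HY : Y `<=` closure Y°).
Hypotheses (Sh : smooth_on Y h) (Sf : smooth_on X f).
Hypothesis fXY : forall x, X x -> Y (f x).

Let extC x U g O k : smooth_extension X f x U g -> smooth_extension Y h (f x) O k ->
  X x -> smooth_extension X (h \o f) x (U `&` g @^-1` O) (k \o g).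
Proof.
move=> [Uo Ux Cg gf] [Oo Ox Ch kh] Xx.
split.
- rewrite openE => y [Uy Oy]; apply: filterI; first exact: open_nbhs_nbhs.
  by apply: (Ck_cont (Cg 0%N) Uy); exact: open_nbhs_nbhs.
- by split=> //=; rewrite gf.
- move=> j; apply: (Ck_comp_rV _ Oo _ (Ch j)).
  + rewrite openE => y [Uy Oy]; apply: filterI; first exact: open_nbhs_nbhs.
    by apply: (Ck_cont (Cg 0%N) Uy); exact: open_nbhs_nbhs.
  + by move=> y [].
  + move=> i; apply: (@Ck_subset _ _ _ _ U); first by move=> y [].
    apply: (@Ck_lin _ _ _ _ _ U (fun M : 'rV_n => M 0 i)) => //.
      by move=> a u v; rewrite !mxE.
    exact: coord_continuous.
  + by move=> y; rewrite inE => -[Uy _]; exact: Ck_cont (Cg 0%N) Uy.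
- by move=> y [Uy Oy] Xy /=; rewrite kh// gf//; exact: fXY.
Qed.

Lemma smooth_on_comp_rV : smooth_on X (h \o f).
Proof.
move=> x Xx; have [U [g E]] := Sf Xx; have [N [k E']] := Sh (fXY Xx).
by exists (U `&` g @^-1` N), (k \o g); exact: extC.
Qed.

Lemma dder_comp_rV x v : X x ->
  dder X (h \o f) x v = dder Y h (f x) (dder X f x v).
Proof.
move=> Xx; have [U [g E]] := Sf Xx; have [N [k E']] := Sh (fXY Xx).
rewrite (dder_ext HX v Xx (extC E E' Xx)) (dder_ext HX v Xx E).
rewrite (dder_ext HY _ (fXY Xx) E').
have dg := derivableP (smooth_derivable E (v := v)).
have [Uo Ux Cg gf] := E; have [No Nx Ch kh] := E'.
rewrite -gf//; rewrite -gf// in Nx.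
by have [] := is_derive_comp_rV No (Ch 1%N) Nx dg.
Qed.

End CompRV.

Lemma dder_rV_sum n (X : set 'rV[R]_n) (f : 'rV[R]_n -> R) x v :
  X `<=` closure X° -> smooth_on X f -> X x ->
  dder X f x v = \sum_i v 0 i * dder X f x (delta_mx 0 i).
Proof.
move=> HX Sf Xx; have [U [g E]] := Sf _ Xx.
rewrite (dder_ext HX _ Xx E); have [Uo Ux Cg gf] := E.
rewrite (Ck1_derive_rV _ Uo (Cg 1%N) Ux).
by apply: eq_bigr => i _; rewrite (dder_ext HX _ Xx E).
Qed.

Lemma setT_closure_interior (V : normedModType R) : [set: V] `<=` closure [set: V]°.
Proof. by rewrite interiorT closureT. Qed.

Lemma is_derive_dderT (V W : normedModType R) (f : V -> W) x v :
  smooth_on [set: V] f -> is_derive x v f (dder [set: V] f x v).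
Proof.
move=> Sf; have [U [g E]] := Sf x I.
rewrite (dder_ext (@setT_closure_interior V) _ I E).
have [Uo Ux Cg gf] := E.
apply: (@near_eq_is_derive _ _ _ g).
  by near=> y; apply: gf => //; near: y; exact: open_nbhs_nbhs.
by apply/derivableP; exact: smooth_derivable E.
Unshelve. all: by end_near. Qed.

End SmoothMaps.

(** * Integrals depending smoothly on a parameter *)

Section SegmentIntegral.
Context {R : realType}.
Implicit Types (a b c : R) (f g : R -> R).
Local Notation mu := (@lebesgue_measure R).

(** [circle_integral] is the case of the segment from 0 to [2 * pi], up to conversion. *)
Definition itg a b f : R := \int[mu]_(t in `[a, b]) f t.

Lemma segment_integrable a b f : {within `[a, b], continuous f} ->
  mu.-integrable `[a, b] (EFin \o f).
Proof. by apply: continuous_compact_integrable; exact: segment_compact. Qed.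

Lemma eq_itg a b f g : (forall t, a <= t <= b -> f t = g t) ->
  itg a b f = itg a b g.
Proof.
move=> fg; apply: eq_Rintegral => t; rewrite inE /= in_itv /=; exact: fg.
Qed.

Lemma itgD a b f g : {within `[a, b], continuous f} ->
  {within `[a, b], continuous g} ->
  itg a b (fun t => f t + g t) = itg a b f + itg a b g.
Proof. by move=> cf cg; apply: RintegralD => //; exact: segment_integrable. Qed.

Lemma itgB a b f g : {within `[a, b], continuous f} ->
  {within `[a, b], continuous g} ->
  itg a b (fun t => f t - g t) = itg a b f - itg a b g.
Proof. by move=> cf cg; apply: RintegralB => //; exact: segment_integrable. Qed.

Lemma itgZ a b k f : {within `[a, b], continuous f} ->
  itg a b (fun t => k * f t) = k * itg a b f.
Proof. by move=> cf; apply: RintegralZl => //; exact: segment_integrable. Qed.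

Lemma itg_cst a b k : a <= b -> itg a b (fun=> k) = k * (b - a).
Proof.
move=> ab; rewrite /itg Rintegral_cst//= lebesgue_measure_itv/= lte_fin.
by case: ltgtP ab => // ->; rewrite subrr.
Qed.

Lemma within_continuousZ (A : set R) k f : {within A, continuous f} ->
  {within A, continuous (fun t => k * f t)}.
Proof. by move=> cf t; apply: cvgM; [exact: cvg_cst|exact: cf]. Qed.

Lemma within_continuousB (A : set R) f g : {within A, continuous f} ->
  {within A, continuous g} -> {within A, continuous (fun t => f t - g t)}.
Proof. by move=> cf cg t; apply: cvgB; [exact: cf|exact: cg]. Qed.

Lemma within_continuous_sum (A : set R) I (r : seq I) (F : I -> R -> R) :
  (forall i, {within A, continuous (F i)}) ->
  {within A, continuous (fun t => \sum_(i <- r) F i t)}.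
Proof.
move=> cF; elim: r => [|j r IH].
  have -> : (fun t => \sum_(i <- [::]) F i t) = cst 0.
    by apply/funext => t; rewrite big_nil.
  by move=> ?; exact: cst_continuous.
have -> : (fun t => \sum_(i <- j :: r) F i t) =
    (fun t => F j t + \sum_(i <- r) F i t).
  by apply/funext => t; rewrite big_cons.
by move=> x; apply: continuousD; [exact: cF|exact: IH].
Qed.

Lemma itg_sum a b I (r : seq I) (F : I -> R -> R) :
  (forall i, {within `[a, b], continuous (F i)}) ->
  itg a b (fun t => \sum_(i <- r) F i t) = \sum_(i <- r) itg a b (F i).
Proof.
move=> cF; elim: r => [|i r IH].
  rewrite big_nil /itg; under eq_Rintegral do rewrite big_nil.
  by rewrite Rintegral_cst//= mul0r.
rewrite big_cons -IH -itgD//; last exact: within_continuous_sum.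
by apply: eq_itg => t _; rewrite big_cons.
Qed.

Lemma itg_le a b f g : {within `[a, b], continuous f} ->
  {within `[a, b], continuous g} -> (forall t, a <= t <= b -> f t <= g t) ->
  itg a b f <= itg a b g.
Proof.
move=> cf cg fg; apply: le_Rintegral => //; try exact: segment_integrable.
Qed.

Lemma itg_bound a b f e : a <= b -> {within `[a, b], continuous f} ->
  (forall t, a <= t <= b -> `|f t| <= e) -> `|itg a b f| <= e * (b - a).
Proof.
move=> ab cf fe; rewrite ler_norml; apply/andP; split.
  rewrite -mulNr -itg_cst//; apply: itg_le => //.
    by move=> ?; exact: cst_continuous.
  by move=> t /fe; rewrite ler_norml => /andP[].
rewrite -itg_cst//; apply: itg_le => //.
  by move=> ?; exact: cst_continuous.
by move=> t /fe; rewrite ler_norml => /andP[].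
Qed.

Lemma itg_split a b c f : a <= b -> b <= c -> {within `[a, c], continuous f} ->
  itg a c f = itg a b f + itg b c f.
Proof.
move=> ab bc cf.
have cab : {within `[a, b], continuous f}.
  by apply: continuous_subspaceW cf; apply: subset_itvl; rewrite bnd_simp.
have cbc : {within `[b, c], continuous f}.
  by apply: continuous_subspaceW cf; apply: subset_itvr; rewrite bnd_simp.
apply/eqP; rewrite addrC -subr_eq; apply/eqP.
rewrite /itg (@Rintegral_itvB _ f (BLeft a) (BRight c) b) ?bnd_simp//; last first.
  exact: segment_integrable.
rewrite Rintegral_itv_obnd_cbnd; last first.
  apply: integrableS (segment_integrable cbc) => //.
  by apply: subset_itvr; rewrite bnd_simp.
by [].
Qed.

(** Compactness of the segment through a supremum: the supremum of the [c] with [P a c] satisfies it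
    too, by the local hypothesis and transitivity, and could be exceeded if it were below [b]. It
    serves to glue extensions that exist only near one time. *)
Lemma segment_induction (P : R -> R -> Prop) a b : a <= b ->
  (forall x y z, a <= x <= y -> y <= z <= b -> P x y -> P y z -> P x z) ->
  (forall t, a <= t <= b -> exists2 e, 0 < e &
     forall c d, t - e < c -> c <= d -> d < t + e -> P c d) ->
  P a b.
Proof.
move=> ab Ptr Ploc.
pose S := [set c | a <= c <= b /\ P a c].
have Sa : S a.
  split; first by rewrite lexx.
  have [|e e0 Pe] := Ploc a; first by rewrite lexx.
  by apply: Pe => //; rewrite ?ltrBlDr ltrDl.
have hS : has_sup S by split; [exists a|exists b => c [/andP[]]].
have sb : sup S <= b by apply: ge_sup; [exists a|move=> c [/andP[]]].
have sa : a <= sup S by apply: ub_le_sup => //; exact: hS.2.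
have [|e e0 Pe] := Ploc (sup S); first by rewrite sa.
have [c [/andP[ac cb] Pac] sc] := sup_adherent e0 hS.
have cs : c <= sup S by apply: ub_le_sup; [exact: hS.2|split => //; rewrite ac].
have Pas : P a (sup S).
  by apply: (Ptr a c) => //; rewrite ?lexx ?cs//; apply: Pe => //; rewrite ltrDl.
move: sb; rewrite le_eqVlt => /predU1P[sb|sb]; first by rewrite -sb.
pose d := Num.min b (sup S + e / 2).
have sd : sup S < d by rewrite lt_min sb ltrDl divr_gt0.
have db : d <= b by rewrite ge_min lexx.
suff : S d by move=> /(ub_le_sup hS.2); rewrite leNgt sd.
split; first by rewrite db (le_trans sa)// ltW.
apply: (Ptr a (sup S)) => //; rewrite ?sa ?lexx ?db ?ltW//.
apply: Pe; [by rewrite ltrBlDr ltrDl|exact: ltW|].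
by rewrite /d gt_min; apply/orP; right; rewrite ltrD2l ltr_pdivrMr// ltr_pMr// ltr1n.
Qed.

End SegmentIntegral.

Section ParamIntegral.
Context {R : realType} {V : normedModType R}.
Implicit Types H : V * R -> R.

Lemma slice_cvg (t : R) : continuous (fun y : V => (y, t)).
Proof.
move=> y; apply: (@cvg_pair _ _ _ _ (nbhs y) (nbhs t)).
  exact: cvg_id.
exact: cvg_cst.
Qed.

Lemma fiber_cvg (x : V) : continuous (fun s : R => (x, s)).
Proof.
move=> s; apply: (@cvg_pair _ _ _ _ (nbhs x) (nbhs s)).
  exact: cvg_cst.
exact: cvg_id.
Qed.

Lemma slice_continuous (W : normedModType R) (H : V * R -> W) (x : V) (A : set R) :
  (forall t, A t -> {for (x, t), continuous H}) ->
  {within A, continuous (fun t => H (x, t))}.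
Proof.
move=> cH; apply/subspace_continuousP => t At.
apply: cvg_within_filter.
exact: (cvg_comp (fun s : R => (x, s)) H (@fiber_cvg x t) (cH _ At)).
Qed.

(** Tube lemma: continuity at each point of the compact fibre over [x] becomes uniform in [t] for
    [y] near [x]. Both [H (x, t)] and [H (y, t)] are compared with the value at a centre of the
    covering, hence [e / 2]. *)
Lemma slice_uniform H (x : V) a b (e : R) : 0 < e ->
  (forall t, a <= t <= b -> {for (x, t), continuous H}) ->
  \forall y \near x, forall t, a <= t <= b -> `|H (x, t) - H (y, t)| <= e.
Proof.
move=> e0 cH.
have := (compact_near_coveringP `[a, b]).1 (@segment_compact R a b).
move=> /(_ V (nbhs x) (fun y t => `|H (x, t) - H (y, t)| <= e) _) NC.
have : \near x, `[a, b] `<=` (fun t => `|H (x, t) - H (x, t)| <= e) -> True by near=> y.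
move=> _; suff : \forall y \near x, `[a, b] `<=` (fun t => `|H (x, t) - H (y, t)| <= e).
  by apply: filterS => y Hy t tab; apply: Hy; rewrite /= in_itv.
apply: NC => t; rewrite /= in_itv /= => tab.
have e20 : 0 < e / 2 by rewrite divr_gt0.
have /cvgrPdist_le/(_ _ e20) [[A B] /= [xA tB] AB] := cH _ tab.
exists (B, A) => //= -[s y] /= [Bs Ay].
have /= H1 := AB (y, s) (conj Ay Bs).
have /= H2 := AB (x, s) (conj (nbhs_singleton xA) Bs).
rewrite (splitr e) -(subrKA (H (x, t))) (le_trans (ler_normD _ _))// lerD//.
by rewrite distrC.
Unshelve. all: by end_near. Qed.

Variables (a b : R).
Hypothesis ab : a <= b.

Lemma param_continuous H (U : set V) x : open U -> U x ->
  (forall y t, U y -> a <= t <= b -> {for (y, t), continuous H}) ->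
  {for x, continuous (fun x => itg a b (fun t => H (x, t)))}.
Proof.
move=> Uo Ux cH; apply/cvgrPdist_le => e e0.
(* The added 1 keeps the denominator positive when [a = b]. *)
have M0 : 0 < b - a + 1 by rewrite ltr_wpDl// subr_ge0.
have e1 : 0 < e / (b - a + 1) by rewrite divr_gt0.
have Hu := slice_uniform e1 (fun t => cH x t Ux).
have cs y : U y -> {within `[a, b], continuous (fun t => H (y, t))}.
  move=> Uy; apply: slice_continuous => t; rewrite /= in_itv /=; exact: cH.
near=> y.
have Uy : U y by near: y; exact: open_nbhs_nbhs.
rewrite -itgB; [|exact: (cs _ Ux)|exact: (cs _ Uy)].
apply: le_trans (itg_bound (e := e / (b - a + 1)) ab _ _) _.
- by apply: within_continuousB; [exact: (cs _ Ux)|exact: (cs _ Uy)].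
- by near: y.
- by rewrite mulrAC ler_pdivrMr// ler_pM2l// lerDl.
Unshelve. all: by end_near. Qed.

(** At each [t] the difference quotient is a mean value of the partial derivative, which is
    uniformly close to its value over [x] by [slice_uniform]; integration preserves the bound. *)
Lemma param_derive H (U : set V) x v : open U -> U x ->
  (forall y t, U y -> a <= t <= b -> {for (y, t), continuous H}) ->
  (forall y t, U y -> a <= t <= b -> derivable H (y, t) (v, 0)) ->
  (forall y t, U y -> a <= t <= b -> {for (y, t), continuous ('D_(v, 0) H)}) ->
  is_derive x v (fun x => itg a b (fun t => H (x, t)))
    (itg a b (fun t => 'D_(v, 0) H (x, t))).
Proof.
move=> Uo Ux cH dH cD; apply/is_derive_cvgP/cvgrPdist_le => e e0.
have M0 : 0 < b - a + 1 by rewrite ltr_wpDl// subr_ge0.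
have e1 : 0 < e / (b - a + 1) by rewrite divr_gt0.
have cs y : U y -> {within `[a, b], continuous (fun t => H (y, t))}.
  move=> Uy; apply: slice_continuous => t; rewrite /= in_itv /=; exact: cH.
have cDs y : U y -> {within `[a, b], continuous (fun t => 'D_(v, 0) H (y, t))}.
  move=> Uy; apply: (@slice_continuous R ('D_(v, 0) H)) => t; rewrite /= in_itv /=; exact: cD.
have Hu := slice_uniform e1 (fun t => cD x t Ux).
have : \forall y \near x, U y /\ forall t, a <= t <= b ->
    `|'D_(v, 0) H (x, t) - 'D_(v, 0) H (y, t)| <= e / (b - a + 1).
  near=> y; split; last by near: y.
  by near: y; exact: open_nbhs_nbhs.
move=> /nbhs_ballP[d /= d0 Hd].
have v0 : 0 < `|v| + 1 by rewrite ltr_wpDl.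
near=> h.
have h0 : h != 0 by near: h; exact: nbhs_dnbhs_neq.
have hd : `|h| * (`|v| + 1) < d.
  by rewrite -ltr_pdivlMr//; near: h; apply: dnbhs0_lt; rewrite divr_gt0.
have B s : 0 <= s <= 1 -> ball x d (x + s *: (h *: v)).
  move=> /andP[s0 s1]; rewrite -ball_normE /= opprD addNKr normrN.
  apply: le_lt_trans hd; rewrite !normrZ (ger0_norm s0) mulrDr mulr1.
  by rewrite ler_wpDr// ler_piMl// mulr_ge0.
have Uh : U (x + h *: v).
  have [|+ _] := Hd _ (B 1 _); first by rewrite ler01 lexx.
  by rewrite scale1r.
rewrite -itgB; [|exact: (cs _ Uh)|exact: (cs _ Ux)].
rewrite -itgZ; last by apply: within_continuousB; [exact: (cs _ Uh)|exact: (cs _ Ux)].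
rewrite -itgB; [|exact: (cDs _ Ux)|]; last first.
  apply: within_continuousZ.
  by apply: within_continuousB; [exact: (cs _ Uh)|exact: (cs _ Ux)].
apply: le_trans (itg_bound (e := e / (b - a + 1)) ab _ _) _.
- apply: within_continuousB; first exact: (cDs _ Ux).
  apply: within_continuousZ.
  by apply: within_continuousB; [exact: (cs _ Uh)|exact: (cs _ Ux)].
- move=> t tab.
  have dl s : 0 <= s <= 1 ->
    is_derive (x + s *: (h *: v)) (h *: v) (fun y => H (y, t))
      (h * 'D_(v, 0) H (x + s *: (h *: v), t)).
    move=> s01; apply: is_deriveZdir.
    apply: (@is_derive_affine R (V * R)%type V R (fun y => (y, t)) (fun w => (w, 0))).
      by move=> y w k; congr (_, _); rewrite /= scaler0 addr0.
    by apply/derivableP; apply: dH => //; have [] := Hd _ (B _ s01).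
  have [s s01 E] := MVT_line (fun s s01 => is_derive_derivable (dl s s01)).
  have [_ D] := dl _ s01; rewrite D in E.
  rewrite E mulKf//.
  by have [_] := Hd _ (B _ s01); exact.
- by rewrite mulrAC ler_pdivrMr// ler_pM2l// lerDl.
Unshelve. all: by end_near. Qed.

Lemma Ck_param k H (U : set V) (N : set R) : open U ->
  (forall t, a <= t <= b -> N t) -> Ck k (U `*` N) H ->
  Ck k U (fun x => itg a b (fun t => H (x, t))).
Proof.
move=> Uo abN; elim: k H => [|k IH] H CH.
  split=> // x Ux; apply: (@param_continuous _ U) => // y t Uy tab.
  by apply: (Ck_cont CH); split=> //; exact: abN.
split=> [x Ux|v].
  apply: (@param_continuous _ U) => // y t Uy tab.
  by apply: (Ck_cont CH); split=> //; exact: abN.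
have D x : U x -> is_derive x v (fun x => itg a b (fun t => H (x, t)))
    (itg a b (fun t => 'D_(v, 0) H (x, t))).
  move=> Ux; apply: (@param_derive _ U) => // y t Uy tab.
  - by apply: (Ck_cont CH); split=> //; exact: abN.
  - by apply: (Ck_derivable CH); split=> //; exact: abN.
  - by apply: (Ck_cont (Ck_derive (v, 0) CH)); split=> //; exact: abN.
split=> [x /D[]//|].
apply: (@eq_Ck _ _ _ _ _ (fun x => itg a b (fun t => 'D_(v, 0) H (x, t)))) => //.
  by move=> x; rewrite inE => /D[_ ->].
exact: (IH ('D_(v, 0) H)) (Ck_derive _ CH).
Qed.

End ParamIntegral.

Section ParamSmooth.
Context {R : realType} {V : normedModType R}.
Variable X : set V.
Hypothesis HX : X `<=` closure X°.

Definition cylinder : set (V * R) := X `*` [set: R].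

Lemma cylinder_closure_interior : cylinder `<=` closure cylinder°.
Proof.
move=> [x t] [/= Xx _] B [[A N] /= [xA tN] AN].
have [y [Xy Ay]] := HX Xx xA.
exists (y, t); split; last by apply: AN; split=> //=; exact: nbhs_singleton.
exists (X, setT) => /=; first by split=> //; exact: filterT.
by move=> [z s] [].
Qed.

Let HC := cylinder_closure_interior.

Lemma slice_affine (t : R) y w (h : R) :
  (fun y : V => (y, t)) (y + h *: w) = (y, t) + h *: (w, 0 : R).
Proof. by congr (_, _); rewrite /= scaler0 addr0. Qed.

Lemma fiber_affine (x : V) y w (h : R) :
  (fun s : R => (x, s)) (y + h *: w) = (x, y) + h *: (0 : V, w).
Proof. by congr (_, _); rewrite /= scaler0 addr0. Qed.

Lemma smooth_on_slice (W : normedModType R) (H : V * R -> W) t :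
  smooth_on cylinder H -> smooth_on X (fun y => H (y, t)).
Proof.
move=> SH; apply: (@smooth_on_affine _ _ _ _ cylinder X (fun y => (y, t)) (fun w => (w, 0))) => //.
- exact: slice_cvg.
- exact: slice_affine.
Qed.

Lemma dder_slice (W : normedModType R) (H : V * R -> W) x t v :
  smooth_on cylinder H -> X x ->
  dder X (fun y => H (y, t)) x v = dder cylinder H (x, t) (v, 0).
Proof.
move=> SH Xx; apply: (@dder_affine _ _ _ _ cylinder X (fun y => (y, t)) (fun w => (w, 0))) => //.
- exact: slice_cvg.
- exact: slice_affine.
Qed.

Lemma smooth_on_fiber (W : normedModType R) (H : V * R -> W) x :
  smooth_on cylinder H -> X x -> smooth_on [set: R] (fun t => H (x, t)).
Proof.
move=> SH Xx.
apply: (@smooth_on_affine _ _ _ _ cylinder setT (fun s => (x, s)) (fun w => (0, w))) => //.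
- exact: fiber_cvg.
- exact: fiber_affine.
Qed.

Lemma is_derive_fiber (W : normedModType R) (H : V * R -> W) x (t : R) :
  smooth_on cylinder H -> X x ->
  is_derive t 1 (fun s => H (x, s)) (dder cylinder H (x, t) (0, 1)).
Proof.
move=> SH Xx; have := is_derive_dderT t 1 (smooth_on_fiber SH Xx).
rewrite (@dder_affine _ _ _ _ cylinder setT (fun s => (x, s)) (fun w => (0, w)) H)//.
- exact: setT_closure_interior.
- exact: fiber_cvg.
- exact: fiber_affine.
Qed.

Lemma fiber_continuous (W : normedModType R) (H : V * R -> W) x (A : set R) :
  smooth_on cylinder H -> X x -> {within A, continuous (fun s => H (x, s))}.
Proof.
move=> SH Xx; apply: continuous_subspaceW (smooth_on_continuous (smooth_on_fiber SH Xx)).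
exact: subsetT.
Qed.

Lemma smooth_on_base (W : normedModType R) (f : V -> W) :
  smooth_on X f -> smooth_on cylinder (fun z => f z.1).
Proof.
move=> Sf; apply: (@smooth_on_affine _ _ _ _ X cylinder fst fst) => //.
- by move=> z; exact: cvg_fst.
- by move=> z [].
Qed.

Lemma dder_base (W : normedModType R) (f : V -> W) x t v s :
  smooth_on X f -> X x ->
  dder cylinder (fun z => f z.1) (x, t) (v, s) = dder X f x v.
Proof.
move=> Sf Xx; rewrite (@dder_affine _ _ _ _ X cylinder fst fst f)//.
- by move=> z; exact: cvg_fst.
- by move=> z [].
Qed.

Variables (H : V * R -> R) (a b : R).
Hypotheses (ab : a <= b) (SH : smooth_on cylinder H).

(** An extension of [H] near a point [(x, t)] covers only times close to [t]. The integral over a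
    short segment is therefore extended by integrating a local extension, and these extensions are
    added along a subdivision; the formula for the derivative is carried along. *)
Let good x c d := exists U g,
  smooth_extension X (fun y => itg c d (fun t => H (y, t))) x U g /\
  forall v, 'D_v g x = itg c d (fun t => dder cylinder H (x, t) (v, 0)).

Let good_trans x c d e : X x -> c <= d -> d <= e -> good x c d -> good x d e -> good x c e.
Proof.
move=> Xx cd de [U [g [[Uo Ux Cg gf] Dg]]] [U' [g' [[U'o U'x Cg' gf'] Dg']]].
exists (U `&` U'), (g + g'); split.
  split=> //; first exact: openI.
    move=> k; apply: CkD; first exact: openI.
      by apply: Ck_subset (Cg k) => y [].
    by apply: Ck_subset (Cg' k) => y [].
  move=> y [Uy U'y] Xy; rewrite (@itg_split _ c d e)//; last exact: fiber_continuous.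
  by rewrite -gf// -gf'.
move=> v; rewrite deriveD.
- rewrite Dg Dg' -itg_split//.
  exact: (fiber_continuous (smooth_on_dder HC (v, 0) SH)).
- exact: Ck_derivable (Cg 1%N) Ux.
- exact: Ck_derivable (Cg' 1%N) U'x.
Qed.

Let good_segment x : X x -> good x a b.
Proof.
move=> Xx; apply: (segment_induction ab).
  by move=> c d e /andP[_ cd] /andP[de _]; exact: good_trans.
move=> t tab; have [U [g E]] := SH (conj Xx I : cylinder (x, t)).
have [Uo Ux Cg gf] := E.
have [[A B] /= [xA tB] AB] : nbhs (x, t) U by exact: open_nbhs_nbhs.
have /nbhs_ballP[e /= e0 eB] := tB.
exists e => // c d tc cd dt.
pose U' := A°.
have inB s : c <= s <= d -> ball t e s.
  move=> /andP[cs sd]; rewrite -ball_normE /= ltr_distlC.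
  by rewrite (lt_le_trans tc)//= (le_lt_trans sd).
have U'B y s : U' y -> c <= s <= d -> U (y, s).
  by move=> Uy /inB/eB Bs; apply: AB; split=> //; exact: interior_subset.
exists U', (fun y => itg c d (fun s => g (y, s))); split.
  split.
  - exact: open_interior.
  - exact: xA.
  - move=> k; apply: (@Ck_param _ _ _ _ cd _ _ _ (ball t e)) => //.
      exact: open_interior.
    apply: Ck_subset (Cg k) => -[y s] [/= Uy /eB Bs].
    by apply: AB; split=> //; exact: interior_subset.
  - by move=> y Uy Xy; apply: eq_itg => s sdc; apply: gf; [exact: U'B|split].
move=> v.
have [_ ->] := @param_derive _ _ _ _ cd g U' x v (@open_interior _ _) xA
   (fun y s Uy sdc => Ck_cont (Cg 0%N) (U'B y s Uy sdc))
   (fun y s Uy sdc => Ck_derivable (Cg 1%N) (U'B y s Uy sdc))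
   (fun y s Uy sdc => Ck_cont (Ck_derive (v, 0) (Cg 1%N)) (U'B y s Uy sdc)).
apply: eq_itg => s scd.
rewrite (@dder_ext _ _ _ HC _ H (x, s) U g)//.
by split=> //; exact: U'B.
Qed.

Lemma smooth_on_param : smooth_on X (fun y => itg a b (fun t => H (y, t))).
Proof. by move=> x /good_segment[U [g [E _]]]; exists U, g. Qed.

Lemma dder_param x v : X x ->
  dder X (fun y => itg a b (fun t => H (y, t))) x v =
  itg a b (fun t => dder cylinder H (x, t) (v, 0)).
Proof.
by move=> Xx; have [U [g [E <-]]] := good_segment Xx; exact: dder_ext E.
Qed.

End ParamSmooth.

(** * Regularity of a domain diffeomorphic to the solid torus *)

Section LocalMin.
Context {R : realType}.

Lemma is_derive_local_min (h : R -> R) (l : R) :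
  is_derive (0 : R) 1 h l -> (\forall s \near (0 : R), h 0 <= h s) -> l = 0.
Proof.
have pos (k : R -> R) (m : R) : is_derive (0 : R) 1 k m ->
    (\forall s \near (0 : R), k 0 <= k s) -> 0 <= m.
  move=> /is_derive_cvgP dk km.
  have dk' : (fun h : R => h^-1 * (k (0 + h *: 1) - k 0)) @ (0 : R)^'+ --> m.
    apply: cvg_trans dk; apply: cvg_app => A [e /= e0 eA].
    by exists e => //= y ye y0; apply: eA => //; rewrite gt_eqF.
  rewrite leNgt; apply/negP => m0.
  have km' : \forall s \near (0 : R)^'+, k 0 <= k s by exact: cvg_within km.
  have kl : \forall s \near (0 : R)^'+, s^-1 * (k (0 + s *: 1) - k 0) < 0.
    exact: (cvgr_lt _ dk').
  have [s [/= s0 [ks]]] := filter_ex (filterI (nbhs_right_gt (0 : R)) (filterI km' kl)).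
  by rewrite /= add0r [s *: 1]mulr1 pmulr_rlt0 ?invr_gt0// subr_lt0 ltNge ks.
move=> dh hm; apply/eqP; rewrite eq_le (pos h)// andbT -oppr_ge0.
apply: (pos (fun s => h (- s))); last first.
  have oc : (fun s : R => - s) @ (0 : R) --> (0 : R).
    by rewrite -[X in _ --> X]oppr0; exact: opp_continuous.
  by rewrite oppr0; exact: (oc _ hm).
have dN : is_derive (0 : R) 1 (fun s : R => - s) (-1).
  by apply: is_deriveN.
rewrite -mulrN1; apply: (@is_derive1_comp _ h (fun s => - s)) => //.
by rewrite oppr0.
Unshelve. all: by end_near. Qed.

Lemma is_derive_rV (V : normedModType R) n (f : V -> 'rV[R]_n) x v (df : 'rV[R]_n) :
  (forall i, is_derive x v (fun y => f y 0 i) (df 0 i)) -> is_derive x v f df.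
Proof.
move=> H; have D : derivable f x v.
  by apply/derivable_mxP => i j; rewrite ord1; exact: (is_derive_derivable (H j)).
apply: DeriveDef => //; rewrite derive_mx//; apply/rowP => i; rewrite mxE.
by have [] := H i.
Qed.

Lemma is_derive_coord (V : normedModType R) n (f : V -> 'rV[R]_n) x v (df : 'rV[R]_n) i :
  is_derive x v f df -> is_derive x v (fun y => f y 0 i) (df 0 i).
Proof.
apply: (is_derive_lin (L := fun M : 'rV_n => M 0 i)).
  by move=> a u w; rewrite !mxE.
exact: coord_continuous.
Qed.

Lemma dot_ge0 n (u : 'rV[R]_n) : 0 <= dot u u.
Proof. by apply: sumr_ge0 => i _; rewrite -expr2 sqr_ge0. Qed.

Lemma dot_coord n (u : 'rV[R]_n) i : (u 0 i) ^+ 2 <= dot u u.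
Proof.
rewrite /dot (bigD1 i)//= -expr2 lerDl.
by apply: sumr_ge0 => j _; rewrite -expr2 sqr_ge0.
Qed.

Lemma coord_le_norm n (u : 'rV[R]_n) i : `|u 0 i| <= `|u|.
Proof.
rewrite {2}/Num.Def.normr/= mx_normrE.
exact: (le_bigmax _ (fun ij : 'I_1 * 'I_n => `|u ij.1 ij.2|) (0, i)).
Qed.

Lemma norm_le_coord n (u : 'rV[R]_n) e : 0 <= e ->
  (forall i, `|u 0 i| <= e) -> `|u| <= e.
Proof.
move=> e0 ue; rewrite /Num.Def.normr/= mx_normrE bigmax_le//= => -[i j] _ /=.
by rewrite ord1.
Qed.

Lemma dot_le n (u : 'rV[R]_n) : dot u u <= n%:R * `|u| ^+ 2.
Proof.
have -> : n%:R * `|u| ^+ 2 = \sum_(i < n) `|u| ^+ 2.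
  by rewrite sumr_const card_ord mulr_natl.
apply: ler_sum => i _.
rewrite -expr2 -real_normK ?num_real//.
by rewrite lerXn2r ?nnegrE// coord_le_norm.
Qed.

Lemma dot_continuous n : continuous (fun u : 'rV[R]_n => dot u u).
Proof.
move=> u; apply: (@cvg_sumr R _ (nbhs u)) => i; apply: cvgM; exact: coord_continuous.
Qed.

Lemma dot_eq0 n (u : 'rV[R]_n) : dot u u = 0 -> u = 0.
Proof.
move=> u0; apply/rowP => i; rewrite mxE; apply/eqP; rewrite -sqrf_eq0.
by rewrite eq_le sqr_ge0 -{1}u0 dot_coord.
Qed.

End LocalMin.

Lemma forall_I3 (P : 'I_3 -> Prop) : P 0 -> P 1 -> P 2%:R -> forall i, P i.
Proof.
move=> P0 P1 P2 i; have : i \in [:: 0; 1; 2%:R] by case: i => -[|[|[|//]]] ?.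
by rewrite !inE => /or3P[]/eqP ->.
Qed.

Lemma sum_I3 (V : zmodType) (F : 'I_3 -> V) : \sum_i F i = F 0 + F 1 + F 2%:R.
Proof.
rewrite !big_ord_recl big_ord0 addr0 addrA.
by congr (_ + F _ + F _); apply/val_inj.
Qed.

Section Torus.
Context {R : realType}.
Implicit Types (a b : 'rV[R]_2) (v z : 'rV[R]_(2 + 2)).

(** The solid torus as a set of single row vectors in R^4, so that the chain rule for maps into row
    vectors applies. *)
Definition flat_torus : set 'rV[R]_(2 + 2) :=
  [set v | dot (lsubmx v) (lsubmx v) <= 1 /\ dot (rsubmx v) (rsubmx v) = 1].

Lemma dot2 a b : dot a b = a 0 0 * b 0 0 + a 0 1 * b 0 1.
Proof.
rewrite /dot !big_ord_recl big_ord0 addr0.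
by congr (_ + _ * _); congr (_ _ _); apply/val_inj.
Qed.

Lemma lsubmx_continuous : continuous (fun v => lsubmx v : 'rV[R]_2).
Proof. by move=> v; apply: differentiable_continuous; exact: differentiable_lsubmx. Qed.

Lemma rsubmx_continuous : continuous (fun v => rsubmx v : 'rV[R]_2).
Proof. by move=> v; apply: differentiable_continuous; exact: differentiable_rsubmx. Qed.

Lemma ldot_continuous : continuous (fun v => dot (lsubmx v) (lsubmx v)).
Proof.
move=> v; apply: (@continuous_comp _ _ _ (fun v => lsubmx v : 'rV[R]_2)
  (fun a => dot a a)); [exact: lsubmx_continuous|exact: dot_continuous].
Qed.

Lemma rdot_continuous : continuous (fun v => dot (rsubmx v) (rsubmx v)).
Proof.
move=> v; apply: (@continuous_comp _ _ _ (fun v => rsubmx v : 'rV[R]_2)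
  (fun a => dot a a)); [exact: rsubmx_continuous|exact: dot_continuous].
Qed.

Lemma flat_torus_compact : compact flat_torus.
Proof.
have cB : compact [set v : 'rV[R]_(2 + 2) | forall i, `[-1, 1]%classic (v ord0 i)].
  by apply: (@rV_compact R _ (fun=> `[-1, 1]%classic)) => i; exact: segment_compact.
apply: (subclosed_compact _ cB).
  have -> : flat_torus =
      (fun v => dot (lsubmx v) (lsubmx v)) @^-1` [set r | r <= 1] `&`
      (fun v => dot (rsubmx v) (rsubmx v)) @^-1` [set r | r = 1] by [].
  apply: closedI; apply: closed_comp.
  - by move=> v _; exact: ldot_continuous.
  - exact: closed_le.
  - by move=> v _; exact: rdot_continuous.
  - exact: closed_eq.
move=> v [l1 r1] i; rewrite /= in_itv /= -ler_norml -(@expr_le1 _ 2)// real_normK ?num_real//.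
case: (splitP i) => j ij.
  have -> : v ord0 i = (lsubmx v) 0 j by rewrite mxE; congr (v _ _); apply/val_inj.
  by apply: le_trans l1; exact: dot_coord.
have -> : v ord0 i = (rsubmx v) 0 j by rewrite mxE; congr (v _ _); apply/val_inj.
by rewrite -r1; exact: dot_coord.
Qed.

Variables (Q : set 'rV[R]_3) (f : 'rV[R]_3 -> 'rV[R]_(2 + 2)) (g : 'rV[R]_(2 + 2) -> 'rV[R]_3).
Hypotheses (Sf : smooth_on Q f) (Sg : smooth_on flat_torus g).
Hypotheses (fQ : forall x, Q x -> flat_torus (f x)) (gT : forall z, flat_torus z -> Q (g z)).
Hypotheses (fK : forall x, Q x -> g (f x) = x) (gK : forall z, flat_torus z -> f (g z) = z).

Lemma torus_image_compact : compact Q.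
Proof.
have -> : Q = g @` flat_torus.
  apply/seteqP; split=> [x Qx|_ [z Tz <-]]; last exact: gT.
  by exists (f x); [exact: fQ|exact: fK].
apply: continuous_compact flat_torus_compact.
exact: smooth_on_continuous.
Qed.

Definition perp b : 'rV[R]_2 := \row_i (if i == 0 then - b 0 1 else b 0 0).

Definition torus_dir z (i : 'I_3) : 'rV[R]_(2 + 2) :=
  if i == 2%:R then row_mx 0 (perp (rsubmx z))
  else row_mx (delta_mx 0 (if i == 0 then 0 else 1)) 0.

(** Straight lines in the two disc directions and a rotation in the circle direction: these curves
    stay in the torus for small [s] when the disc coordinate is interior. *)
Definition torus_curve z (i : 'I_3) (s : R) : 'rV[R]_(2 + 2) :=
  if i == 2%:R then row_mx (lsubmx z) 0 +
    (cos s *: row_mx 0 (rsubmx z) + sin s *: row_mx 0 (perp (rsubmx z)))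
  else z + s *: torus_dir z i.

Lemma torus_curve0 z i : torus_curve z i 0 = z.
Proof.
rewrite /torus_curve; case: ifP => _; last by rewrite scale0r addr0.
rewrite cos0 sin0 scale1r scale0r addr0 add_row_mx addr0 add0r hsubmxK //.
Qed.

Lemma is_derive_torus_curve z i : is_derive (0 : R) 1 (torus_curve z i) (torus_dir z i).
Proof.
have dZ (h : R -> R) (dh : R) (v : 'rV[R]_(2 + 2)) : is_derive (0 : R) 1 h dh ->
    is_derive (0 : R) 1 (fun s => h s *: v) (dh *: v).
  apply: (is_derive_lin (L := fun r : R => r *: v)).
    by move=> k r s; rewrite scalerDl -scalerA.
  exact: scalel_continuous.
rewrite /torus_curve; case i2: (i == 2%:R).
  have -> : torus_dir z i = 0 + ((- sin 0) *: row_mx 0 (rsubmx z) + cos 0 *: row_mx 0 (perp (rsubmx z))).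
    by rewrite /torus_dir i2 sin0 cos0 oppr0 scale0r scale1r !add0r.
  apply: is_deriveD; apply: is_deriveD; apply: dZ.
rewrite -[X in is_derive _ _ _ X]add0r -[X in is_derive _ _ _ (_ + X)]scale1r.
by apply: is_deriveD; apply: dZ.
Qed.

Lemma torus_curve_in z i : flat_torus z -> dot (lsubmx z) (lsubmx z) < 1 ->
  \forall s \near (0 : R), flat_torus (torus_curve z i s).
Proof.
move=> [_ r1] l1.
have cc : {for (0 : R), continuous (torus_curve z i)}.
  apply/differentiable_continuous/derivable1_diffP.
  exact: (is_derive_derivable (is_derive_torus_curve z i)).
have nl : \forall s \near (0 : R),
    dot (lsubmx (torus_curve z i s)) (lsubmx (torus_curve z i s)) < 1.
  have cl := cvg_comp _ _ cc (@ldot_continuous (torus_curve z i 0)).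
  by apply: (cvgr_lt _ cl); rewrite torus_curve0.
near=> s; split; first by apply: ltW; near: s.
rewrite /torus_curve; case: ifP => i2.
  rewrite !scale_row_mx !add_row_mx row_mxKr !add0r.
  rewrite -r1 !dot2 !mxE /=.
  have := cos2Dsin2 s; set c := cos s; set d := sin s => cd.
  set x := z 0 (rshift 2 0); set y := z 0 (rshift 2 1).
  transitivity ((c ^+ 2 + d ^+ 2) * (x * x + y * y)); first by ring.
  by rewrite cd mul1r.
by rewrite /torus_dir i2 -[in X in dot _ X](hsubmxK z) -{1}(hsubmxK z) scale_row_mx
  !add_row_mx !row_mxKr scaler0 addr0.
Unshelve. all: by end_near. Qed.

Lemma torus_dir_free z (c : 'I_3 -> R) : dot (rsubmx z) (rsubmx z) = 1 ->
  \sum_i c i *: torus_dir z i = 0 -> forall i, c i = 0.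
Proof.
move=> r1 E.
have /rowP El := congr1 (@lsubmx R 1 2 2) E.
have /rowP Er := congr1 (@rsubmx R 1 2 2) E.
have D0 : torus_dir z 0 = row_mx (delta_mx 0 0) 0 by [].
have D1 : torus_dir z 1 = row_mx (delta_mx 0 1) 0 by [].
have D2 : torus_dir z 2%:R = row_mx 0 (perp (rsubmx z)) by [].
rewrite sum_I3 D0 D1 D2 !scale_row_mx !add_row_mx in El Er.
have := El 0; have := El 1; have := Er 0; have := Er 1.
rewrite !row_mxKl !row_mxKr !mxE /= !(mulr0, mulr1, addr0, add0r) => e1 e0 c1 c0.
have c2 : c 2%:R = 0.
  have : c 2%:R * dot (rsubmx z) (rsubmx z) = 0.
    rewrite dot2 !mxE mulrDr !mulrA e1 mul0r add0r.
    by move/eqP: e0; rewrite mulrN oppr_eq0 => /eqP ->; rewrite mul0r.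
  by rewrite r1 mulr1.
exact: forall_I3.
Qed.

(* At the point [q] of [Q] closest to [p], the vector [q - p] is orthogonal to
   the three independent tangent directions of [Q]. *)
Lemma torus_critical p q : Q q -> dot (lsubmx (f q)) (lsubmx (f q)) < 1 ->
  (forall y, Q y -> dot (q - p) (q - p) <= dot (y - p) (y - p)) -> q = p.
Proof.
move=> Qq l1 qmin; pose z := f q; have Tz : flat_torus z by exact: fQ.
have [U [G [Uo Uz CG Gg]]] := Sg Tz.
have [U' [F [U'o U'q CF Ff]]] := Sf Qq.
have Gz : G z = q by rewrite Gg// fK.
pose w (i : 'I_3) : 'rV[R]_3 := 'D_(torus_dir z i) G z.
have coordC n m (V : 'I_n) (N : set 'rV[R]_m) (h : 'rV[R]_m -> 'rV[R]_n) k :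
    open N -> Ck k N h -> Ck k N (fun y => h y 0 V).
  move=> No; apply: (@Ck_lin _ _ _ _ _ N (fun M : 'rV_n => M 0 V)) => //.
    by move=> a u v; rewrite !mxE.
  exact: coord_continuous.
have dphi i : is_derive (0 : R) 1 (fun s => G (torus_curve z i s)) (w i).
  apply: is_derive_rV => j.
  have := is_derive_comp_rV (h := fun y => G y 0 j) Uo (coordC _ _ _ _ _ _ Uo (CG 1%N)) _
    (is_derive_torus_curve z i).
  rewrite torus_curve0 => /(_ Uz).
  have [_ <-] := is_derive_coord j (derivableP (Ck_derivable (CG 1%N) Uz (v := torus_dir z i))).
  by [].
have near_in i : \forall s \near (0 : R),
    [/\ flat_torus (torus_curve z i s), G (torus_curve z i s) = g (torus_curve z i s)
      & F (g (torus_curve z i s)) = torus_curve z i s].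
  have cc : {for (0 : R), continuous (torus_curve z i)}.
    apply/differentiable_continuous/derivable1_diffP.
    exact: (is_derive_derivable (is_derive_torus_curve z i)).
  have cG : {for (0 : R), continuous (fun s => G (torus_curve z i s))}.
    apply/differentiable_continuous/derivable1_diffP.
    exact: (is_derive_derivable (dphi i)).
  have nU : \forall s \near (0 : R), U (torus_curve z i s).
    by apply: cc; rewrite torus_curve0; exact: open_nbhs_nbhs.
  have nU' : \forall s \near (0 : R), U' (G (torus_curve z i s)).
    by apply: cG; rewrite torus_curve0 Gz; exact: open_nbhs_nbhs.
  have nT := torus_curve_in i Tz l1.
  near=> s.
  have Ts : flat_torus (torus_curve z i s) by near: s.
  have Us : U (torus_curve z i s) by near: s.
  have U's : U' (G (torus_curve z i s)) by near: s.
  have E := Gg _ Us Ts; split=> //; rewrite Ff ?gK//; last exact: gT.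
  by rewrite -E.
have w_orth i : dot (q - p) (w i) = 0.
  have dd : is_derive (0 : R) 1
     (fun s => dot (G (torus_curve z i s) - p) (G (torus_curve z i s) - p))
     (dot (q - p) (w i) *+ 2).
    have -> : dot (q - p) (w i) *+ 2 =
        \sum_j ((G (torus_curve z i 0) - p) 0 j *: w i 0 j +
                (G (torus_curve z i 0) - p) 0 j *: w i 0 j).
      rewrite torus_curve0 Gz /dot -sumrMnl; apply: eq_bigr => j _.
      by rewrite mulr2n.
    have := @is_derive_sum R R R 3 (fun j s => (G (torus_curve z i s) - p) 0 j * (G (torus_curve z i s) - p) 0 j)
       0 1.
    have -> : (fun s => dot (G (torus_curve z i s) - p) (G (torus_curve z i s) - p)) =
      \sum_j (fun s => (G (torus_curve z i s) - p) 0 j * (G (torus_curve z i s) - p) 0 j).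
      by apply/funext => s; rewrite fct_sumE.
    apply=> j; have dj : is_derive (0 : R) 1 (fun s => (G (torus_curve z i s) - p) 0 j) (w i 0 j).
      apply: is_derive_coord.
      by rewrite -[w i]subr0; apply: is_deriveB.
    exact: (@is_deriveM _ _ _ _ _ _ _ _ dj dj).
  have /(_ _)/eqP := is_derive_local_min dd; rewrite mulrn_eq0 /= => H.
  apply/eqP/H; have := near_in i; apply: filterS => s [Ts E _].
  by rewrite torus_curve0 Gz E; apply: qmin; exact: gT.
pose W : 'M[R]_3 := \matrix_i w i.
have Wu : W \in unitmx.
  rewrite -row_free_unit; apply: inj_row_free => u.
  rewrite mulmx_sum_row => uW; apply/rowP => i; rewrite mxE.
  apply: (torus_dir_free (z := z) (c := fun i => u 0 i)); first by have [] := Tz.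
  apply/rowP => k; rewrite mxE summxE.
  (* [F] inverts [G] along the curve, so the chain rule recovers each [torus_dir] from [w j]; a
     linear relation between the [w j] is thus one between the independent directions of the
     torus. *)
  have dF j : torus_dir z j 0 k = 'D_(w j) (fun y => F y 0 k) q.
    have CFk := coordC _ _ k _ _ _ U'o (CF 1%N).
    have := is_derive_comp_rV (h := fun y => F y 0 k) U'o CFk _ (dphi j).
    rewrite torus_curve0 Gz => /(_ U'q)[_ <-].
    have [_ <-] := is_derive_coord k (is_derive_torus_curve z j).
    apply: near_eq_derive; have := near_in j; apply: filterS => s [Ts E FE].
    by rewrite /= E FE.
  under eq_bigr do rewrite mxE dF.
  rewrite -(@Ck1_derive_sum _ _ _ _ _ _ _ _ U'o (coordC _ _ k _ _ _ U'o (CF 1%N)) U'q).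
  have -> : \sum_i u 0 i *: w i = 0.
    by rewrite -[RHS]uW; apply: eq_bigr => j _; rewrite rowK.
  exact: derive0.
apply/eqP; rewrite -subr_eq0; apply/eqP.
have : W *m (q - p)^T = 0.
  apply/matrixP => i j; rewrite !mxE ord1 -[RHS](w_orth i) /dot.
  by apply: eq_bigr => l _; rewrite !mxE mulrC.
move/(congr1 (mulmx (invmx W))); rewrite mulKmx// mulmx0.
by move/(congr1 trmx); rewrite trmxK trmx0.
Unshelve. all: by end_near. Qed.

(** A point [p] close to [x] has a nearest point [q] in the compact set [Q]; [q] is still close to
    [x], hence its disc coordinate lies in the open disc, and [torus_critical] gives [q = p]. So [p]
    belongs to [Q]. *)
Lemma torus_interior z : flat_torus z -> dot (lsubmx z) (lsubmx z) < 1 -> Q° (g z).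
Proof.
move=> Tz l1; set x := g z; have Qx : Q x by exact: gT.
have [U [F [Uo Ux CF Ff]]] := Sf Qx.
have : \forall y \near x, U y /\ dot (lsubmx (F y)) (lsubmx (F y)) < 1.
  have cl : (fun y => dot (lsubmx (F y)) (lsubmx (F y))) @ x
      --> dot (lsubmx (F x)) (lsubmx (F x)).
    exact: (cvg_comp _ _ (Ck_cont (CF 0%N) Ux) (@ldot_continuous (F x))).
  have nl : \forall y \near x, dot (lsubmx (F y)) (lsubmx (F y)) < 1.
    by apply: (cvgr_lt _ cl); rewrite Ff// gK.
  near=> y; split; last by near: y.
  by near: y; exact: open_nbhs_nbhs.
move=> /nbhs_ballP[d /= d0 Hd].
(* The bound on the distance from [q] to [p] below puts [q] within three times the distance from [x]
   to [p], hence within [d] of [x]. *)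
apply/nbhs_ballP; exists (d / 4); first by rewrite /= divr_gt0.
move=> p; rewrite -ball_normE /= => xp.
have dc : continuous (fun y : 'rV[R]_3 => dot (y - p) (y - p)).
  move=> y; have cy : {for y, continuous (fun y : 'rV[R]_3 => y - p)}.
    by apply: continuousB; [exact: cvg_id|exact: cst_continuous].
  exact: (cvg_comp _ _ cy (@dot_continuous R 3 (y - p))).
have [||q /[!inE] Qq qmin] := @compact_EVT_min _ R (fun y : 'rV[R]_3 => dot (y - p) (y - p)) Q _ torus_image_compact.
- by exists x.
- exact: continuous_subspaceT.
have {}qmin y : Q y -> dot (q - p) (q - p) <= dot (y - p) (y - p).
  by move=> Qy; apply: qmin; rewrite inE.
(* The squared Euclidean norm is at most 3 times the squared maximum norm, and 3 is at most the
   square of 2. *)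
have qp : `|q - p| <= 2 * `|x - p|.
  apply: norm_le_coord => [|i]; first by rewrite mulr_ge0.
  rewrite -(@ler_pXn2r _ 2) ?nnegrE ?mulr_ge0// real_normK ?num_real//.
  apply: le_trans (dot_coord _ i) _; apply: le_trans (qmin _ Qx) _.
  apply: le_trans (dot_le _) _; rewrite exprMn ler_wpM2r ?sqr_ge0//.
  by rewrite -natrX ler_nat.
have Bq : ball x d q.
  rewrite -ball_normE /= -(subrKA p) (le_lt_trans (ler_normD _ _))//.
  rewrite (distrC p).
  by move: qp xp d0; move: `|q - p| `|x - p| => u v *; lra.
have [Uq lq] := Hd _ Bq.
by rewrite -(@torus_critical p q)//; rewrite -Ff.
Unshelve. all: by end_near. Qed.

(** Shrinking the disc coordinate of [f x] by the factor [1 - s], with small [s > 0], gives points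
    over the open disc, whose images under [g] are interior and tend to [x]. *)
Lemma torus_closure_interior : Q `<=` closure Q°.
Proof.
move=> x Qx B xB; pose z := f x; have Tz : flat_torus z by exact: fQ.
have [U [G [Uo Uz CG Gg]]] := Sg Tz.
pose c (s : R) : 'rV[R]_(2 + 2) := z + s *: row_mx (- lsubmx z) 0.
have cE s : c s = row_mx ((1 - s) *: lsubmx z) (rsubmx z).
  by rewrite /c -{1}(hsubmxK z) scale_row_mx add_row_mx scaler0 addr0 scalerN scalerBl scale1r.
have c0 : c 0 = z by rewrite /c scale0r addr0.
have cc : {for (0 : R), continuous c}.
  apply: continuousD; first exact: cst_continuous.
  exact: scalel_continuous.
have nU : \forall s \near (0 : R), U (c s) by apply: cc; rewrite c0; exact: open_nbhs_nbhs.
have nB : \forall s \near (0 : R), B (G (c s)).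
  have cG : {for c 0, continuous G} by rewrite c0; exact: Ck_cont (CG 0%N) Uz.
  by apply: (cvg_comp _ _ cc cG); rewrite c0 Gg// fK.
have nU' : \forall s \near (0 : R)^'+, U (c s) by exact: cvg_within nU.
have nB' : \forall s \near (0 : R)^'+, B (G (c s)) by exact: cvg_within nB.
have rp : \forall s \near (0 : R)^'+, s < 1 by exact: nbhs_right_lt.
have [s [/= s0 [s1 [Us Bs]]]] := filter_ex (filterI (nbhs_right_gt (0 : R))
   (filterI rp (filterI nU' nB'))).
have dl : dot (lsubmx (c s)) (lsubmx (c s)) = (1 - s) ^+ 2 * dot (lsubmx z) (lsubmx z).
  by rewrite cE row_mxKl /dot mulr_sumr; apply: eq_bigr => i _; rewrite !mxE; ring.
have [l1 r1] := Tz.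
have dl1 : dot (lsubmx (c s)) (lsubmx (c s)) < 1.
  rewrite dl; apply: le_lt_trans (_ : (1 - s) ^+ 2 < 1).
    by rewrite ler_piMr// sqr_ge0.
  by rewrite expr_lt1// ?subr_ge0 ?ltW// ltrBlDr ltrDl.
have Ts : flat_torus (c s) by split; [exact: ltW|rewrite cE row_mxKr].
exists (G (c s)); split=> //; rewrite Gg//; exact: torus_interior.
Qed.

End Torus.

Lemma continuous_pair (R : realType) (V W W' : normedModType R)
    (f : V -> W) (g : V -> W') x :
  {for x, continuous f} -> {for x, continuous g} ->
  {for x, continuous (fun y => (f y, g y))}.
Proof. exact: cvg_pair. Qed.

Lemma solid_torus_closure_interior (R : realType) (Q : set 'rV[R]_3) :
  diffeomorphic Q (@solid_torus R) -> Q `<=` closure Q°.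
Proof.
move=> [f [g [Sf Sg fQ gT [fK gK]]]].
pose f' x : 'rV[R]_(2 + 2) := row_mx (f x).1 (f x).2.
pose A (v : 'rV[R]_(2 + 2)) : 'rV[R]_2 * 'rV[R]_2 := (lsubmx v, rsubmx v).
have cA : continuous A.
  move=> v; apply: continuous_pair.
    exact: lsubmx_continuous.
  exact: rsubmx_continuous.
apply: (@torus_closure_interior _ _ f' (g \o A)).
- apply: smooth_on_rV => k.
  case: (splitP k) => j kj.
    have -> : k = lshift 2 j by apply/val_inj.
    apply: (@eq_smooth_on _ _ _ _ (fun y => (f y).1 0 j)).
      by move=> y _; rewrite /f' row_mxEl.
    apply: (@smooth_on_lin _ _ Q ('rV[R]_2 * 'rV[R]_2)%type R (fun w => w.1 0 j)) Sf.
      by move=> a u v; rewrite !mxE.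
    move=> w; apply: (@continuous_comp _ _ _ (fun w : 'rV[R]_2 * 'rV[R]_2 => w.1)
        (fun M : 'rV[R]_2 => M 0 j)); [exact: cvg_fst|exact: coord_continuous].
  have -> : k = rshift 2 j by apply/val_inj.
  apply: (@eq_smooth_on _ _ _ _ (fun y => (f y).2 0 j)).
    by move=> y _; rewrite /f' row_mxEr.
  apply: (@smooth_on_lin _ _ Q ('rV[R]_2 * 'rV[R]_2)%type R (fun w => w.2 0 j)) Sf.
    by move=> a u v; rewrite !mxE.
  move=> w; apply: (@continuous_comp _ _ _ (fun w : 'rV[R]_2 * 'rV[R]_2 => w.2)
        (fun M : 'rV[R]_2 => M 0 j)); [exact: cvg_snd|exact: coord_continuous].
- apply: (smooth_on_affine (A0 := A) cA _ _ Sg).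
    by move=> y w h; rewrite /A !linearD !linearZ.
  by move=> v [].
- by move=> x /fQ[l1 r1]; split; rewrite /f' ?row_mxKl ?row_mxKr.
- by move=> z [l1 r1]; exact: gT.
- by move=> x Qx; rewrite /= /A /f' row_mxKl row_mxKr -surjective_pairing fK.
- by move=> z [l1 r1]; rewrite /f' /= gK //= hsubmxK.
Qed.

(** * Volume of sheared boxes *)

Section Strips.
Context {R : realType}.
Local Notation lam := (@lebesgue_measure R).
Local Open Scope ereal_scope.

Lemma le_lebesgue_measure (A B : set R) : A `<=` B -> lam A <= lam B.
Proof.
rewrite /lebesgue_measure /lebesgue_stieltjes_measure /measure_extension => AB.
exact: le_outer_measure.
Qed.

(* No measurability is needed: the integral of a nonnegative function is the
   supremum of those of the simple functions below it. *)
Lemma ge0_le_integralT d (T : measurableType d) (m : {measure set T -> \bar R})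
    (f g : T -> \bar R) : (forall x, 0 <= f x) -> (forall x, f x <= g x) ->
  \int[m]_x f x <= \int[m]_x g x.
Proof.
move=> f0 fg; rewrite !ge0_integralTE//; last by move=> x; exact: le_trans (fg x).
apply: le_ereal_sup => _ [h /= hf <-]; exists h => //= x.
exact: le_trans (fg x).
Qed.

Lemma le_volume (A B : set 'rV[R]_3) : A `<=` B -> volume A <= volume B.
Proof.
move=> AB; apply: ge0_le_integralT => // x.
by apply: le_lebesgue_measure => y; rewrite /xsection /= !inE; exact: AB.
Qed.

Lemma lebesgue_strip (c r : R) : (0 <= r)%R ->
  lam [set x : R | `|x - c| < r]%R = (2 * r)%:E.
Proof.
move=> r0; have -> : [set x : R | `|x - c| < r]%R = `](c - r)%R, (c + r)%R[%classic.
  apply/seteqP; split=> x /=; rewrite in_itv /= ltr_norml.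
    by move=> /andP[? ?]; apply/andP; split; lra.
  by move=> /andP[? ?]; apply/andP; split; lra.
rewrite lebesgue_measure_itv /= lte_fin; case: ifP => [_|].
  by rewrite -EFinD; congr EFin; ring.
move/negbT; rewrite -leNgt => rc; congr EFin; apply/eqP; rewrite eq_sym.
have -> : r = 0%R by apply/eqP; rewrite eq_le r0 andbT; move: rc; lra.
by rewrite mulr0.
Qed.

Section Fibered.
Context d (T : measurableType d) (m : {measure set T -> \bar R}).
Variables (D : set T) (k : T -> R) (r : R).
Hypotheses (mD : measurable D) (mk : measurable_fun setT k) (r0 : (0 <= r)%R).

Lemma measurable_strip1 :
  measurable [set p : T * measurableTypeR R | D p.1 /\ (`|p.2 - k p.1| < r)%R].
Proof.
have -> : [set p : T * measurableTypeR R | D p.1 /\ (`|p.2 - k p.1| < r)%R] =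
   fst @^-1` D `&` (fun p => `|p.2 - k p.1|%R) @^-1` `]-oo, r[%classic.
  by apply/seteqP; split=> p /=; rewrite in_itv.
apply: measurableI.
  by rewrite -[X in measurable X]setTI; exact: measurable_fst.
rewrite -[X in measurable X]setTI.
have mf : measurable_fun [set: T * measurableTypeR R] (fun p => `|p.2 - k p.1|%R).
  apply: measurableT_comp => //; apply: measurable_funB; first exact: measurable_snd.
  by apply: measurableT_comp => //; exact: measurable_fst.
exact: mf.
Qed.

Lemma measurable_strip2 :
  measurable [set p : measurableTypeR R * T | D p.2 /\ (`|p.1 - k p.2| < r)%R].
Proof.
have -> : [set p : measurableTypeR R * T | D p.2 /\ (`|p.1 - k p.2| < r)%R] =
   snd @^-1` D `&` (fun p => `|p.1 - k p.2|%R) @^-1` `]-oo, r[%classic.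
  by apply/seteqP; split=> p /=; rewrite in_itv.
apply: measurableI.
  by rewrite -[X in measurable X]setTI; exact: measurable_snd.
rewrite -[X in measurable X]setTI.
have mf : measurable_fun [set: measurableTypeR R * T] (fun p => `|p.1 - k p.2|%R).
  apply: measurableT_comp => //; apply: measurable_funB; first exact: measurable_fst.
  by apply: measurableT_comp => //; exact: measurable_snd.
exact: mf.
Qed.

(** Each section over [D] is an interval of length [2 * r], wherever its centre [k x] lies: this is
    the invariance of volume under shears. *)
Lemma product_strip1 :
  (m \x lam) [set p | D p.1 /\ (`|p.2 - k p.1| < r)%R] = m D * (2 * r)%:E.
Proof.
rewrite /product_measure1 /=.
rewrite (eq_integral (fun x => (\1_D x)%:E * (2 * r)%:E)); last first.
  move=> x _; rewrite indicE; have [xD|xD] /= := boolP (x \in D).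
    rewrite mul1e -(lebesgue_strip (k x) r0); congr (lam _).
    apply/seteqP; split=> y; rewrite /xsection /= inE /=; first by case.
    by rewrite inE in xD.
  rewrite mul0e -(measure0 lam); congr (lam _); apply/seteqP; split=> y //.
  by rewrite /xsection /= inE /= => -[Dx]; rewrite notin_setE in xD.
rewrite ge0_integralZr ?integral_indic ?setIT// ?lee_fin ?mulr_ge0//.
exact: measurableT_comp.
Qed.

Lemma product_strip2 :
  (lam \x^ m) [set p | D p.2 /\ (`|p.1 - k p.2| < r)%R] = (2 * r)%:E * m D.
Proof.
rewrite /product_measure2 /=.
rewrite (eq_integral (fun x => (2 * r)%:E * (\1_D x)%:E)); last first.
  move=> x _; rewrite indicE; have [xD|xD] /= := boolP (x \in D).
    rewrite mule1 -(lebesgue_strip (k x) r0); congr (lam _).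
    apply/seteqP; split=> y; rewrite /ysection /= inE /=; first by case.
    by rewrite inE in xD.
  rewrite mule0 -(measure0 lam); congr (lam _); apply/seteqP; split=> y //.
  by rewrite /ysection /= inE /= => -[Dx]; rewrite notin_setE in xD.
rewrite ge0_integralZl ?integral_indic ?setIT// ?lee_fin ?mulr_ge0//.
exact: measurableT_comp.
Qed.

End Fibered.

Lemma product_measure12 d1 d2 (T1 : measurableType d1) (T2 : measurableType d2)
    (m1 : {sigma_finite_measure set T1 -> \bar R})
    (m2 : {sigma_finite_measure set T2 -> \bar R}) (X : set (T1 * T2)) :
  measurable X -> (m1 \x m2) X = (m1 \x^ m2) X.
Proof.
move=> mX; apply: product_measure_unique => // A B mA mB.
exact: product_measure2E.
Qed.

End Strips.

(* A name of its own for the plane measure: the canonical sigma-finite structure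
   on [\x] is the one for subprobabilities. *)
Definition lebesgue2 (R : realType) :
    set (measurableTypeR R * measurableTypeR R) -> \bar R :=
  (@lebesgue_measure R \x @lebesgue_measure R)%E.

HB.instance Definition _ (R : realType) := Measure.on (@lebesgue2 R).

Lemma lebesgue2_sigma_finite (R : realType) :
  sigma_finite [set: measurableTypeR R * measurableTypeR R] (@lebesgue2 R).
Proof.
have /sigma_finiteP[F [FT ndF Foo]] := sigma_finiteT (@lebesgue_measure R).
exists (fun n => F n `*` F n).
  apply/esym; rewrite -subTset => -[x y] _.
  have : (\bigcup_i F i) x by rewrite -FT.
  have : (\bigcup_i F i) y by rewrite -FT.
  move=> [j _ Fjy] [i _ Fix]; exists (maxn i j) => //; split => /=.
    by have /subsetPset := ndF _ _ (leq_maxl i j); exact.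
  by have /subsetPset := ndF _ _ (leq_maxr i j); exact.
move=> n; have [mF Fy] := Foo n; split; first exact: measurableX.
by rewrite /lebesgue2 product_measure1E// lte_mul_pinfty// ge0_fin_numE.
Qed.

HB.instance Definition _ (R : realType) :=
  Measure_isSigmaFinite.Build _ _ _ (@lebesgue2 R) (@lebesgue2_sigma_finite R).

Section Boxes.
Context {R : realType}.
Local Notation mR := (measurableTypeR R).
Local Notation lam := (@lebesgue_measure R).
Local Notation lam2 := (@lebesgue2 R).
Variables (c0 c1 c2 r0 r1 r2 : R).
Hypotheses (r00 : 0 <= r0) (r10 : 0 <= r1) (r20 : 0 <= r2).

Lemma measurable_affine1 (a b : R) :
  measurable_fun [set: mR] (fun x => a + b * x).
Proof.
apply: measurable_funD; first exact: measurable_cst.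
by apply: measurable_funM; [exact: measurable_cst|exact: measurable_id].
Qed.

Lemma measurable_strip (c r : R) :
  measurable [set x : mR | `|x - c| < r].
Proof.
have -> : [set x : R | `|x - c| < r] = `](c - r)%R, (c + r)%R[%classic; last first.
  exact: measurable_itv.
apply/seteqP; split=> x /=; rewrite in_itv /= ltr_norml.
  by move=> /andP[? ?]; apply/andP; split; lra.
by move=> /andP[? ?]; apply/andP; split; lra.
Qed.

(** The preimage of a box under a unit lower triangular map: each centre depends only on the
    preceding coordinates, so [product_strip1] applies twice. *)
Lemma volume_lower_box (a b c : R) :
  volume [set z : 'rV[R]_3 | [/\ `|z 0 0 - c0| < r0,
     `|z 0 1 - (c1 + a * z 0 0)| < r1 &
     `|z 0 2%:R - (c2 + b * z 0 0 + c * z 0 1)| < r2]] =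
  ((2 * r0) * (2 * r1) * (2 * r2))%:E.
Proof.
pose D1 := [set x : mR | `|x - c0| < r0].
pose D2 := [set p : mR * mR | D1 p.1 /\ `|p.2 - (c1 + a * p.1)| < r1].
have mD2 : measurable D2.
  exact: (measurable_strip1 r1 (measurable_strip c0 r0) (measurable_affine1 c1 a)).
have vD2 : lam2 D2 = ((2 * r0) * (2 * r1))%:E.
  have L1 : lam D1 = (2 * r0)%:E by exact: lebesgue_strip.
  transitivity (lam D1 * (2 * r1)%:E)%E; last by rewrite L1 -EFinM.
  exact: (product_strip1 lam (fun x => c1 + a * x) (measurable_strip c0 r0) r10).
transitivity (lam2 D2 * (2 * r2)%:E)%E; last by rewrite vD2 -EFinM.
rewrite -[RHS](product_strip1 lam2 (fun p => c2 + b * p.1 + c * p.2) mD2 r20).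
rewrite /volume; congr (product_measure1 _ _ _).
apply/seteqP; split=> t /=; rewrite !mxE /=.
  by move=> [H1 H2 H3].
by move=> [[H1 H2] H3].
Qed.

Lemma volume_upper_box (a b c : R) :
  volume [set z : 'rV[R]_3 | [/\ `|z 0 2%:R - c2| < r2,
     `|z 0 1 - (c1 + a * z 0 2%:R)| < r1 &
     `|z 0 0 - (c0 + b * z 0 1 + c * z 0 2%:R)| < r0]] =
  ((2 * r0) * (2 * r1) * (2 * r2))%:E.
Proof.
set S := [set t : mR * mR * mR | [/\ `|t.2 - c2| < r2,
     `|t.1.2 - (c1 + a * t.2)| < r1 &
     `|t.1.1 - (c0 + b * t.1.2 + c * t.2)| < r0]].
have -> : volume [set z : 'rV[R]_3 | [/\ `|z 0 2%:R - c2| < r2,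
     `|z 0 1 - (c1 + a * z 0 2%:R)| < r1 &
     `|z 0 0 - (c0 + b * z 0 1 + c * z 0 2%:R)| < r0]] = (lam2 \x lam)%E S.
  rewrite /volume; congr (product_measure1 _ _ _).
  by apply/seteqP; split=> t /=; rewrite !mxE.
have mS : measurable S.
  have -> : S = [set t | `|t.2 - c2| < r2 /\ `|t.1.2 - (c1 + a * t.2)| < r1] `&`
     [set t | `|t.1.1 - (c0 + b * t.1.2 + c * t.2)| < r0].
    by apply/seteqP; split=> t /=; [case|move=> [[? ?] ?]].
  have m11 : measurable_fun [set: mR * mR * mR] (fun t => t.1.1).
    by apply: (measurableT_comp measurable_fst measurable_fst).
  have m12 : measurable_fun [set: mR * mR * mR] (fun t => t.1.2).
    by apply: (measurableT_comp measurable_snd measurable_fst).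
  have m2 : measurable_fun [set: mR * mR * mR] snd.
    exact: measurable_snd.
  have m_lt (f : mR * mR * mR -> mR) (s : R) :
      measurable_fun setT f -> measurable [set t | `|f t| < s].
    move=> mf; have -> : [set t | `|f t| < s] = setT `&` (fun t => `|f t|) @^-1` `]-oo, s[%classic.
      by apply/seteqP; split=> t /=; rewrite in_itv //= => -[].
    have mf' : measurable_fun [set: mR * mR * mR] (fun t => `|f t|).
      by apply: measurableT_comp.
    exact: mf'.
  have mZ (f : mR * mR * mR -> mR) (s : R) :
      measurable_fun setT f -> measurable_fun setT (fun t => s * f t).
    by move=> mf; apply: measurable_funM => //; exact: measurable_cst.
  apply: measurableI; last first.
    apply: m_lt; apply: measurable_funB => //; apply: measurable_funD; last exact: mZ.
    by apply: measurable_funD; [exact: measurable_cst|exact: mZ].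
  have -> : [set t : mR * mR * mR
       | `|t.2 - c2| < r2 /\ `|t.1.2 - (c1 + a * t.2)| < r1] =
     [set t | `|t.2 - c2| < r2] `&` [set t | `|t.1.2 - (c1 + a * t.2)| < r1] by [].
  apply: measurableI; apply: m_lt; apply: measurable_funB => //.
  by apply: measurable_funD; [exact: measurable_cst|exact: mZ].
(* The centres depend here on the last coordinate, over which [\x] integrates innermost; the order
   of integration is exchanged, and this calls for the measurability of [S]. *)
transitivity ((lam2 \x^ lam)%E S).
  exact: (product_measure12 lam2 lam mS).
rewrite /product_measure2 /=.
rewrite (eq_integral (fun z => ((2 * r0) * (2 * r1))%:E * (\1_[set x : mR | `|x - c2| < r2] z)%:E)%E); last first.
  move=> z _; rewrite indicE; have [zD|zD] /= := boolP (z \in _).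
    pose k := fun y : mR => (c0 + c * z) + b * y.
    pose D1 := [set y : mR | `|y - (c1 + a * z)| < r1].
    have mD1 : measurable D1 by exact: measurable_strip.
    have E : ysection S z = [set p | D1 p.2 /\ (`|p.1 - k p.2| < r0)%R].
      apply/seteqP; split=> p; rewrite /ysection /= inE /= /k.
        move=> [H1 H2 H3]; split=> //.
        by rewrite addrAC.
      move=> [H1 H2]; rewrite inE in zD; split=> //.
      by rewrite addrAC.
    rewrite mule1 E.
    transitivity ((lam \x^ lam)%E [set p : mR * mR | D1 p.2 /\ (`|p.1 - k p.2| < r0)%R]).
      exact: (product_measure12 lam lam (measurable_strip2 r0 mD1 (measurable_affine1 (c0 + c * z) b))).
    have L1 : lam D1 = (2 * r1)%:E by exact: lebesgue_strip.
    transitivity ((2 * r0)%:E * lam D1)%E; last by rewrite L1 -EFinM.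
    exact: (product_strip2 lam k mD1 r00).
  rewrite mule0 -(measure0 lam2); congr (product_measure1 _ _ _).
  apply/seteqP; split=> p //.
  by rewrite /ysection /= inE /= => -[H _ _]; rewrite notin_setE in zD.
pose D2 := [set x : mR | `|x - c2| < r2].
have L2 : lam D2 = (2 * r2)%:E by exact: lebesgue_strip.
have mD2 : measurable D2 by exact: measurable_strip.
transitivity ((2 * r0 * (2 * r1))%:E * lam D2)%E; last by rewrite L2 -EFinM.
rewrite ge0_integralZl ?integral_indic ?setIT// ?lee_fin ?mulr_ge0//.
exact: measurableT_comp.
Qed.

End Boxes.

Lemma near_finite (R : realType) (V : normedModType R) (I : finType)
    (P : I -> V -> Prop) (x : V) :
  (forall i, \forall z \near x, P i z) -> \forall z \near x, forall i, P i z.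
Proof. exact: filter_forall. Qed.

(** * Divergence of the generator *)

Section FlowEstimate.
Context {R : realType}.
Local Notation V3 := 'rV[R]_3.
Variables (G : V3 * R -> V3) (U : set (V3 * R)) (x0 : V3).
Hypotheses (Uo : open U) (U0 : U (x0, 0)) (CG : Cinfty U G).
Hypothesis G0 : forall y, U (y, 0) -> G (y, 0) = y.

(** For a flow [G] this is the derivative in direction [j] of the [i]-th component of the generator
    at [x0]. *)
Definition flow_jac (i j : 'I_3) : R :=
  'D_(delta_mx 0 j, 0) ('D_(0, 1) (fun z => G z 0 i)) (x0, 0).

Let Gi i z := G z 0 i.

Let CGi k i : Ck k U (Gi i).
Proof.
apply: (@Ck_lin _ _ _ _ _ U (fun M : V3 => M 0 i)) => //.
  by move=> a u v; rewrite !mxE.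
exact: coord_continuous.
Qed.

(** Mean values in [t] and in [y]: the difference of two orbits starts at [y 0 i], and its variation
    is [t] times mixed derivatives applied to [y]. The error is thus proportional to both [|t|] and
    [|y|], as needed to compare volumes at order [t]. *)
Lemma flow_estimate (e : R) : 0 < e -> exists2 d, 0 < d &
  forall y t, `|y| < d -> `|t| < d -> U (x0 + y, t) /\ forall i,
   `|G (x0 + y, t) 0 i - G (x0, t) 0 i - y 0 i - t * \sum_j flow_jac i j * y 0 j|
     <= e * `|t| * `|y|.
Proof.
move=> e0; pose D i j := 'D_(delta_mx 0 j, 0) ('D_(0, 1) (Gi i)).
have cD i j : {for (x0, 0), continuous (D i j)}.
  by apply: Ck_cont U0; apply: Ck_derive; apply: Ck_derive; exact: (CGi 2%N).
(* One third for each of the three terms of the sum over [j]. *)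
have e30 : 0 < e / 3 by rewrite divr_gt0.
pose P (ij : 'I_3 * 'I_3) (z : V3 * R) := `|D ij.1 ij.2 (x0, 0) - D ij.1 ij.2 z| <= e / 3.
have nDD : nbhs (x0, 0 : R) [set z | forall ij, P ij z].
  apply: (@near_finite R (V3 * R)%type _ P) => ij.
  by have /cvgrPdist_le/(_ _ e30) := cD ij.1 ij.2.
have nU : nbhs (x0, 0 : R) U by exact: open_nbhs_nbhs.
have /nbhs_ballP[d /= d0 Hd] : nbhs (x0, 0 : R) (U `&` [set z | forall ij, P ij z]).
  exact: filterI.
exists d => // y t yd td.
have inB (a b : R) : 0 <= a <= 1 -> 0 <= b <= 1 -> ball (x0, 0 : R) d (x0 + a *: y, b * t).
  move=> /andP[a0 a1] /andP[b0 b1]; split; rewrite /= -ball_normE /=.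
    rewrite opprD addNKr normrN normrZ ger0_norm//.
    by apply: le_lt_trans yd; rewrite ler_piMl.
  rewrite sub0r normrN normrM ger0_norm//.
  by apply: le_lt_trans td; rewrite ler_piMl.
have I0 : 0 <= (0 : R) <= 1 by rewrite lexx ler01.
have I1 : 0 <= (1 : R) <= 1 by rewrite lexx ler01.
split; first by have [] := Hd _ (inB 1 1 I1 I1); rewrite scale1r mul1r.
move=> i.
have U1 b : 0 <= b <= 1 -> U (x0 + y, b * t).
  by move=> b01; have [] := Hd _ (inB 1 b I1 b01); rewrite scale1r.
have U0b b : 0 <= b <= 1 -> U (x0, b * t).
  by move=> b01; have [] := Hd _ (inB 0 b I0 b01); rewrite scale0r addr0.
pose h (s : R) := Gi i (x0 + y, s) - Gi i (x0, s).
have dh b : 0 <= b <= 1 -> is_derive (0 + b *: t) t h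
    (t * ('D_(0, 1) (Gi i) (x0 + y, b * t) - 'D_(0, 1) (Gi i) (x0, b * t))).
  move=> b01; rewrite add0r -{2}(mulr1 t); apply: (is_deriveZdir (v := 1 : R)).
  apply: is_deriveB.
    apply: (@is_derive_affine R (V3 * R)%type R R (fun s => (x0 + y, s)) (fun s => (0, s))).
      exact: fiber_affine.
    by apply/derivableP; apply: (Ck_derivable (CGi 1 i)); exact: U1.
  apply: (@is_derive_affine R (V3 * R)%type R R (fun s => (x0, s)) (fun s => (0, s))).
    exact: fiber_affine.
  by apply/derivableP; apply: (Ck_derivable (CGi 1 i)); exact: U0b.
have [b b01 Eb] := MVT_line (fun b b01 => is_derive_derivable (dh b b01)).
have [_ Db] := dh _ b01; rewrite Db add0r in Eb.
have dk a : 0 <= a <= 1 -> is_derive (x0 + a *: y) y (fun x => 'D_(0, 1) (Gi i) (x, b * t))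
    (\sum_j y 0 j * D i j (x0 + a *: y, b * t)).
  move=> a01; have Ua : U (x0 + a *: y, b * t) by have [] := Hd _ (inB a b a01 b01).
  have C1 : Ck 1 U ('D_(0, 1) (Gi i)) by apply: Ck_derive; exact: (CGi 2 i).
  have -> : \sum_j y 0 j * D i j (x0 + a *: y, b * t) =
      'D_(y, 0) ('D_(0, 1) (Gi i)) (x0 + a *: y, b * t).
    rewrite -(@Ck1_derive_sum R _ U _ _ _ _ _ Uo C1 Ua); congr (derive _ _ _).
    apply/esym; rewrite {1}(row_sum_delta y).
    elim/big_rec2 : _ => // j v w _ <-.
    by rewrite -[RHS]/(_, _) /= scaler0 addr0.
  apply: (@is_derive_affine R (V3 * R)%type V3 R (fun x => (x, b * t)) (fun v => (v, 0)) ('D_(0, 1) (Gi i))).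
    exact: slice_affine.
  exact/derivableP/(Ck_derivable C1).
have [a a01 Ea] := MVT_line (fun a a01 => is_derive_derivable (dk a a01)).
have [_ Da] := dk _ a01; rewrite Da in Ea.
have [Uab Hab] := Hd _ (inB a b a01 b01).
have E0 : h 0 = y 0 i.
  rewrite /h /Gi !G0; [by rewrite !mxE addrAC subrr add0r| |].
    by have := U0b 0 I0; rewrite mul0r.
  by have := U1 0 I0; rewrite mul0r.
have -> : G (x0 + y, t) 0 i - G (x0, t) 0 i - y 0 i - t * \sum_j flow_jac i j * y 0 j =
  t * \sum_j y 0 j * (D i j (x0 + a *: y, b * t) - D i j (x0, 0)).
  rewrite -E0 -/(Gi _ _) -/(Gi _ _) -/(h t) Eb Ea -mulrBr; congr (_ * _).
  rewrite -sumrB; apply: eq_bigr => j _.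
  have -> : flow_jac i j = D i j (x0, 0) by [].
  by move: (D i j (x0, 0)) (D i j _) => ? ?; ring.
rewrite normrM -mulrA mulrCA ler_wpM2l//.
apply: le_trans (ler_norm_sum _ _ _) _.
have -> : e * `|y| = \sum_(j < 3) (e / 3 * `|y|).
  by rewrite sumr_const card_ord -mulr_natl; move: `|y| => ?; field.
apply: ler_sum => j _; rewrite normrM mulrC ler_pM//; last exact: coord_le_norm.
by rewrite distrC; exact: (Hab (i, j)).
Qed.

End FlowEstimate.

Section Contraction.
Context {R : realType}.

(** The inequality of means for two numbers reduces it to [((3 - c) / 2) ^+ 2 * c <= 1], where the
    difference factors as [(1 - c) ^+ 2 * (4 - c) / 4]. *)
Lemma AGM3_lt1 (a b c : R) : 0 < a -> 0 < b -> 0 < c -> a + b + c < 3 ->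
  a * b * c < 1.
Proof.
move=> a0 b0 c0 s3; have ab : a * b <= ((a + b) / 2) ^+ 2.
  rewrite -subr_ge0; have -> : ((a + b) / 2) ^+ 2 - a * b = ((a - b) / 2) ^+ 2 by field.
  exact: sqr_ge0.
have ab3 : a + b < 3 - c by rewrite ltrBrDr.
have ab4 : ((a + b) / 2) ^+ 2 < ((3 - c) / 2) ^+ 2.
  by rewrite ltrXn2r ?nnegrE ?divr_ge0 ?(ltW (addr_gt0 a0 b0)) ?ltr_pM2r ?invr_gt0//
    (le_trans (ltW (addr_gt0 a0 b0)))// ltW.
apply: lt_le_trans (_ : ((3 - c) / 2) ^+ 2 * c <= 1).
  by rewrite ltr_pM2r// (le_lt_trans ab).
have c3 : c < 3 by move: s3; lra.
rewrite -subr_ge0; have -> : 1 - ((3 - c) / 2) ^+ 2 * c = (1 - c) ^+ 2 * (4 - c) / 4.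
  by field.
by rewrite divr_ge0// mulr_ge0 ?sqr_ge0//; move: c3; lra.
Qed.

Lemma norm_mul3_le (t K M x X : R) : 0 <= t -> `|M| <= K -> `|x| <= X ->
  `|t * M * x| <= K * t * X.
Proof.
move=> t0 MK xX; rewrite !normrM (ger0_norm t0) [t * _]mulrC.
by rewrite ler_pM ?mulr_ge0// ler_wpM2r.
Qed.

(* The matrix [1 + t M] maps the upper box into a slightly enlarged lower box:
   [1 + t M = (1 + t L) (1 + t U)] up to [O(t^2)], [U] being the strict upper
   part of [M]. *)
Lemma box_estimate (M : 'I_3 -> 'I_3 -> R) (K e t r : R) (y z : 'I_3 -> R) :
  1 <= K -> (forall i j, `|M i j| <= K) -> 0 < t -> K * t <= 1 / 4 -> 0 < r ->
  0 <= e <= 1 ->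
  `|y 2%:R| < r -> `|y 1 + t * M 1 2%:R * y 2%:R| < r ->
  `|y 0 + t * M 0 1 * y 1 + t * M 0 2%:R * y 2%:R| < r ->
  ((forall i, `|y i| <= 2 * r) -> forall i,
    `|z i - y i - (t * M i 0 * y 0 + t * M i 1 * y 1 + t * M i 2%:R * y 2%:R)| <= e * t * (2 * r)) ->
  let eta := 2 * e + 16 * K ^+ 2 * t in
  [/\ (forall i, `|y i| <= 2 * r),
   `|z 0| < r * (1 + t * (M 0 0 + eta)),
   `|z 1 - t * M 1 0 * z 0| < r * (1 + t * (M 1 1 + eta)) &
   `|z 2%:R - t * M 2%:R 0 * z 0 - t * M 2%:R 1 * z 1| < r * (1 + t * (M 2%:R 2%:R + eta))].
Proof.
move=> K1 MK t0 Kt r0 /andP[e0 e1] y2r w1r w0r zE eta.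
have K0 : 0 <= K by apply: le_trans K1.
have t0' := ltW t0; have r0' := ltW r0.
(* [q] is the size of first order displacements and [p] that of second order ones; [r * t * eta]
   equals [2 * (e * t * r) + 16 * p]. *)
pose q := K * t * r; pose p := K * t * q.
have q0 : 0 <= q by rewrite !mulr_ge0.
have p0 : 0 <= p by rewrite !mulr_ge0.
have qr : q <= r / 4 by rewrite /q; have := ler_wpM2r r0' Kt; lra.
have eq_ : e * t * r <= q by rewrite /q ler_wpM2r// ler_wpM2r// (le_trans e1).
have etr0 : 0 <= e * t * r by rewrite !mulr_ge0.
have bnd M' x X : `|M'| <= K -> `|x| <= X -> `|t * M' * x| <= K * t * X.
  exact: norm_mul3_le.
have b2 : `|y 2%:R| <= 2 * r by move: y2r r0; move: `|_| => u; lra.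
have T12 := bnd _ _ _ (MK 1 2%:R) (ltW y2r).
have b1 : `|y 1| <= 2 * r.
  have := ler_normB (y 1 + t * M 1 2%:R * y 2%:R) (t * M 1 2%:R * y 2%:R).
  rewrite addrK; move: T12; rewrite -/q.
  by move: w1r qr r0; move: `|y 1| `|y 1 + _| `|t * _ * _| => u v w; lra.
have T01 := bnd _ _ _ (MK 0 1) b1.
have T02 := bnd _ _ _ (MK 0 2%:R) b2.
have E2q : K * t * (2 * r) = 2 * q by rewrite /q; ring.
have b0 : `|y 0| <= 2 * r.
  have tri (u v w : R) : `|u| <= `|u + v + w| + `|v| + `|w|.
    have := ler_normB (u + v + w) w; have := ler_normB (u + v) v.
    by rewrite !addrK; move: `|u| `|u + v| `|u + v + w| `|v| `|w| => *; lra.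
  have := tri (y 0) (t * M 0 1 * y 1) (t * M 0 2%:R * y 2%:R).
  move: T01 T02; rewrite E2q.
  move: w0r qr r0; move: `|y 0| `|y 0 + _ + _| `|t * _ * y 1| `|t * _ * y 2%:R| => ? ? ? ?.
  lra.
have b i : `|y i| <= 2 * r by move: i; apply: (@forall_I3 (fun i => `|y i| <= 2 * r)).
have {}zE := zE b.
pose E i := z i - y i - (t * M i 0 * y 0 + t * M i 1 * y 1 + t * M i 2%:R * y 2%:R).
have {}zE i : `|E i| <= 2 * (e * t * r).
  have -> : 2 * (e * t * r) = e * t * (2 * r) by ring.
  exact: zE.
have T i j : `|t * M i j * y j| <= 2 * q by rewrite -E2q; exact: bnd.
have D i : `|y i - z i| <= 8 * q.
  have -> : y i - z i = - (E i + (t * M i 0 * y 0 + t * M i 1 * y 1 + t * M i 2%:R * y 2%:R)).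
    by rewrite /E; ring.
  rewrite normrN; apply: le_trans (ler_normD _ _) _.
  have := ler_normD (t * M i 0 * y 0 + t * M i 1 * y 1) (t * M i 2%:R * y 2%:R).
  have := ler_normD (t * M i 0 * y 0) (t * M i 1 * y 1).
  have := T i 0; have := T i 1; have := T i 2%:R; have := zE i; move: eq_.
  move: `|E i| `|t * _ * _ + _ + _| `|t * _ * _ + _| `|t * _ * y 0| `|t * _ * y 1| `|t * _ * y 2%:R| => *; lra.
have MA i j x : `|x| <= 8 * q -> `|t * M i j * x| <= 8 * p.
  by move=> /(bnd _ _ _ (MK i j)); rewrite /p; congr (_ <= _); ring.
have Mpos i : 0 <= 1 + t * M i i.
  have := bnd _ _ _ (MK i i) (_ : `|1| <= 1); rewrite normr1 => /(_ (lexx _)).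
  by rewrite !mulr1 ler_norml => /andP[+ _]; move: Kt; lra.
(* Each coordinate to be bounded is a diagonal factor times one of the three quantities bounded by
   [r], plus a small remainder [A]. *)
have final i w A (s : R) : `|w| < r -> s = w * (1 + t * M i i) + A ->
    `|A| <= 16 * p + 2 * (e * t * r) -> `|s| < r * (1 + t * (M i i + eta)).
  move=> wr -> HA; apply: le_lt_trans (ler_normD _ _) _.
  rewrite normrM (ger0_norm (Mpos i)).
  have -> : r * (1 + t * (M i i + eta)) = r * (1 + t * M i i) + (16 * p + 2 * (e * t * r)).
    by rewrite /eta /p /q; ring.
  apply: ltr_leD => //; rewrite ltr_pM2r//.
  rewrite lt_def Mpos andbT; apply/eqP => M0.
  have := bnd _ _ _ (MK i i) (_ : `|1| <= 1); rewrite normr1 => /(_ (lexx _)).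
  by rewrite !mulr1 ler_norml => /andP[+ _]; move: Kt M0; lra.
split=> //.
- apply: (final 0 (y 0 + t * M 0 1 * y 1 + t * M 0 2%:R * y 2%:R)
    (t * M 0 0 * - (t * M 0 1 * y 1 + t * M 0 2%:R * y 2%:R) + E 0)) => //.
    by rewrite /E; ring.
  apply: le_trans (ler_normD _ _) _.
  have : `|- (t * M 0 1 * y 1 + t * M 0 2%:R * y 2%:R)| <= 8 * q.
    rewrite normrN; have := ler_normD (t * M 0 1 * y 1) (t * M 0 2%:R * y 2%:R).
    have := T 0 1; have := T 0 2%:R; move: q0.
    move: `|t * _ * _ + _| `|t * _ * y 1| `|t * _ * y 2%:R| => *; lra.
  move=> /(MA 0 0); have := zE 0; move: p0 `|t * M 0 0 * _| `|E 0| => *; lra.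
- apply: (final 1 (y 1 + t * M 1 2%:R * y 2%:R)
    (t * M 1 1 * - (t * M 1 2%:R * y 2%:R) + t * M 1 0 * (y 0 - z 0) + E 1)) => //.
    by rewrite /E; ring.
  apply: le_trans (ler_normD _ _) _.
  have := ler_normD (t * M 1 1 * - (t * M 1 2%:R * y 2%:R)) (t * M 1 0 * (y 0 - z 0)).
  have : `|- (t * M 1 2%:R * y 2%:R)| <= 8 * q.
    by rewrite normrN; have := T 1 2%:R; move: q0 `|t * _ * _| => *; lra.
  move=> /(MA 1 1); have := MA 1 0 _ (D 0); have := zE 1.
  move: p0 `|t * M 1 1 * _| `|t * M 1 0 * _| `|_ + _| `|E 1| => *; lra.
- apply: (final 2%:R (y 2%:R)
    (t * M 2%:R 0 * (y 0 - z 0) + t * M 2%:R 1 * (y 1 - z 1) + E 2%:R)) => //.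
    by rewrite /E; ring.
  apply: le_trans (ler_normD _ _) _.
  have := ler_normD (t * M 2%:R 0 * (y 0 - z 0)) (t * M 2%:R 1 * (y 1 - z 1)).
  have := MA 2%:R 0 _ (D 0); have := MA 2%:R 1 _ (D 1); have := zE 2%:R.
  move: p0 `|t * M _ 0 * _| `|t * M _ 1 * _| `|_ + _| `|E _| => *; lra.
Qed.

End Contraction.

Section Trace.
Context {R : realType}.
Local Notation V3 := 'rV[R]_3.
Variables (G : V3 * R -> V3) (U : set (V3 * R)) (x0 : V3) (dv : R).
Hypotheses (Uo : open U) (U0 : U (x0, 0)) (CG : Cinfty U G).
Hypothesis G0 : forall y, U (y, 0) -> G (y, 0) = y.
Hypothesis dv0 : 0 < dv.
Hypothesis Gvol : forall t (N : set V3), `|t| < dv -> open N -> N `<=` ball x0 dv ->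
  volume N = volume ((fun y => G (y, t)) @` N).

Lemma open_affine_strip (i j k : 'I_3) (c a b r : R) :
  open [set z : V3 | `|z 0 i - (c + a * z 0 j + b * z 0 k)| < r].
Proof.
have -> : [set z : V3 | `|z 0 i - (c + a * z 0 j + b * z 0 k)| < r] =
  (fun z : V3 => `|z 0 i - (c + a * z 0 j + b * z 0 k)|) @^-1` [set s | s < r] by [].
apply: open_comp; last exact: open_lt.
move=> z _; apply: (@continuous_comp _ _ _ (fun z : V3 => z 0 i - (c + a * z 0 j + b * z 0 k)) (fun s : R => `|s|)); last exact: norm_continuous.
have cc (l : 'I_3) (s : R) : {for z, continuous (fun z : V3 => s * z 0 l)}.
  apply: (@continuous_comp _ _ _ (fun z : V3 => z 0 l) (fun u => s * u)).
    exact: coord_continuous.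
  exact: mulrl_continuous.
apply: (@continuousB _ _ _ (fun z : V3 => z 0 i)); first exact: coord_continuous.
apply: (@continuousD _ _ _ (fun z : V3 => c + a * z 0 j) (fun z : V3 => b * z 0 k)); last exact: cc.
by apply: (@continuousD _ _ _ (fun z : V3 => c) (fun z : V3 => a * z 0 j)); [exact: cst_continuous|exact: cc].
Qed.

(** A negative trace makes the product of the diagonal factors [1 + t * (M i i + eta)] less than 1
    by the inequality of means, so the image of [O] would lie in a set [S] of smaller volume. *)
Lemma flow_trace_ge0 : 0 <= \sum_i flow_jac G x0 i i.
Proof.
have [M ME] : exists M, M = flow_jac G x0 by exists (flow_jac G x0).
have HM := flow_estimate Uo U0 CG G0; rewrite -ME in HM *.
rewrite sum_I3 leNgt; apply/negP => mneg; set m := _ + _ in mneg.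
pose K := 1 + \sum_i \sum_j `|M i j|.
have K1 : 1 <= K by rewrite lerDl sumr_ge0// => i _; rewrite sumr_ge0.
have K0 : 0 < K by rewrite (lt_le_trans _ K1).
have MK i j : `|M i j| <= K.
  have le_term (F : 'I_3 -> R) k : (forall l, 0 <= F l) -> F k <= \sum_l F l.
    by move=> F0; rewrite (bigD1 k)//= lerDl sumr_ge0.
  apply: le_trans (le_term (fun j => `|M i j|) j _) _ => //.
  apply: le_trans (le_term (fun i => \sum_j `|M i j|) i _) _; last by rewrite lerDr.
  by move=> k; rewrite sumr_ge0.
(* With [2 * e] and [16 * K ^+ 2 * t] both at most [- m / 12], [eta] is at most [- m / 6] and
   [m + 3 * eta] stays negative. *)
pose e := Num.min 1 (- m / 24).
have e0 : 0 < e by rewrite lt_min ltr01 divr_gt0// oppr_gt0.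
have e1 : e <= 1 by rewrite ge_min lexx.
have em : 2 * e <= - m / 12.
  have : e <= - m / 24 by rewrite ge_min lexx orbT.
  by lra.
have [d d0 Hd] := HM _ e0.
(* The first bound gives the smallness [K * t <= 1 / 4] asked by [box_estimate], the second controls
   the share of [eta] linear in [t], and [d] and [dv] keep the time within reach of the estimate and
   of volume preservation. *)
pose T := Num.min (Num.min ((4 * K)^-1) (- m / (192 * K ^+ 2))) (Num.min d dv).
have K20 : 0 < K ^+ 2 by rewrite exprn_gt0.
have T0 : 0 < T by rewrite !lt_min d0 dv0 invr_gt0 divr_gt0 ?mulr_gt0// oppr_gt0.
pose t := T / 2.
have t0 : 0 < t by rewrite divr_gt0.
have tT : t < T by rewrite /t; move: T0; lra.
have [td tdv] : t < d /\ t < dv.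
  split; apply: lt_le_trans tT _; rewrite /T; last by rewrite !ge_min lexx !orbT.
  by rewrite !ge_min lexx !orbT.
have Kt : K * t <= 1 / 4.
  have : t <= (4 * K)^-1 by apply: le_trans (ltW tT) _; rewrite !ge_min lexx.
  rewrite -(ler_pM2l K0) => /le_trans; apply.
  by rewrite (_ : K * (4 * K)^-1 = 1 / 4)//; field; exact: lt0r_neq0.
have Kt2 : 16 * K ^+ 2 * t <= - m / 12.
  have : t <= - m / (192 * K ^+ 2).
    by apply: le_trans (ltW tT) _; rewrite !ge_min lexx orbT.
  rewrite ler_pdivlMr ?mulr_gt0// => H.
  by rewrite ler_pdivlMr//; apply: le_trans H; rewrite le_eqVlt; apply/orP; left; apply/eqP; ring.
pose r := Num.min d dv / 4.
have r0 : 0 < r by rewrite divr_gt0// lt_min d0.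
have [rd rdv] : 2 * r < d /\ 2 * r < dv.
  have h1 : Num.min d dv <= d by rewrite ge_min lexx.
  have h2 : Num.min d dv <= dv by rewrite ge_min lexx orbT.
  by rewrite /r; split; lra.
(* The points that [1 + t U], with [U] the strict upper part of [M], sends into the cube of half
   side [r] around the image of [x0]. *)
pose O := [set z : V3 | [/\ `|z 0 2%:R - x0 0 2%:R| < r,
     `|z 0 1 - ((x0 0 1 + t * M 1 2%:R * x0 0 2%:R) + - (t * M 1 2%:R) * z 0 2%:R)| < r &
     `|z 0 0 - ((x0 0 0 + t * M 0 1 * x0 0 1 + t * M 0 2%:R * x0 0 2%:R)
        + - (t * M 0 1) * z 0 1 + - (t * M 0 2%:R) * z 0 2%:R)| < r]].
have Oo : open O.
  have -> : O = [set z : V3 | `|z 0 2%:R - (x0 0 2%:R + 0 * z 0 0 + 0 * z 0 0)| < r] `&`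
    ([set z : V3 | `|z 0 1 - ((x0 0 1 + t * M 1 2%:R * x0 0 2%:R) + - (t * M 1 2%:R) * z 0 2%:R + 0 * z 0 0)| < r] `&`
     [set z : V3 | `|z 0 0 - ((x0 0 0 + t * M 0 1 * x0 0 1 + t * M 0 2%:R * x0 0 2%:R)
        + - (t * M 0 1) * z 0 1 + - (t * M 0 2%:R) * z 0 2%:R)| < r]).
    by apply/seteqP; split=> z /=; rewrite !mul0r !addr0; [case|move=> [? []]].
  by apply: openI; [|apply: openI]; exact: open_affine_strip.
have vO : volume O = ((2 * r) * (2 * r) * (2 * r))%:E.
  exact: (volume_upper_box _ _ _ (ltW r0) (ltW r0) (ltW r0)).
pose eta := 2 * e + 16 * K ^+ 2 * t.
have key z : O z -> let y := z - x0 in let z' := G (x0 + y, t) - G (x0, t) in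
  [/\ (forall i, `|y 0 i| <= 2 * r),
   `|z' 0 0| < r * (1 + t * (M 0 0 + eta)),
   `|z' 0 1 - t * M 1 0 * z' 0 0| < r * (1 + t * (M 1 1 + eta)) &
   `|z' 0 2%:R - t * M 2%:R 0 * z' 0 0 - t * M 2%:R 1 * z' 0 1| < r * (1 + t * (M 2%:R 2%:R + eta))].
  move=> [h2 h1 h0] y z'.
  have yE i : y 0 i = z 0 i - x0 0 i by rewrite !mxE.
  apply: (box_estimate (y := fun i => y 0 i) (z := fun i => z' 0 i) K1 MK t0 Kt r0).
  - by rewrite (ltW e0).
  - by rewrite yE.
  - by rewrite !yE; congr (`|_| < r): h1; ring.
  - by rewrite !yE; congr (`|_| < r): h0; ring.
  move=> yr i.
  have yn : `|y| <= 2 * r by apply: norm_le_coord => //; rewrite mulr_ge0// ltW.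
  have t_d : `|t| < d by rewrite gtr0_norm.
  have [_ /(_ i)] := Hd y t (le_lt_trans yn rd) t_d.
  rewrite (gtr0_norm t0) sum_I3 => H.
  have {}H := le_trans H (ler_wpM2l (mulr_ge0 (ltW e0) (ltW t0)) yn).
  apply: le_trans H; rewrite le_eqVlt; apply/orP; left; apply/eqP; congr (`|_|).
  by rewrite !mxE; ring.
have eta0 : 0 <= eta by rewrite addr_ge0// !mulr_ge0 ?exprn_ge0 ?ltW.
have eta_m : eta <= - m / 6 by rewrite /eta; move: em Kt2; lra.
have rho0 i : 0 < 1 + t * (M i i + eta).
  have Mi : - K <= M i i by have := MK i i; rewrite ler_norml => /andP[].
  have H : t * - (K) <= t * (M i i + eta) by rewrite ler_pM2l// (le_trans Mi)// lerDl.
  by move: H Kt; rewrite mulrN [t * K]mulrC; lra.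
have prod1 : (1 + t * (M 0 0 + eta)) * (1 + t * (M 1 1 + eta)) * (1 + t * (M 2%:R 2%:R + eta)) < 1.
  apply: AGM3_lt1 => //.
  have -> : 1 + t * (M 0 0 + eta) + (1 + t * (M 1 1 + eta)) + (1 + t * (M 2%:R 2%:R + eta)) =
    3 + t * (m + 3 * eta) by rewrite /m; ring.
  rewrite gtrDl pmulr_rlt0//.
  by move: eta_m mneg; lra.
pose X := G (x0, t).
pose S := [set z : V3 | [/\ `|z 0 0 - X 0 0| < r * (1 + t * (M 0 0 + eta)),
     `|z 0 1 - ((X 0 1 - t * M 1 0 * X 0 0) + t * M 1 0 * z 0 0)| < r * (1 + t * (M 1 1 + eta)) &
     `|z 0 2%:R - ((X 0 2%:R - t * M 2%:R 0 * X 0 0 - t * M 2%:R 1 * X 0 1)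
       + t * M 2%:R 0 * z 0 0 + t * M 2%:R 1 * z 0 1)| < r * (1 + t * (M 2%:R 2%:R + eta))]].
have OS : (fun y => G (y, t)) @` O `<=` S.
  move=> _ [z Oz <-]; have [_] := key _ Oz.
  rewrite /= (addrC x0) subrK -/X !mxE => k0 k1 k2; split => //=.
    by congr (`|_| < _): k1; ring.
  by congr (`|_| < _): k2; ring.
have OB : O `<=` ball x0 dv.
  move=> z /key[yr _ _ _]; rewrite -ball_normE /= distrC.
  apply: le_lt_trans rdv; apply: norm_le_coord => //; by rewrite mulr_ge0// ltW.
have := le_volume OS; rewrite -Gvol ?gtr0_norm// vO.
have -> : volume S = ((2 * (r * (1 + t * (M 0 0 + eta)))) * (2 * (r * (1 + t * (M 1 1 + eta))))
    * (2 * (r * (1 + t * (M 2%:R 2%:R + eta)))))%:E.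
  by apply: volume_lower_box; rewrite mulr_ge0// ltW.
rewrite lee_fin leNgt => /negP; apply.
rewrite (_ : _ * _ * _ = (2 * r) * (2 * r) * (2 * r) * ((1 + t * (M 0 0 + eta)) * (1 + t * (M 1 1 + eta)) * (1 + t * (M 2%:R 2%:R + eta)))); last by ring.
have r2 : 0 < 2 * r by rewrite mulr_gt0.
have r30 : 0 < 2 * r * (2 * r) * (2 * r) by apply: mulr_gt0 => //; exact: mulr_gt0.
by rewrite gtr_pMr.
Qed.

End Trace.

Lemma itg_FTC (R : realType) (F f : R -> R) (a b : R) : a < b ->
  {within `[a, b], continuous f} -> (forall t : R, is_derive t 1 F (f t)) ->
  itg a b f = F b - F a.
Proof.
move=> ab cf dF; have cF : continuous F.
  move=> t; apply/differentiable_continuous/derivable1_diffP.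
  exact: (is_derive_derivable (dF t)).
rewrite /itg /Rintegral (@continuous_FTC2 R f F a b ab cf)//.
- split; first by move=> t _; exact: (is_derive_derivable (dF t)).
  + by apply: cvg_at_right_filter; exact: cF.
  + by apply: cvg_at_left_filter; exact: cF.
- by move=> t _; rewrite derive1E; have [_ ->] := dF t.
Qed.

Section Action.
Context {R : realType}.
Local Notation V3 := 'rV[R]_3.
Local Notation e := (@Defs.basis R).
Variables (Q : set V3) (Phi : R -> V3 -> V3).
Hypotheses (HQ : Q `<=` closure Q°) (act : circle_action Q Phi).
Local Notation C := (cylinder Q).
Local Notation u := (generator Phi).
Let HC : C `<=` closure C° := @cylinder_closure_interior R _ Q HQ.

Definition orbit_map (z : V3 * R) : V3 := Phi z.2 z.1.
Definition orbit_coord (k : 'I_3) (z : V3 * R) : R := orbit_map z 0 k.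
Local Notation phi := orbit_coord.

Lemma action_smooth : smooth_on C orbit_map.
Proof. by have [] := act. Qed.

Lemma action_in t x : Q x -> Q (Phi t x).
Proof. by have [/(_ t)[g [_ _ H _ _]] _ _ _ _] := act; exact: H. Qed.

Lemma action0 x : Q x -> Phi 0 x = x.
Proof. by have [_ _ H _ _] := act; exact: H. Qed.

Lemma actionD s t x : Q x -> Phi (s + t) x = Phi s (Phi t x).
Proof. by have [_ _ _ H _] := act; exact: H. Qed.

Lemma smooth_on_phi k : smooth_on C (phi k).
Proof. by apply: smooth_on_coord; exact: action_smooth. Qed.

Lemma is_derive_orbit x (t : R) : Q x ->
  is_derive t 1 (fun s => Phi s x) (dder C orbit_map (x, t) (0, 1)).
Proof. by move=> Qx; exact: (is_derive_fiber HQ t action_smooth Qx). Qed.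

Lemma generatorE x : Q x -> u x = dder C orbit_map (x, 0) (0, 1).
Proof. by move=> Qx; rewrite /generator derive1E; have [_ ->] := is_derive_orbit 0 Qx. Qed.

Lemma smooth_on_generator : smooth_on Q u.
Proof.
apply: (@eq_smooth_on _ _ _ _ (fun x => dder C orbit_map (x, 0) (0, 1))).
  by move=> x Qx; rewrite generatorE.
apply: (smooth_on_slice (H := fun z => dder C orbit_map z (0, 1))).
exact: (smooth_on_dder HC (0, 1) action_smooth).
Qed.

Lemma smooth_on_gen k : smooth_on Q (fun x => u x 0 k).
Proof. by apply: smooth_on_coord; exact: smooth_on_generator. Qed.

(** The flow equation, from the group law [Phi (s + t) x = Phi s (Phi t x)] differentiated at
    [s = 0]. *)
Lemma dder_orbit_time x t : Q x -> dder C orbit_map (x, t) (0, 1) = u (Phi t x).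
Proof.
move=> Qx; have H1 := is_derive_orbit t Qx.
have Qtx := action_in t Qx; have H2 := is_derive_orbit 0 Qtx.
rewrite (generatorE Qtx); have [_ <-] := H2.
have E : (fun s => Phi s (Phi t x)) = (fun s => Phi (t + s *: 1) x).
  by apply/funext => s; rewrite [s *: 1]mulr1 addrC actionD.
have /is_derive_lineP[_ <-] := H1.
by rewrite E.
Qed.

Lemma dder_phi_time k x t : Q x -> dder C (phi k) (x, t) (0, 1) = u (Phi t x) 0 k.
Proof.
by move=> Qx; rewrite -dder_orbit_time// (dder_coord HC)//; exact: action_smooth.
Qed.

Lemma dder_phi_space k x t v : Q x ->
  dder C (phi k) (x, t) (v, 0) = dder Q (Phi t) x v 0 k.
Proof.
move=> Qx; rewrite -(dder_slice HQ t v (smooth_on_phi k) Qx).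
rewrite (dder_coord HQ) //; exact: (smooth_on_slice (H := orbit_map) t action_smooth).
Qed.

Lemma smooth_on_action t : smooth_on Q (Phi t).
Proof. exact: (smooth_on_slice (H := orbit_map) t action_smooth). Qed.

(* Differentiate [Phi_(t + s) = Phi_t \o Phi_s] at [s = 0]. *)
Lemma dder_orbit_push t x : Q x -> dder Q (Phi t) x (u x) = u (Phi t x).
Proof.
move=> Qx; apply/rowP => k; rewrite -dder_phi_time//.
rewrite (dder_coord HQ)//; last exact: smooth_on_action.
have Sf : smooth_on [set: R] (fun s => Phi s x).
  exact: (smooth_on_fiber (H := orbit_map) action_smooth Qx).
have := @dder_comp_rV R R 3 setT Q (fun y => Phi t y 0 k) (fun s => Phi s x)
  (@setT_closure_interior R R) HQ (smooth_on_coord k (smooth_on_action t)) Sf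
  (fun s _ => action_in s Qx) (0 : R) (1 : R) I.
have -> : dder setT (fun s => Phi s x) (0 : R) (1 : R) = u x.
  rewrite generatorE//; have [_ <-] := is_derive_orbit 0 Qx.
  by have [_ ->] := is_derive_dderT (0 : R) (1 : R) Sf.
rewrite action0// => <-.
have Sh : smooth_on [set: R] ((fun y => Phi t y 0 k) \o (fun s => Phi s x)).
  exact: (smooth_on_comp_rV (smooth_on_coord k (smooth_on_action t)) Sf (fun s _ => action_in s Qx)).
have [_ <-] := is_derive_dderT (0 : R) (1 : R) Sh.
have H := is_derive_fiber HQ t (smooth_on_phi k) Qx.
have /is_derive_lineP[_ <-] := H.
have E : (fun y => Phi t y 0 k) \o (fun s => Phi s x) = (fun s => phi k (x, t + s *: 1)).
  by apply/funext => s /=; rewrite /orbit_coord /orbit_map /= [s *: 1]mulr1 actionD.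
by rewrite E.
Qed.

End Action.

Section Divergence.
Context {R : realType}.
Local Notation V3 := 'rV[R]_3.
Local Notation e := (@Defs.basis R).
Variables (Q : set V3).
Hypothesis HQ : Q `<=` closure Q°.

(** Near an interior point the extension [G] coincides with the action on a full neighbourhood, and
    small open sets lie in [Q], so volume preservation passes to [G]. *)
Lemma divergence_generator_ge0 (Phi : R -> V3 -> V3) (x : V3) :
  circle_action Q Phi -> volume_preserving Q Phi -> Q° x ->
  0 <= \sum_i dder Q (fun y => generator Phi y 0 i) x (e i).
Proof.
move=> act vp Qix; have Qx : Q x := interior_subset Qix.
have HC := @cylinder_closure_interior R _ Q HQ.
have Cx : cylinder Q (x, 0 : R) by [].
have [U [G [Uo Ux CG Gg]]] := action_smooth act Cx.
pose U' := U `&` (fst @^-1` Q°).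
have U'o : open U'.
  apply: openI => //; apply: open_comp; last exact: open_interior.
  by move=> z _; exact: cvg_fst.
have U'x : U' (x, 0 : R) by [].
have CG' : Cinfty U' G by move=> k; apply: Ck_subset (CG k) => z [].
have GE z : U' z -> G z = Phi z.2 z.1.
  by move=> [Uz Qz]; rewrite Gg//; split=> //; exact: interior_subset.
have G0 y : U' (y, 0) -> G (y, 0) = y.
  by move=> U'y; rewrite GE//= (action0 act)//; exact: interior_subset U'y.2.
have /nbhs_ballP[d /= d0 Hd] : nbhs (x, 0 : R) U' by exact: open_nbhs_nbhs.
have Gvol t (N : set V3) : `|t| < d -> open N -> N `<=` ball x d ->
    volume N = volume ((fun y => G (y, t)) @` N).
  move=> td No NB.
  have inU y : N y -> U' (y, t).
    by move=> /NB xy; apply: Hd; split=> //=; rewrite -ball_normE /= sub0r normrN.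
  have NQ : N `<=` Q by move=> y /inU[_ /interior_subset].
  have := vp t N No; rewrite (_ : Q `&` N = N); last by apply/setIidPr.
  move=> ->; congr volume; apply/seteqP; split=> _ [y Ny <-]; exists y => //.
    by rewrite GE//; exact: inU.
  by rewrite GE//; exact: inU.
have := flow_trace_ge0 U'o U'x CG' G0 d0 Gvol; congr (_ <= _).
apply: eq_bigr => i _.
have Ei : smooth_extension (cylinder Q) (orbit_coord Phi i) (x, 0 : R) U (fun z => G z 0 i).
  split=> //.
  - move=> k; apply: (@Ck_lin _ _ _ _ _ U (fun M : V3 => M 0 i)) => //.
      by move=> a v w; rewrite !mxE.
    exact: coord_continuous.
  - by move=> z Uz Cz; rewrite Gg.
have -> : dder Q (fun y => generator Phi y 0 i) x (e i) =
    dder Q (fun y => dder (cylinder Q) (orbit_coord Phi i) (y, 0) (0, 1)) x (e i).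
  by apply: eq_dder => y Qy; rewrite (dder_phi_time HQ act i 0 Qy) (action0 act Qy).
have Sd := smooth_on_dder HC (0, 1) (smooth_on_phi act i).
rewrite (dder_slice HQ (H := fun z => dder (cylinder Q) (orbit_coord Phi i) z (0, 1)) 0 (e i) Sd Qx).
by rewrite (dder_ext HC (e i, 0) Cx (smooth_extension_dder HC (0, 1) Ei)).
Qed.

Lemma circle_action_reverse (Phi : R -> V3 -> V3) :
  circle_action Q Phi -> circle_action Q (fun t => Phi (- t)).
Proof.
move=> [dPhi per P0 PD S]; split.
- by move=> t; exact: dPhi.
- by move=> t x Qx /=; rewrite -(per (- (t + 2 * pi)) x Qx) opprD subrK.
- by move=> x Qx; rewrite oppr0 P0.
- by move=> s t x Qx; rewrite opprD PD.
- apply: (@smooth_on_affine R _ _ _ (cylinder Q) _ (fun z : V3 * R => (z.1, - z.2))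
    (fun z => (z.1, - z.2)) (fun z : V3 * R => Phi z.2 z.1)) S => //.
  + move=> z; apply: continuous_pair; first exact: cvg_fst.
    by apply: continuousN; exact: cvg_snd.
  + by move=> [y s] [w r] h; congr (_, _); rewrite /= opprD scalerN.
Qed.

Lemma generator_reverse (Phi : R -> V3 -> V3) (x : V3) : circle_action Q Phi -> Q x ->
  generator (fun t => Phi (- t)) x = - generator Phi x.
Proof.
move=> act Qx; apply/rowP => k; rewrite mxE.
have act' := circle_action_reverse act.
have Dk (Psi : R -> V3 -> V3) : circle_action Q Psi ->
    is_derive (0 : R) 1 (fun s => Psi s x 0 k) (generator Psi x 0 k).
  move=> aPsi; apply: is_derive_coord; rewrite (generatorE HQ aPsi)//.
  exact: is_derive_orbit.
have dN : is_derive (0 : R) 1 (fun s : R => - s) (-1) by apply: is_deriveN.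
have H := Dk _ act; rewrite -{1}oppr0 in H.
have [_ E1] := @is_derive1_comp _ (fun s => Phi s x 0 k) (fun s => - s) 0 _ _ H dN.
have [_ E2] := Dk _ act'.
by rewrite -E2 -mulrN1 -E1.
Qed.

Lemma volume_preserving_reverse (Phi : R -> V3 -> V3) :
  volume_preserving Q Phi -> volume_preserving Q (fun t => Phi (- t)).
Proof. by move=> vp t; exact: vp. Qed.

(** The inequalities for the action and for the reversed one settle interior points; the other
    points follow by continuity, [Q] being in the closure of its interior. *)
Lemma divergence_generator (Phi : R -> V3 -> V3) (x : V3) :
  circle_action Q Phi -> volume_preserving Q Phi -> Q x ->
  \sum_i dder Q (fun y => generator Phi y 0 i) x (e i) = 0.
Proof.
move=> act vp; set D := fun x => \sum_i dder Q (fun y => generator Phi y 0 i) x (e i).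
have act' := circle_action_reverse act.
have Su i := smooth_on_gen HQ act i.
have SD : smooth_on Q D by apply: smooth_on_sum => i; exact: smooth_on_dder.
have Di y : Q° y -> D y = 0.
  move=> Qy; have Qy' := interior_subset Qy; apply/eqP; rewrite eq_le.
  rewrite (divergence_generator_ge0 act vp Qy) andbT.
  have := divergence_generator_ge0 act' (volume_preserving_reverse vp) Qy.
  have -> : \sum_i dder Q (fun y => generator (fun t => Phi (- t)) y 0 i) y (e i) = - D y.
    rewrite /D -sumrN; apply: eq_bigr => i _; rewrite -(dderN HQ)//.
    by apply: eq_dder => z Qz; rewrite generator_reverse// mxE.
  by rewrite oppr_ge0.
move=> Qx; have [U [g [Uo Ux Cg gD]]] := SD _ Qx; rewrite -/(D x) -gD//.
apply/eqP; apply/negP => /negP gx0.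
have cg := Ck_cont (Cg 0%N) Ux.
have n0' : nbhs (g x) [set r : R | r != 0] by apply: open_nbhs_nbhs; split.
have n0 : \forall y \near x, g y != 0 by exact: (cg _ n0').
have [y [Qy [Uy gy]]] := HQ Qx (filterI (open_nbhs_nbhs (conj Uo Ux)) n0).
by move: gy; rewrite /= gD ?Di ?eqxx//; exact: interior_subset.
Qed.

End Divergence.

(** Positivity is asked at the left end because there, at time 0, the integrand of the averaged
    metric is [dot v v]. *)
Lemma itg_gt0 (R : realType) (f : R -> R) (a b : R) : a < b ->
  {within `[a, b], continuous f} -> (forall t, a <= t <= b -> 0 <= f t) ->
  {for a, continuous f} -> 0 < f a -> 0 < itg a b f.
Proof.
move=> ab cf f0 ca fa.
have /nbhs_ballP[d /= d0 Hd] : \forall t \near a, f a / 2 < f t.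
  have n0 : nbhs (f a) [set r | f a / 2 < r].
    by apply: open_nbhs_nbhs; split; [exact: open_gt|rewrite /=; lra].
  exact: (ca _ n0).
pose c := Num.min b (a + d / 2).
have ac : a < c by rewrite lt_min ab; lra.
have cb : c <= b by rewrite ge_min lexx.
have acb : `[a, c] `<=` `[a, b] by apply: subset_itvl; rewrite bnd_simp.
have cbb : `[c, b] `<=` `[a, b] by apply: subset_itvr; rewrite bnd_simp ltW.
have cfac : {within `[a, c], continuous f} by exact: continuous_subspaceW acb cf.
have cfcb : {within `[c, b], continuous f} by exact: continuous_subspaceW cbb cf.
have H1 : f a / 2 * (c - a) <= itg a c f.
  rewrite -(itg_cst _ (ltW ac)); apply: itg_le => //.
    by move=> t; exact: cvg_cst.
  move=> t /andP[at1 tc]; apply/ltW/Hd; rewrite -ball_normE /= ltr_distlC.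
  have : t <= a + d / 2 by rewrite (le_trans tc)// /c ge_min lexx orbT.
  by move=> ?; apply/andP; split; lra.
have H2 : 0 <= itg c b f.
  rewrite -(mul0r (b - c)) -(itg_cst _ cb); apply: itg_le => //.
    by move=> t; exact: cvg_cst.
  by move=> t /andP[ct tb]; apply: f0; rewrite tb (le_trans (ltW ac)).
rewrite (itg_split (ltW ac) cb cf); apply: ltr_pwDl => //.
by apply: lt_le_trans H1; apply: mulr_gt0; [lra|rewrite subr_gt0].
Qed.

Lemma dotC (R : realType) n (a b : 'rV[R]_n) : dot a b = dot b a.
Proof. by apply: eq_bigr => i _; rewrite mulrC. Qed.

Lemma dot_combination (R : realType) (a b v w : 'rV[R]_3) (J : 'I_3 -> 'I_3 -> R) :
  (forall k, a 0 k = \sum_i v 0 i * J i k) -> (forall k, b 0 k = \sum_i w 0 i * J i k) ->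
  dot a b = \sum_i \sum_j v 0 i * w 0 j * \sum_k J i k * J j k.
Proof.
move=> aE bE.
have -> : dot a b = \sum_k \sum_i \sum_j v 0 i * w 0 j * (J i k * J j k).
  apply: eq_bigr => k _; rewrite aE bE big_distrlr.
  by apply: eq_bigr => i _; apply: eq_bigr => j _; rewrite /= mulrACA.
rewrite exchange_big; apply: eq_bigr => i _; rewrite exchange_big /=.
by apply: eq_bigr => j _; rewrite mulr_sumr.
Qed.

(** * The averaged metric and its vector calculus *)

Section Metric.
Context {R : realType}.
Local Notation V3 := 'rV[R]_3.
Local Notation e := (@Defs.basis R).
Variables (Q : set V3) (Phi : R -> V3 -> V3).
Hypotheses (HQ : Q `<=` closure Q°) (act : circle_action Q Phi).
Local Notation C := (cylinder Q).
Local Notation u := (generator Phi).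
Local Notation phi := (orbit_coord Phi).
Let HC : C `<=` closure C° := @cylinder_closure_interior R _ Q HQ.

(** [z] is a pair of a point and a time, so that smoothness is joint; [i] is the direction and [k]
    the component. [pull] collects the components of the pulled-back Euclidean metric. *)
Definition jac (i k : 'I_3) (z : V3 * R) : R := dder C (phi k) z (e i, 0).
Definition pull (i j : 'I_3) (z : V3 * R) : R := \sum_k jac i k z * jac j k z.
Definition metric (i j : 'I_3) (x : V3) : R := avg_metric Q Phi x (e i) (e j).

Lemma smooth_on_jac i k : smooth_on C (jac i k).
Proof. exact: (smooth_on_dder HC (e i, 0) (smooth_on_phi act k)). Qed.

Lemma smooth_on_pull i j : smooth_on C (pull i j).
Proof. by apply: smooth_on_sum => k; apply: smooth_onM; exact: smooth_on_jac. Qed.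

Lemma jacE i k x t : Q x -> jac i k (x, t) = dder Q (Phi t) x (e i) 0 k.
Proof. exact: dder_phi_space. Qed.

Lemma dder_action (x : V3) (t : R) (v : V3) k : Q x ->
  dder Q (Phi t) x v 0 k = \sum_i v 0 i * jac i k (x, t).
Proof.
move=> Qx; have SP := smooth_on_action act t.
rewrite (dder_coord HQ)// (dder_rV_sum _ HQ)//; last exact: smooth_on_coord.
by apply: eq_bigr => i _; rewrite jacE// (dder_coord HQ).
Qed.

Lemma dot_dder_action (x : V3) (t : R) (v w : V3) : Q x ->
  dot (dder Q (Phi t) x v) (dder Q (Phi t) x w) =
  \sum_i \sum_j v 0 i * w 0 j * pull i j (x, t).
Proof.
move=> Qx; apply: dot_combination => k; exact: dder_action.
Qed.

Lemma pi2_gt0 : 0 < 2 * pi :> R.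
Proof. by rewrite mulr_gt0// pi_gt0. Qed.

Lemma metricE i j x : Q x ->
  metric i j x = (2 * pi)^-1 * itg 0 (2 * pi) (fun t => pull i j (x, t)).
Proof.
move=> Qx; congr (_ * _); apply: eq_itg => t _; rewrite /dot /pull.
by apply: eq_bigr => k _; rewrite !jacE.
Qed.

Lemma avg_metricE (x v w : V3) : Q x ->
  avg_metric Q Phi x v w = \sum_i \sum_j v 0 i * w 0 j * metric i j x.
Proof.
move=> Qx; rewrite /avg_metric -[circle_integral _]/(itg 0 (2 * pi) _).
under eq_itg do rewrite dot_dder_action//.
have cp i j : {within `[0, 2 * pi], continuous (fun t => pull i j (x, t))}.
  exact: fiber_continuous (smooth_on_pull i j) Qx.
have czp i j : {within `[0, 2 * pi], continuous (fun t => v 0 i * w 0 j * pull i j (x, t))}.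
  exact: within_continuousZ.
rewrite itg_sum; last by move=> i; exact: within_continuous_sum.
rewrite mulr_sumr; apply: eq_bigr => i _; rewrite itg_sum//.
rewrite mulr_sumr; apply: eq_bigr => j _; rewrite itgZ// metricE//.
by rewrite mulrCA.
Qed.

Lemma avg_metric_gt0 (x v : V3) : Q x -> v != 0 -> 0 < avg_metric Q Phi x v v.
Proof.
move=> Qx v0; apply: mulr_gt0; first by rewrite invr_gt0 pi2_gt0.
have Sf : smooth_on [set: R] (fun t => dot (dder Q (Phi t) x v) (dder Q (Phi t) x v)).
  apply: (@eq_smooth_on _ _ _ _ (fun t => \sum_i \sum_j v 0 i * v 0 j * pull i j (x, t))).
    by move=> t _; rewrite dot_dder_action.
  do 2 (apply: smooth_on_sum => ?); apply: smooth_onM; first exact: smooth_on_cst.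
  exact: smooth_on_fiber (smooth_on_pull _ _) Qx.
have cf : continuous (fun t => dot (dder Q (Phi t) x v) (dder Q (Phi t) x v)).
  move=> t; apply/differentiable_continuous/derivable1_diffP.
  exact: is_derive_derivable (is_derive_dderT t 1 Sf).
rewrite -[circle_integral _]/(itg 0 (2 * pi) _); apply: itg_gt0.
- exact: pi2_gt0.
- exact: continuous_subspaceT.
- by move=> t _; exact: dot_ge0.
- exact: cf.
- have -> : dder Q (Phi 0) x v = v.
    rewrite -[RHS](dder_linear (L := idfun) HQ v _ _ Qx)//.
      by apply: eq_dder => y; exact: action0.
    by move=> ?; exact: cvg_id.
  by rewrite lt0r dot_ge0 andbT; apply: contra_neq v0 => /dot_eq0.
Qed.

Lemma smooth_on_metric i j : smooth_on Q (metric i j).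
Proof.
apply: (@eq_smooth_on _ _ _ _ (fun x => (2 * pi)^-1 * itg 0 (2 * pi) (fun t => pull i j (x, t)))).
  by move=> x Qx; rewrite metricE.
apply: smooth_onM; first exact: smooth_on_cst.
by apply: (smooth_on_param HQ); [exact/ltW/pi2_gt0|exact: smooth_on_pull].
Qed.

Lemma dder_metric i j (x v : V3) : Q x ->
  dder Q (metric i j) x v =
  (2 * pi)^-1 * itg 0 (2 * pi) (fun t => dder C (pull i j) (x, t) (v, 0)).
Proof.
move=> Qx.
rewrite -(dder_param HQ (ltW pi2_gt0) (smooth_on_pull i j) v Qx).
rewrite -(dderZ HQ)//.
  by apply: eq_dder => y Qy; exact: metricE.
by apply: (smooth_on_param HQ); [exact/ltW/pi2_gt0|exact: smooth_on_pull].
Qed.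

End Metric.

Lemma I3E : ((0 + 1 = 1 :> 'I_3)%R * (0 + 2 = 2 :> 'I_3)%R * (1 + 1 = 2 :> 'I_3)%R *
  (1 + 2 = 0 :> 'I_3)%R * (2 + 1 = 0 :> 'I_3)%R * (2 + 2 = 1 :> 'I_3)%R)%type.
Proof. by do !split; apply/val_inj. Qed.

(** * Cofactors and determinants of matrices of order 3 *)

Section Cofactor.
Context {R : realType}.
Implicit Types G : 'I_3 -> 'I_3 -> R.

(** Indices modulo 3 absorb the alternating signs of the cofactors. *)
Definition cof3 G (i j : 'I_3) : R :=
  G (i + 1) (j + 1) * G (i + 2) (j + 2) - G (i + 1) (j + 2) * G (i + 2) (j + 1).

Definition det3 G : R := \sum_k G 0 k * cof3 G 0 k.

Lemma det3E G : \det (\matrix_(i < 3, j < 3) G i j) = det3 G.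
Proof.
(* Entries are reindexed by natural numbers, so that equal ordinals built differently by the
   expansion become identical for [ring]. *)
pose A (m n : nat) := G (inord m) (inord n).
have GE i j : G i j = A i j by rewrite /A !inord_val.
rewrite /det3 sum_I3 (expand_det_row _ 0) sum_I3 !mxE /cof3 !I3E.
rewrite /cofactor !(expand_det_row _ 0) !big_ord_recl !big_ord0 /cofactor !det_mx11 !mxE.
rewrite !GE /= /bump /= ?expr0 ?expr1 ?expr2; ring.
Qed.

Lemma mul_cof3 G i k : \sum_j G i j * cof3 G k j = det3 G * (i == k)%:R.
Proof.
rewrite /det3 !sum_I3 /cof3 !I3E.
by move: i k; do 2!(apply: forall_I3); rewrite !I3E /= ?mulr1 ?mulr0; ring.
Qed.

Definition low3 G (v : 'rV[R]_3) : 'rV[R]_3 := \row_i \sum_j G i j * v 0 j.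

Lemma low3_cof G v : low3 G (low3 (fun i j => cof3 G j i) v) = det3 G *: v.
Proof.
apply/rowP => i; rewrite !mxE.
transitivity (\sum_k det3 G * (i == k)%:R * v 0 k).
  under [RHS]eq_bigr do rewrite -mul_cof3 mulr_suml.
  rewrite exchange_big; apply: eq_bigr => j _; rewrite mxE mulr_sumr.
  by apply: eq_bigr => k _; rewrite mulrA.
rewrite (bigD1 i)//= eqxx mulr1 big1 ?addr0// => k ki.
by rewrite eq_sym (negbTE ki) mulr0 mul0r.
Qed.

Lemma cross_low3 G v w :
  cross (low3 G v) (low3 G w) = low3 (cof3 G) (cross v w).
Proof.
apply/rowP; apply: forall_I3; rewrite !mxE !sum_I3 ?mxE /cof3 !I3E; ring.
Qed.

(** Three test vectors: the last basis vector gives [G 2 2 > 0], the vector with coordinates [0],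
    [G 2 2], [- G 1 2] gives [cof3 G 0 0 > 0], and the adjugate applied to the first basis vector
    gives [det3 G * cof3 G 0 0 > 0]. *)
Lemma det3_gt0 G : (forall i j, G i j = G j i) ->
  (forall v : 'rV[R]_3, v != 0 -> 0 < dot (low3 G v) v) -> 0 < det3 G.
Proof.
move=> GC G0.
have neq0 (v : 'rV[R]_3) i : v 0 i != 0 -> v != 0.
  by apply: contra_neq => ->; rewrite mxE.
have G22 : 0 < G 2 2.
  have /G0 : delta_mx 0 2 != 0 :> 'rV[R]_3 by apply: (neq0 _ 2); rewrite mxE !eqxx oner_eq0.
  by rewrite /dot sum_I3 !mxE !sum_I3 ?mxE /= !mulr0 !add0r !mulr1.
have H00 : 0 < cof3 G 0 0.
  pose v : 'rV[R]_3 := \row_i (if i == 0 then 0 else if i == 1 then G 2 2 else - G 1 2).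
  have /G0 : v != 0 by apply: (neq0 _ 1); rewrite mxE /= gt_eqF.
  rewrite /dot sum_I3 !mxE !sum_I3 ?mxE /= (GC 2 1) => H.
  rewrite -(pmulr_rgt0 _ G22) (lt_le_trans H)// /cof3 !I3E (GC 2 1) le_eqVlt.
  by apply/orP; left; apply/eqP; ring.
pose v : 'rV[R]_3 := low3 (fun i j => cof3 G j i) (delta_mx 0 0).
have v0 : v 0 0 = cof3 G 0 0.
  by rewrite /v mxE sum_I3 !mxE /= mulr1 !mulr0 !addr0.
have /G0 : v != 0 by apply: (neq0 _ 0); rewrite v0 gt_eqF.
rewrite low3_cof; have -> (d : R) (w : 'rV[R]_3) : dot (d *: delta_mx 0 0) w = d * w 0 0.
  by rewrite /dot sum_I3 !mxE /= mulr1 !mulr0 !mul0r !addr0.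
by rewrite v0 pmulr_lgt0.
Qed.

End Cofactor.

Lemma smooth_on_dot (R : realType) (V : normedModType R) (X : set V) n (v w : V -> 'rV[R]_n) :
  smooth_on X v -> smooth_on X w -> smooth_on X (fun x => dot (v x) (w x)).
Proof.
by move=> Sv Sw; apply: smooth_on_sum => i; apply: smooth_onM; exact: smooth_on_coord.
Qed.

Lemma dotZl (R : realType) n (k : R) (v w : 'rV[R]_n) : dot (k *: v) w = k * dot v w.
Proof. by rewrite /dot mulr_sumr; apply: eq_bigr => i _; rewrite mxE mulrA. Qed.

Lemma cross_basis (R : realType) i :
  cross (@Defs.basis R (i + 1)) (Defs.basis R (i + 2)) = Defs.basis R i.
Proof.
apply/rowP => j; rewrite !mxE /=.
by move: i j; do 2!apply: forall_I3; rewrite /= ?mulr0 ?mulr1 ?mul0r ?subr0 ?subrr.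
Qed.

Lemma smooth_onZ (R : realType) (V : normedModType R) (X : set V) n (f : V -> R) (w : V -> 'rV[R]_n) :
  smooth_on X f -> smooth_on X w -> smooth_on X (fun x => f x *: w x).
Proof.
move=> Sf Sw; apply: smooth_on_rV => i.
apply: eq_smooth_on (smooth_onM Sf (smooth_on_coord i Sw)) => y _.
by rewrite mxE.
Qed.

Lemma smooth_on_cross (R : realType) (V : normedModType R) (X : set V) (v w : V -> 'rV[R]_3) :
  smooth_on X v -> smooth_on X w -> smooth_on X (fun x => cross (v x) (w x)).
Proof.
move=> Sv Sw; apply: smooth_on_rV => i.
apply: (@eq_smooth_on _ _ _ _ (fun x => v x 0 (i + 1) * w x 0 (i + 2) - v x 0 (i + 2) * w x 0 (i + 1))).
  by move=> y _; rewrite mxE.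
by apply: smooth_onB; apply: smooth_onM; exact: smooth_on_coord.
Qed.

(** Algebraic core of the formula for the exterior derivative of [c] on two fields [v1], [v2] with
    values [p], [q]: [d2] is the derivative of [v2] along [v1], [d1] that of [v1] along [v2], and
    [dc i l] the derivative of [c i] in direction [l]. The commutator cancels the derivatives of the
    vector fields. *)
Lemma curl_pairing (R : realType) (c p q d1 d2 : 'I_3 -> R) (dc : 'I_3 -> 'I_3 -> R) :
  \sum_i (c i * d2 i + q i * \sum_l p l * dc i l)
  - \sum_i (c i * d1 i + p i * \sum_l q l * dc i l) - \sum_i c i * (d2 i - d1 i) =
  \sum_i (dc (i + 2) (i + 1) - dc (i + 1) (i + 2)) *
    (p (i + 1) * q (i + 2) - p (i + 2) * q (i + 1)).
Proof. rewrite !sum_I3 !I3E; ring. Qed.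

Section DderVector.
Context {R : realType}.
Local Notation V3 := 'rV[R]_3.
Local Notation e := (@Defs.basis R).
Variable (Q : set V3).
Hypothesis (HQ : Q `<=` closure Q°).

Lemma dder_sum_basis (f : V3 -> R) (x v : V3) : smooth_on Q f -> Q x ->
  dder Q f x v = \sum_l v 0 l * dder Q f x (e l).
Proof. exact: dder_rV_sum. Qed.

Lemma gradE (f : V3 -> R) (x : V3) i : grad Q f x 0 i = dder Q f x (e i).
Proof. by rewrite mxE. Qed.

Lemma dot_grad (f : V3 -> R) (x v : V3) : smooth_on Q f -> Q x ->
  dot v (grad Q f x) = dder Q f x v.
Proof.
move=> Sf Qx; rewrite dder_sum_basis//; apply: eq_bigr => i _.
by rewrite gradE.
Qed.

Lemma smooth_on_grad (f : V3 -> R) : smooth_on Q f -> smooth_on Q (grad Q f).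
Proof.
move=> Sf; apply: smooth_on_rV => i.
apply: eq_smooth_on (smooth_on_dder HQ (e i) Sf) => y _.
by rewrite gradE.
Qed.

Lemma divergenceE (w : V3 -> V3) (x : V3) : smooth_on Q w -> Q x ->
  divergence Q w x = \sum_i dder Q (fun y => w y 0 i) x (e i).
Proof. by move=> Sw Qx; apply: eq_bigr => i _; rewrite -(dder_coord HQ). Qed.

Lemma curlE (w : V3 -> V3) (x : V3) i : smooth_on Q w -> Q x ->
  curl Q w x 0 i = dder Q (fun y => w y 0 (i + 2)) x (e (i + 1)) -
                   dder Q (fun y => w y 0 (i + 1)) x (e (i + 2)).
Proof. by move=> Sw Qx; rewrite mxE; congr (_ - _); exact: dder_coord. Qed.

Lemma smooth_on_curl (w : V3 -> V3) : smooth_on Q w -> smooth_on Q (curl Q w).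
Proof.
move=> Sw; apply: smooth_on_rV => i.
apply: (@eq_smooth_on _ _ _ _ (fun x => dder Q (fun y => w y 0 (i + 2)) x (e (i + 1)) -
                   dder Q (fun y => w y 0 (i + 1)) x (e (i + 2)))).
  by move=> y Qy; rewrite curlE.
by apply: smooth_onB; apply: (smooth_on_dder HQ); exact: smooth_on_coord.
Qed.

Lemma dder_scale_coord (f : V3 -> R) (w : V3 -> V3) (x v : V3) i : smooth_on Q f -> smooth_on Q w -> Q x ->
  dder Q (fun y => (f y *: w y) 0 i) x v =
  f x * dder Q (fun y => w y 0 i) x v + w x 0 i * dder Q f x v.
Proof.
move=> Sf Sw Qx; rewrite -(dderM HQ Sf (smooth_on_coord i Sw) v Qx).
by apply: eq_dder => y _; rewrite mxE.
Qed.

End DderVector.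

(** * Lowering and raising indices; explicit averaged operations *)

Section Average.
Context {R : realType}.
Local Notation V3 := 'rV[R]_3.
Local Notation e := (@Defs.basis R).
Variables (Q : set V3) (Phi : R -> V3 -> V3).
Hypotheses (HQ : Q `<=` closure Q°) (act : circle_action Q Phi).

Definition low (x v : V3) : V3 := low3 (fun i j => metric Q Phi i j x) v.
Definition avg_det (x : V3) : R := det3 (fun i j => metric Q Phi i j x).
(** The inverse of the metric matrix through its adjugate, so that smoothness is inherited from the
    entries. *)
Definition raise (x c : V3) : V3 :=
  (avg_det x)^-1 *: low3 (fun i j => cof3 (fun i j => metric Q Phi i j x) j i) c.

Lemma avg_metricC (x v w : V3) : avg_metric Q Phi x v w = avg_metric Q Phi x w v.
Proof.
have E : (fun t => dot (dder Q (Phi t) x v) (dder Q (Phi t) x w)) =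
         (fun t => dot (dder Q (Phi t) x w) (dder Q (Phi t) x v)).
  by apply/funext => t; exact: dotC.
exact: (congr1 (fun f => (2 * pi)^-1 * circle_integral f) E).
Qed.

Lemma avg_metric_low (x v w : V3) : Q x -> avg_metric Q Phi x v w = dot (low x v) w.
Proof.
move=> Qx; rewrite (avg_metricE HQ act)// /dot exchange_big; apply: eq_bigr => j _ /=.
rewrite mxE mulr_suml; apply: eq_bigr => i _.
by rewrite [metric _ _ j i _]avg_metricC mulrAC [v 0 i * _]mulrC.
Qed.

Lemma low_inj (x v w : V3) : Q x -> low x v = low x w -> v = w.
Proof.
move=> Qx vw; apply/eqP; rewrite -subr_eq0; apply/negP => /negP vw0.
have := avg_metric_gt0 HQ act Qx vw0; rewrite avg_metric_low//.
have -> : low x (v - w) = 0.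
  rewrite -(subrr (low x w)) -{1}vw; apply/rowP => i; rewrite !mxE -sumrB.
  by apply: eq_bigr => j _; rewrite !mxE mulrBr.
by rewrite /dot big1 ?ltxx// => i _; rewrite mxE mul0r.
Qed.

Lemma avg_det_gt0 (x : V3) : Q x -> 0 < avg_det x.
Proof.
move=> Qx; apply: det3_gt0 => [i j|v v0]; first exact: avg_metricC.
by rewrite -[low3 _ v]/(low x v) -avg_metric_low//; exact: avg_metric_gt0.
Qed.

Lemma avg_densityE (x : V3) : avg_density Q Phi x = Num.sqrt (avg_det x).
Proof. by rewrite /avg_density /avg_det -det3E. Qed.

Lemma avg_density_gt0 (x : V3) : Q x -> 0 < avg_density Q Phi x.
Proof. by move=> Qx; rewrite avg_densityE sqrtr_gt0 avg_det_gt0. Qed.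

Lemma avg_density_sqr (x : V3) : Q x -> avg_density Q Phi x ^+ 2 = avg_det x.
Proof. by move=> Qx; rewrite avg_densityE sqr_sqrtr// ltW// avg_det_gt0. Qed.

Lemma lowZ (x v : V3) (k : R) : low x (k *: v) = k *: low x v.
Proof.
apply/rowP => i; rewrite !mxE mulr_sumr; apply: eq_bigr => j _.
by rewrite mxE mulrCA.
Qed.

Lemma lowD (x v w : V3) : low x (v + w) = low x v + low x w.
Proof.
apply/rowP => i; rewrite !mxE -big_split; apply: eq_bigr => j _.
by rewrite mxE mulrDr.
Qed.

Lemma raiseK (x c : V3) : Q x -> low x (raise x c) = c.
Proof.
move=> Qx; rewrite /raise lowZ /low low3_cof scalerA mulVf ?scale1r//.
by rewrite gt_eqF// avg_det_gt0.
Qed.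

Lemma smooth_on_low3 (G : 'I_3 -> 'I_3 -> V3 -> R) (w : V3 -> V3) :
  (forall i j, smooth_on Q (G i j)) -> smooth_on Q w ->
  smooth_on Q (fun x => low3 (fun i j => G i j x) (w x)).
Proof.
move=> SG Sw; apply: smooth_on_rV => i.
apply: (@eq_smooth_on _ _ _ _ (fun x => \sum_j G i j x * w x 0 j)).
  by move=> y _; rewrite mxE.
by apply: smooth_on_sum => j; apply: smooth_onM => //; exact: smooth_on_coord.
Qed.

Lemma smooth_on_low (w : V3 -> V3) : smooth_on Q w -> smooth_on Q (fun x => low x (w x)).
Proof. by apply: smooth_on_low3 => i j; exact: smooth_on_metric. Qed.

Lemma smooth_on_cof3 i j :
  smooth_on Q (fun x => cof3 (fun i j => metric Q Phi i j x) i j).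
Proof. by apply: smooth_onB; apply: smooth_onM; exact: smooth_on_metric. Qed.

Lemma smooth_on_avg_det : smooth_on Q avg_det.
Proof.
apply: smooth_on_sum => k; apply: smooth_onM; first exact: smooth_on_metric.
exact: smooth_on_cof3.
Qed.

Lemma smooth_on_avg_density : smooth_on Q (avg_density Q Phi).
Proof.
apply: (eq_smooth_on _ (smooth_on_sqrt smooth_on_avg_det avg_det_gt0)) => x _.
by rewrite avg_densityE.
Qed.

Lemma smooth_on_raise (c : V3 -> V3) : smooth_on Q c -> smooth_on Q (fun x => raise x (c x)).
Proof.
move=> Sc; apply: smooth_onZ.
  by apply: (smooth_on_inv smooth_on_avg_det) => x Qx; rewrite gt_eqF// avg_det_gt0.
by apply: smooth_on_low3 => // i j; exact: smooth_on_cof3.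
Qed.

(** To be used once a property is shown equivalent, among smooth fields, to agreement on [Q] with an
    explicit smooth [w0]: the choice made by [the_field] is then immaterial on [Q]. *)
Lemma the_fieldE (P : (V3 -> V3) -> Prop) (w0 : V3 -> V3) : smooth_on Q w0 ->
  (forall w, smooth_on Q w -> P w <-> forall x, Q x -> w x = w0 x) ->
  smooth_on Q (the_field Q P) /\ forall x, Q x -> the_field Q P x = w0 x.
Proof.
move=> S0 Pw; have [] : [set w | smooth_on Q w /\ P w] (the_field Q P).
  by apply: getPex; exists w0; split=> //; exact/Pw.
by move=> Sw /(Pw _ Sw).
Qed.

Lemma dot_basis (v : V3) i : dot v (e i) = v 0 i.
Proof.
rewrite /dot (bigD1 i)//= mxE !eqxx mulr1 big1 ?addr0// => j ji.
by rewrite mxE (negbTE ji) andbF mulr0.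
Qed.

Lemma dot_inj (v w : V3) : (forall i, dot v (e i) = dot w (e i)) -> v = w.
Proof. by move=> vw; apply/rowP => i; rewrite -!dot_basis. Qed.

(** Nondegeneracy of the averaged metric: pairing with the constant basis fields already determines
    the field as the one dual to [c]. *)
Let smooth_dual (P : (V3 -> V3) -> Prop) (c : V3 -> V3) : smooth_on Q c ->
  (forall w, smooth_on Q w -> P w <-> forall v, smooth_on Q v ->
    forall x, Q x -> avg_dot Q Phi w v x = dot (c x) (v x)) ->
  smooth_on Q (the_field Q P) /\ forall x, Q x -> the_field Q P x = raise x (c x).
Proof.
move=> Sc Pw; apply: the_fieldE; first exact: smooth_on_raise.
move=> w Sw; rewrite Pw//; split=> [H x Qx|H v Sv x Qx].
  apply: (low_inj Qx); rewrite raiseK//; apply: dot_inj => i.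
  by rewrite -avg_metric_low// -(H (fun=> e i))//; exact: smooth_on_cst.
by rewrite /avg_dot avg_metric_low// H// raiseK.
Qed.

Lemma avg_gradE (f : V3 -> R) : smooth_on Q f ->
  smooth_on Q (avg_grad Q Phi f) /\
  forall x, Q x -> avg_grad Q Phi f x = raise x (grad Q f x).
Proof. by move=> Sf; apply: smooth_dual; first exact: smooth_on_grad. Qed.

Lemma avg_crossE (v w : V3 -> V3) : smooth_on Q v -> smooth_on Q w ->
  smooth_on Q (avg_cross Q Phi v w) /\
  forall x, Q x -> avg_cross Q Phi v w x =
    raise x (avg_density Q Phi x *: cross (v x) (w x)).
Proof.
move=> Sv Sw; apply: smooth_dual.
  by apply: smooth_onZ; [exact: smooth_on_avg_density|exact: smooth_on_cross].
by move=> w' Sw'; split=> H v' Sv' x Qx; rewrite H// dotZl.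
Qed.

(** The expression defining the averaged curl is the exterior derivative of the covector field dual
    to [w]; the metric enters only through [low]. *)
Let avg_curl_identity (w v1 v2 : V3 -> V3) (x : V3) :
  smooth_on Q w -> smooth_on Q v1 -> smooth_on Q v2 -> Q x ->
  avg_dot Q Phi v1 (avg_grad Q Phi (avg_dot Q Phi w v2)) x
  - avg_dot Q Phi v2 (avg_grad Q Phi (avg_dot Q Phi w v1)) x
  - avg_dot Q Phi w (commutator Q v1 v2) x =
  dot (curl Q (fun y => low y (w y)) x) (cross (v1 x) (v2 x)).
Proof.
move=> Sw S1 S2 Qx; pose c y := low y (w y).
have Sc : smooth_on Q c by exact: smooth_on_low.
have Sdot (v : V3 -> V3) : smooth_on Q v -> smooth_on Q (avg_dot Q Phi w v).
  move=> Sv; apply: (eq_smooth_on _ (smooth_on_dot Sc Sv)) => y Qy.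
  by rewrite /avg_dot avg_metric_low.
have grad_dot (v v' : V3 -> V3) : smooth_on Q v -> smooth_on Q v' ->
    avg_dot Q Phi v' (avg_grad Q Phi (avg_dot Q Phi w v)) x =
    \sum_i (c x 0 i * dder Q (fun y => v y 0 i) x (v' x) +
            v x 0 i * \sum_l v' x 0 l * dder Q (fun y => c y 0 i) x (e l)).
  move=> Sv Sv'; rewrite /avg_dot (avg_gradE (Sdot v Sv)).2// avg_metricC.
  rewrite avg_metric_low// raiseK// dotC (dot_grad HQ); [|exact: Sdot|by []].
  have Sci i : smooth_on Q (fun y => c y 0 i) by exact: smooth_on_coord.
  have Svi i : smooth_on Q (fun y => v y 0 i) by exact: smooth_on_coord.
  have -> : dder Q (avg_dot Q Phi w v) x (v' x) =
      dder Q (fun y => \sum_i c y 0 i * v y 0 i) x (v' x).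
    by apply: eq_dder => y Qy; rewrite /avg_dot avg_metric_low.
  rewrite (dder_sum HQ)//; last by move=> i; exact: smooth_onM.
  apply: eq_bigr => i _; rewrite (dderM HQ)//; congr (_ + _ * _).
  exact: dder_sum_basis.
rewrite !grad_dot// [avg_dot Q Phi w _ x]avg_metric_low// -/(c x).
have -> : dot (c x) (commutator Q v1 v2 x) = \sum_i c x 0 i *
    (dder Q (fun y => v2 y 0 i) x (v1 x) - dder Q (fun y => v1 y 0 i) x (v2 x)).
  apply: eq_bigr => i _; congr (_ * _); rewrite !mxE.
  by congr (_ - _); exact: dder_coord.
rewrite (curl_pairing _ _ _ _ _ (fun i l => dder Q (fun y => c y 0 i) x (e l))).
apply: eq_bigr => i _; congr (_ * _); last by rewrite mxE.
by rewrite (curlE HQ).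
Qed.

Lemma avg_curlE (w : V3 -> V3) : smooth_on Q w ->
  smooth_on Q (avg_curl Q Phi w) /\
  forall x, Q x -> avg_curl Q Phi w x =
    (avg_density Q Phi x)^-1 *: curl Q (fun y => low y (w y)) x.
Proof.
move=> Sw; have rho0 x (Qx : Q x) : avg_density Q Phi x != 0.
  by rewrite gt_eqF// avg_density_gt0.
apply: the_fieldE.
  apply: smooth_onZ; first exact: (smooth_on_inv smooth_on_avg_density).
  by apply: (smooth_on_curl HQ); exact: smooth_on_low.
move=> c Sc; split=> H.
  move=> x Qx; apply: (scalerI (rho0 x Qx)); rewrite scalerA divff ?rho0// scale1r.
  (* The constant fields [e (i + 1)] and [e (i + 2)], whose cross product is [e i], isolate the
     [i]-th component. *)
  apply: dot_inj => i; rewrite -cross_basis -(avg_curl_identity Sw)//; [|exact: smooth_on_cst..].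
  rewrite -H//; [|exact: smooth_on_cst..].
  rewrite /avg_dot (avg_crossE (smooth_on_cst _) (smooth_on_cst _)).2// avg_metricC.
  by rewrite avg_metric_low// raiseK// !dotZl dotC.
move=> v1 v2 S1 S2 x Qx; rewrite avg_curl_identity//.
rewrite /avg_dot (avg_crossE S1 S2).2// avg_metricC avg_metric_low// raiseK//.
by rewrite dotZl H// dotC dotZl mulrA divff ?rho0// mul1r.
Qed.

End Average.

Lemma exchange_pairing (R : comRingType) (a b p q : 'I_3 -> R) (J : 'I_3 -> 'I_3 -> R) :
  \sum_l (p l * (\sum_k J l k * b k) + q l * (\sum_k a k * J l k)) =
  \sum_k (a k * (\sum_l q l * J l k) + b k * (\sum_l p l * J l k)).
Proof. rewrite !sum_I3; ring. Qed.

Lemma sum_pairD (R : comRingType) (I : finType) (a b A B A' B' P Q : I -> R) :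
  (forall k, A' k = A k + P k) -> (forall k, B' k = B k + Q k) ->
  \sum_k (a k * B' k + b k * A' k) =
  \sum_k (a k * B k + b k * A k) + \sum_k (a k * Q k + b k * P k).
Proof.
move=> EA EB; rewrite -big_split; apply: eq_bigr => k _ /=.
rewrite EA EB; ring.
Qed.

(** * The Killing equation for the averaged metric *)

Section Killing.
Context {R : realType}.
Local Notation V3 := 'rV[R]_3.
Local Notation e := (@Defs.basis R).
Variables (Q : set V3) (Phi : R -> V3 -> V3).
Hypotheses (HQ : Q `<=` closure Q°) (act : circle_action Q Phi).
Local Notation C := (cylinder Q).
Local Notation u := (generator Phi).
Local Notation phi := (orbit_coord Phi).
Local Notation jac := (jac Q Phi).
Local Notation pull := (pull Q Phi).
Local Notation metric := (metric Q Phi).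
Local Notation du i l x := (dder Q (fun y : V3 => u y 0 l) x (e i)).
Let HC : C `<=` closure C° := @cylinder_closure_interior R _ Q HQ.

Lemma dder_phi_time_sum k (z : V3 * R) : C z ->
  dder C (phi k) z (0, 1) = \sum_l u z.1 0 l * jac l k z.
Proof.
by case: z => x t [/= Qx _]; rewrite (dder_phi_time HQ act)// -(dder_action HQ act)// (dder_orbit_push HQ act).
Qed.

Lemma dder_slice_sum (H : V3 * R -> R) (x v : V3) (t : R) : smooth_on C H -> Q x ->
  dder C H (x, t) (v, 0) = \sum_l v 0 l * dder C H (x, t) (e l, 0).
Proof.
move=> SH Qx; rewrite -(dder_slice HQ t v SH Qx) (dder_sum_basis HQ)//; last exact: smooth_on_slice.
by apply: eq_bigr => l _; rewrite (dder_slice HQ).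
Qed.

Lemma dder_jac_sym i l k (z : V3 * R) : C z ->
  dder C (jac l k) z (e i, 0) = dder C (jac i k) z (e l, 0).
Proof. exact: (dder_Schwarz HC (e i, 0) (e l, 0) (smooth_on_phi act k)). Qed.

(** The time derivative of the flow is its space derivative along [u x]; this identity is
    differentiated in direction [i], with the order of differentiation exchanged on both sides. *)
Lemma dder_jac_time i k (x : V3) (t : R) : Q x ->
  dder C (jac i k) (x, t) (0, 1) =
  dder C (jac i k) (x, t) (u x, 0) + \sum_l du i l x * jac l k (x, t).
Proof.
move=> Qx; have Cx : C (x, t) by [].
have Sphi := smooth_on_phi act k; have Sjac l := smooth_on_jac HQ act l k.
have Su l := smooth_on_gen HQ act l.
etransitivity; first exact: (dder_Schwarz HC (0, 1) (e i, 0) Sphi Cx).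
etransitivity; first exact: (eq_dder _ _ (dder_phi_time_sum k)).
have Sb l : smooth_on C (fun z => u z.1 0 l).
  exact: (smooth_on_base (f := fun y => u y 0 l) (Su l)).
rewrite (dder_sum HC)//; last by move=> l; exact: smooth_onM.
rewrite (dder_slice_sum (u x) t (Sjac i) Qx) -big_split; apply: eq_bigr => l _.
rewrite (dderM HC (Sb l) (Sjac l) (e i, 0) Cx).
rewrite (dder_base HQ t (e i) 0 (Su l) Qx).
exact: (congr2 +%R (congr1 ( *%R (u x 0 l)) (dder_jac_sym i l k Cx)) (mulrC _ _)).
Qed.

(** Product rule applied to [dder_jac_time]; the right-hand side is the Lie derivative along [u] of
    the pulled-back metric, in coordinates. *)
Lemma dder_pull_time i j (x : V3) (t : R) : Q x ->
  dder C (pull i j) (x, t) (0, 1) =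
  dder C (pull i j) (x, t) (u x, 0) +
  \sum_l (du i l x * pull l j (x, t) + du j l x * pull i l (x, t)).
Proof.
move=> Qx; have Cx : C (x, t) by [].
have Sjac := smooth_on_jac HQ act.
have dE v : dder C (pull i j) (x, t) v =
    \sum_k (jac i k (x, t) * dder C (jac j k) (x, t) v +
            jac j k (x, t) * dder C (jac i k) (x, t) v).
  rewrite (dder_sum HC)//; last by move=> k; exact: smooth_onM.
  by apply: eq_bigr => k _; rewrite (dderM HC).
have -> : \sum_l (du i l x * pull l j (x, t) + du j l x * pull i l (x, t)) =
    \sum_k (jac i k (x, t) * (\sum_l du j l x * jac l k (x, t)) +
            jac j k (x, t) * (\sum_l du i l x * jac l k (x, t))).
  exact: (@exchange_pairing R (fun k => jac i k (x, t)) (fun k => jac j k (x, t))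
    (fun l => du i l x) (fun l => du j l x) (fun l k => jac l k (x, t))).
rewrite (dE (0, 1)) (dE (u x, 0)); apply: sum_pairD => k.
  exact: (dder_jac_time i k t Qx).
exact: (dder_jac_time j k t Qx).
Qed.

Lemma pull_periodic i j (x : V3) : Q x -> pull i j (x, 2 * pi) = pull i j (x, 0).
Proof.
move=> Qx; have [_ per _ _ _] := act.
have E l k : jac l k (x, 2 * pi) = jac l k (x, 0).
  rewrite !(jacE HQ act)//; congr (fun_of_matrix _ _ _); apply: eq_dder => y Qy.
  by rewrite -(per 0 y Qy) add0r.
by apply: eq_bigr => k _; rewrite !E.
Qed.

(* The average over the circle kills the time derivative of the pulled-back metric. *)
Lemma Killing i j (x : V3) : Q x ->
  dder Q (metric i j) x (u x) =
  - \sum_l (du i l x * metric l j x + du j l x * metric i l x).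
Proof.
move=> Qx; rewrite (dder_metric HQ act)//.
have Sp := smooth_on_pull HQ act.
have cp k l : {within `[0, 2 * pi], continuous (fun t => pull k l (x, t))}.
  exact: fiber_continuous (Sp k l) Qx.
have cd v : {within `[0, 2 * pi], continuous (fun t => dder C (pull i j) (x, t) v)}.
  exact: fiber_continuous (smooth_on_dder HC v (Sp i j)) Qx.
have czp r k l : {within `[0, 2 * pi], continuous (fun t => r * pull k l (x, t))}.
  exact: within_continuousZ.
pose M k l := itg 0 (2 * pi) (fun t => pull k l (x, t)).
have mE k l : metric k l x = (2 * pi)^-1 * M k l := metricE HQ act k l Qx.
have E0 : itg 0 (2 * pi) (fun t => dder C (pull i j) (x, t) (0, 1)) = 0.
  have := itg_FTC (@pi2_gt0 R) (cd (0, 1)) (fun t => is_derive_fiber HQ t (Sp i j) Qx).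
  by move=> ->; rewrite pull_periodic// subrr.
have E1 : itg 0 (2 * pi) (fun t => dder C (pull i j) (x, t) (0, 1)) =
    itg 0 (2 * pi) (fun t => dder C (pull i j) (x, t) (u x, 0)) +
    \sum_l (du i l x * M l j + du j l x * M i l).
  etransitivity; first exact: (eq_itg (fun t _ => dder_pull_time i j t Qx)).
  have cs l : {within `[0, 2 * pi], continuous (fun t => du i l x * pull l j (x, t) + du j l x * pull i l (x, t))}.
    by move=> t; apply: cvgD; exact: czp.
  etransitivity; first exact: (itgD (g := fun t => \sum_l (du i l x * pull l j (x, t) +
    du j l x * pull i l (x, t))) (cd (u x, 0)) (within_continuous_sum cs)).
  congr (_ + _); etransitivity; first exact: (itg_sum _ cs).
  apply: eq_bigr => l _; etransitivity; first exact: (itgD (czp _ _ _) (czp _ _ _)).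
  exact: (congr2 +%R (itgZ _ (cp l j)) (itgZ _ (cp i l))).
have := etrans (esym E1) E0; move: (itg _ _ _) => I1 /eqP.
rewrite addr_eq0 => /eqP ->; rewrite mulrN mulr_sumr; congr (- _).
apply: eq_bigr => l _; rewrite (mE l j) (mE i l).
move: (dder _ _ _ _) (dder _ _ _ _) (M l j) (M i l) => *; ring.
Qed.

End Killing.

(** * Invariant fields *)

Section Derivations.
Context {R : comRingType}.
Implicit Types (G d : 'I_3 -> 'I_3 -> R) (c w dw : 'I_3 -> R).

(** In this group of identities [d i l] stands for the derivative in direction [i] of the component
    [l] of [u]. Here the Killing equation makes lowering an index commute with the Lie derivative
    along [u]. *)
Lemma low_derivation G d w dw i :
  \sum_j (G i j * dw j + w j * - \sum_l (d i l * G l j + d j l * G i l)) =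
  \sum_j G i j * (dw j - \sum_l w l * d l j) - \sum_l d i l * \sum_j G l j * w j.
Proof. rewrite !sum_I3; ring. Qed.

Lemma dot_derivation d c w :
  \sum_i (c i * (\sum_l w l * d l i) + w i * - \sum_l d i l * c l) = 0.
Proof. rewrite !sum_I3; ring. Qed.

(** The cross product of two covectors is a vector density; a zero trace of [d], that is zero
    divergence of [u], lets it behave as a vector. *)
Lemma cross_derivation d (a b : 'rV[R]_3) i : \sum_i d i i = 0 ->
  a 0 (i + 1) * (- \sum_l d (i + 2) l * b 0 l) + b 0 (i + 2) * (- \sum_l d (i + 1) l * a 0 l)
  - (a 0 (i + 2) * (- \sum_l d (i + 1) l * b 0 l) + b 0 (i + 1) * (- \sum_l d (i + 2) l * a 0 l)) =
  \sum_l (\row_i (a 0 (i + 1) * b 0 (i + 2) - a 0 (i + 2) * b 0 (i + 1))) 0 l * d l i.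
Proof.
rewrite !sum_I3 !mxE !I3E => /eqP; rewrite addrC addr_eq0 => /eqP d22.
by move: i; apply: forall_I3; rewrite !I3E ?d22; ring.
Qed.

(** The left-hand side is the product rule for the determinant; by the Killing equation it equals
    [- 2] times the trace of [d] times the determinant. *)
Lemma det_derivation G dG d : (forall i j, G i j = G j i) -> \sum_i d i i = 0 ->
  (forall i j, dG i j = - \sum_l (d i l * G l j + d j l * G i l)) ->
  \sum_k (G 0 k * (G 1 (k + 1) * dG 2 (k + 2) + G 2 (k + 2) * dG 1 (k + 1)
    - (G 1 (k + 2) * dG 2 (k + 1) + G 2 (k + 1) * dG 1 (k + 2)))
    + (G 1 (k + 1) * G 2 (k + 2) - G 1 (k + 2) * G 2 (k + 1)) * dG 0 k) = 0.
Proof.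
move=> GC; rewrite !sum_I3 => /eqP; rewrite addrC addr_eq0 => /eqP d22 dGE.
rewrite !dGE !sum_I3 !I3E d22 (GC 1 0) (GC 2 0) (GC 2 1); ring.
Qed.

End Derivations.

Section Invariance.
Context {R : realType}.
Local Notation V3 := 'rV[R]_3.
Local Notation e := (@Defs.basis R).
Variables (Q : set V3) (Phi : R -> V3 -> V3).
Hypotheses (HQ : Q `<=` closure Q°) (act : circle_action Q Phi).
Hypothesis vp : volume_preserving Q Phi.
Local Notation u := (generator Phi).
Local Notation du i l x := (dder Q (fun y : V3 => u y 0 l) x (e i)).

(* Vanishing Lie derivative along the generator, in coordinates. *)
Definition inv_scalar (f : V3 -> R) :=
  smooth_on Q f /\ forall x, Q x -> dder Q f x (u x) = 0.
Definition inv_covector (c : V3 -> V3) :=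
  smooth_on Q c /\ forall (i : 'I_3) x, Q x ->
    dder Q (fun y => c y 0 i) x (u x) = - \sum_l du i l x * c x 0 l.
Definition inv_vector (w : V3 -> V3) :=
  smooth_on Q w /\ forall (i : 'I_3) x, Q x ->
    dder Q (fun y => w y 0 i) x (u x) = \sum_l w x 0 l * du l i x.

Lemma div_u (x : V3) : Q x -> \sum_i du i i x = 0.
Proof. exact: divergence_generator. Qed.

Lemma inv_scalar_orbit (f : V3 -> R) : smooth_on Q f ->
  (forall t x, Q x -> f (Phi t x) = f x) -> inv_scalar f.
Proof.
move=> Sf fP; split=> // x Qx.
have SP : smooth_on [set: R] (fun s => Phi s x).
  exact: (smooth_on_fiber (H := orbit_map Phi) (action_smooth act) Qx).
have := @dder_comp_rV R R 3 setT Q f (fun s => Phi s x) (@setT_closure_interior R R) HQ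
  Sf SP (fun s _ => action_in act s Qx) (0 : R) (1 : R) I.
have -> : dder setT (fun s => Phi s x) (0 : R) (1 : R) = u x.
  rewrite (generatorE HQ act Qx); have [_ <-] := is_derive_orbit HQ act 0 Qx.
  by have [_ ->] := is_derive_dderT (0 : R) (1 : R) SP.
rewrite (action0 act Qx) => <-.
rewrite -[RHS](dder_cst (@setT_closure_interior R R) (f x) (1 : R) (I : setT (0 : R))).
by apply: eq_dder => s _ /=; exact: fP.
Qed.

Lemma dder_gen_sum (f : V3 -> R) (x : V3) : smooth_on Q f -> Q x ->
  dder Q f x (u x) = \sum_l u x 0 l * dder Q f x (e l).
Proof. by move=> Sf Qx; exact: dder_sum_basis. Qed.

Lemma inv_generator : inv_vector u.
Proof.
split=> [|i x Qx]; first exact: smooth_on_generator.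
by apply: dder_gen_sum => //; exact: smooth_on_gen.
Qed.

Lemma inv_scalarM (f g : V3 -> R) : inv_scalar f -> inv_scalar g ->
  inv_scalar (fun x => f x * g x).
Proof.
move=> [Sf If] [Sg Ig]; split=> [|x Qx]; first exact: smooth_onM.
by rewrite (dderM HQ Sf Sg (u x) Qx) If// Ig// !mulr0 addr0.
Qed.

Lemma inv_scalarV (f : V3 -> R) : inv_scalar f -> (forall x, Q x -> f x != 0) ->
  inv_scalar (fun x => (f x)^-1).
Proof.
move=> [Sf If] f0; split=> [|x Qx]; first exact: smooth_on_inv.
by rewrite (dder_inv HQ (u x) Sf f0 Qx) If// oppr0 mul0r.
Qed.

Lemma inv_scalar_comp (h : R -> R) (f : V3 -> R) : Cinfty setT h -> inv_scalar f ->
  inv_scalar (fun x => h (f x)).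
Proof.
move=> Ch [Sf If]; split=> [|x Qx].
  by apply: (smooth_on_comp (O := setT) _ Ch) => //; exact: openT.
by rewrite (dder_comp HQ (O := setT) openT Ch Sf)// If// mulr0.
Qed.

Lemma inv_vectorZ (f : V3 -> R) (w : V3 -> V3) : inv_scalar f -> inv_vector w ->
  inv_vector (fun x => f x *: w x).
Proof.
move=> [Sf If] [Sw Iw]; split=> [|i x Qx]; first exact: smooth_onZ.
rewrite (dder_scale_coord HQ (u x) i Sf Sw Qx) If// Iw// mulr0 addr0 mulr_sumr.
by apply: eq_bigr => l _; rewrite mxE mulrA.
Qed.

Lemma inv_covectorZ (f : V3 -> R) (w : V3 -> V3) : inv_scalar f -> inv_covector w ->
  inv_covector (fun x => f x *: w x).
Proof.
move=> [Sf If] [Sw Iw]; split=> [|i x Qx]; first exact: smooth_onZ.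
rewrite (dder_scale_coord HQ (u x) i Sf Sw Qx) If// Iw// mulr0 addr0 mulrN mulr_sumr.
by congr (- _); apply: eq_bigr => l _; rewrite mxE mulrCA.
Qed.

Lemma inv_vectorD (w w' : V3 -> V3) : inv_vector w -> inv_vector w' ->
  inv_vector (fun x => w x + w' x).
Proof.
move=> [Sw Iw] [Sw' Iw']; split=> [|i x Qx]; first exact: smooth_onD.
transitivity (dder Q (fun y => w y 0 i + w' y 0 i) x (u x)).
  by apply: eq_dder => y _; rewrite mxE.
rewrite (dderD HQ (smooth_on_coord i Sw) (smooth_on_coord i Sw') (u x) Qx).
rewrite Iw// Iw'// -big_split; apply: eq_bigr => l _.
by rewrite mxE mulrDl.
Qed.

(** Differentiation of [u . grad f = 0] in direction [i], with the second derivatives of [f]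
    exchanged. *)
Lemma inv_grad (f : V3 -> R) : inv_scalar f -> inv_covector (grad Q f).
Proof.
move=> [Sf If]; split=> [|i x Qx]; first exact: smooth_on_grad.
transitivity (dder Q (dder Q f ^~ (e i)) x (u x)).
  by apply: eq_dder => y _; rewrite gradE.
have Sd l : smooth_on Q (dder Q f ^~ (e l)) by exact: smooth_on_dder.
have Su l := smooth_on_gen HQ act l.
have Sud l : smooth_on Q (fun y => u y 0 l * dder Q f y (e l)) by exact: smooth_onM.
have H : dder Q (fun y => \sum_l u y 0 l * dder Q f y (e l)) x (e i) = 0.
  rewrite -[RHS](dder_cst HQ (0 : R) (e i) Qx); apply: eq_dder => y Qy.
  by rewrite -dder_gen_sum// If.
rewrite (dder_gen_sum (Sd i) Qx); apply/eqP; rewrite -addr_eq0 -big_split.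
apply/eqP; apply: etrans H; rewrite (dder_sum HQ)//; apply: eq_bigr => l _ /=.
rewrite (dderM HQ (Su l) (Sd l) (e i) Qx) gradE.
exact: (congr2 +%R (congr1 ( *%R (u x 0 l)) (dder_Schwarz HQ (e l) (e i) Sf Qx)) (mulrC _ _)).
Qed.

Let dder_low (w : V3 -> V3) (x v : V3) i : smooth_on Q w -> Q x ->
  dder Q (fun y => low Q Phi y (w y) 0 i) x v =
  \sum_j (metric Q Phi i j x * dder Q (fun y => w y 0 j) x v +
          w x 0 j * dder Q (metric Q Phi i j) x v).
Proof.
move=> Sw Qx; have Sm j := smooth_on_metric HQ act i j.
have Sc j := smooth_on_coord j Sw.
transitivity (dder Q (fun y => \sum_j metric Q Phi i j y * w y 0 j) x v).
  by apply: eq_dder => y _; rewrite mxE.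
rewrite (dder_sum HQ)//; last by move=> j; exact: smooth_onM.
by apply: eq_bigr => j _; exact: (dderM HQ (Sm j) (Sc j) v Qx).
Qed.

Let dder_low_gen (w : V3 -> V3) (x : V3) i : smooth_on Q w -> Q x ->
  dder Q (fun y => low Q Phi y (w y) 0 i) x (u x) =
  low Q Phi x (\row_j (dder Q (fun y => w y 0 j) x (u x) - \sum_l w x 0 l * du l j x)) 0 i
  - \sum_l du i l x * low Q Phi x (w x) 0 l.
Proof.
move=> Sw Qx; rewrite (dder_low (u x) i Sw Qx).
transitivity (\sum_j (metric Q Phi i j x * dder Q (fun y => w y 0 j) x (u x) + w x 0 j *
    - \sum_l (du i l x * metric Q Phi l j x + du j l x * metric Q Phi i l x))).
  apply: eq_bigr => j _; congr (_ + _ * _); exact: (Killing HQ act i j Qx).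
etransitivity; first exact: (low_derivation (fun i j => metric Q Phi i j x) (fun i l => du i l x)).
congr (_ - _); last by apply: eq_bigr => l _; rewrite mxE.
by rewrite mxE; apply: eq_bigr => j _; rewrite mxE.
Qed.

Lemma inv_low (w : V3 -> V3) : inv_vector w -> inv_covector (fun x => low Q Phi x (w x)).
Proof.
move=> [Sw Iw]; split=> [|i x Qx]; first exact: smooth_on_low.
rewrite (dder_low_gen i Sw Qx) mxE big1 ?sub0r// => j _.
by rewrite mxE Iw// subrr mulr0.
Qed.

(** The derivative of the inverse matrix is avoided: [low] sends the Lie derivative of the raised
    field to that of [c], which vanishes, and [low] is injective. *)
Lemma inv_raise (c : V3 -> V3) : inv_covector c -> inv_vector (fun x => raise Q Phi x (c x)).
Proof.
move=> [Sc Ic]; have Sw := smooth_on_raise HQ act Sc; split=> // i x Qx.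
pose w x := raise Q Phi x (c x); rewrite -/(w x).
have E : low Q Phi x (\row_j (dder Q (fun y => w y 0 j) x (u x) - \sum_l w x 0 l * du l j x)) =
    low Q Phi x 0.
  apply/rowP => k; rewrite [RHS]mxE big1; last by move=> j _; rewrite mxE mulr0.
  apply: (addIr (- \sum_l du k l x * c x 0 l)); rewrite add0r.
  apply: (etrans _ (Ic k x Qx)).
  transitivity (dder Q (fun y => low Q Phi y (w y) 0 k) x (u x)); last first.
    by apply: eq_dder => y Qy; rewrite (raiseK HQ act _ Qy).
  rewrite (dder_low_gen k Sw Qx); congr (_ + - _); apply: eq_bigr => l _.
  by rewrite (raiseK HQ act _ Qx).
have := congr1 (fun v : V3 => v 0 i) (low_inj HQ act Qx E); rewrite !mxE => /eqP.
by rewrite subr_eq0 => /eqP.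
Qed.

Lemma inv_det : inv_scalar (avg_det Q Phi).
Proof.
split=> [|x Qx]; first exact: smooth_on_avg_det.
have Sm i j := smooth_on_metric HQ act i j.
have Sc i j := smooth_on_cof3 HQ act i j.
have GC i j : metric Q Phi i j x = metric Q Phi j i x := avg_metricC Q Phi _ _ _.
apply: (etrans _ (det_derivation GC (div_u Qx) (fun i j => Killing HQ act i j Qx))).
rewrite (dder_sum HQ)//; last by move=> k; exact: smooth_onM.
apply: eq_bigr => k _; etransitivity; first exact: (dderM HQ (Sm _ _) (Sc _ _) (u x) Qx).
rewrite /cof3 !I3E; congr (_ * _ + _); etransitivity.
  exact: (dderB HQ (u x) (smooth_onM (Sm _ _) (Sm _ _)) (smooth_onM (Sm _ _) (Sm _ _)) Qx).
congr (_ - _); exact: (dderM HQ (Sm _ _) (Sm _ _) (u x) Qx).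
Qed.

Lemma inv_dot (c w : V3 -> V3) : inv_covector c -> inv_vector w ->
  inv_scalar (fun x => dot (c x) (w x)).
Proof.
move=> [Sc Ic] [Sw Iw]; split=> [|x Qx]; first exact: smooth_on_dot.
have Sci i := smooth_on_coord i Sc; have Swi i := smooth_on_coord i Sw.
rewrite (dder_sum HQ)//; last by move=> i; exact: smooth_onM.
under eq_bigr do rewrite (dderM HQ (Sci _) (Swi _) (u x) Qx) Ic// Iw//.
exact: dot_derivation.
Qed.

Lemma inv_cross (a b : V3 -> V3) : inv_covector a -> inv_covector b ->
  inv_vector (fun x => cross (a x) (b x)).
Proof.
move=> [Sa Ia] [Sb Ib]; split=> [|i x Qx]; first exact: smooth_on_cross.
have Sai i := smooth_on_coord i Sa; have Sbi i := smooth_on_coord i Sb.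
transitivity (dder Q (fun y => a y 0 (i + 1) * b y 0 (i + 2) - a y 0 (i + 2) * b y 0 (i + 1)) x (u x)).
  by apply: eq_dder => y _; rewrite mxE.
rewrite (dderB HQ (u x) (smooth_onM (Sai _) (Sbi _)) (smooth_onM (Sai _) (Sbi _)) Qx).
rewrite (dderM HQ (Sai _) (Sbi _) (u x) Qx) (dderM HQ (Sai _) (Sbi _) (u x) Qx).
rewrite !Ia// !Ib//.
exact: (cross_derivation (d := fun i l => du i l x) (a x) (b x) i (div_u Qx)).
Qed.

End Invariance.

(** * Euclidean vector identities on the domain *)

Section VectorCalculus.
Context {R : realType}.
Local Notation V3 := 'rV[R]_3.
Local Notation e := (@Defs.basis R).
Variable (Q : set V3).
Hypothesis (HQ : Q `<=` closure Q°).
Implicit Types (f : V3 -> R) (a b w : V3 -> V3).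

Lemma row_addE (v w : V3) i : (v + w) 0 i = v 0 i + w 0 i.
Proof. by rewrite mxE. Qed.

Lemma row_scaleE (k : R) (w : V3) i : (k *: w) 0 i = k * w 0 i.
Proof. by rewrite mxE. Qed.

Lemma cross_coord (v w : V3) i :
  cross v w 0 i = v 0 (i + 1) * w 0 (i + 2) - v 0 (i + 2) * w 0 (i + 1).
Proof. by rewrite mxE. Qed.

Lemma dder_cross_coord a b (x v : V3) i : smooth_on Q a -> smooth_on Q b -> Q x ->
  dder Q (fun y => cross (a y) (b y) 0 i) x v =
  a x 0 (i + 1) * dder Q (fun y => b y 0 (i + 2)) x v +
  b x 0 (i + 2) * dder Q (fun y => a y 0 (i + 1)) x v -
  (a x 0 (i + 2) * dder Q (fun y => b y 0 (i + 1)) x v +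
   b x 0 (i + 1) * dder Q (fun y => a y 0 (i + 2)) x v).
Proof.
move=> Sa Sb Qx; have Sai i := smooth_on_coord i Sa; have Sbi i := smooth_on_coord i Sb.
transitivity (dder Q (fun y => a y 0 (i + 1) * b y 0 (i + 2) - a y 0 (i + 2) * b y 0 (i + 1)) x v).
  by apply: eq_dder => y _; rewrite mxE.
rewrite (dderB HQ v (smooth_onM (Sai _) (Sbi _)) (smooth_onM (Sai _) (Sbi _)) Qx).
by rewrite (dderM HQ (Sai _) (Sbi _) v Qx) (dderM HQ (Sai _) (Sbi _) v Qx).
Qed.

Lemma eq_divergence a b (x : V3) : (forall y, Q y -> a y = b y) ->
  divergence Q a x = divergence Q b x.
Proof.
by move=> ab; apply: eq_bigr => i _; congr (fun_of_matrix _ _ _); exact: eq_dder.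
Qed.

Lemma curl_coord w (x : V3) i :
  curl Q w x 0 i = partial Q (i + 1) w x 0 (i + 2) - partial Q (i + 2) w x 0 (i + 1).
Proof. by rewrite mxE. Qed.

Lemma eq_curl a b (x : V3) : (forall y, Q y -> a y = b y) -> curl Q a x = curl Q b x.
Proof.
move=> ab; have E j : partial Q j a x = partial Q j b x by exact: eq_dder.
by apply/rowP => i; rewrite !mxE !E.
Qed.

Lemma divergenceZ f w (x : V3) : smooth_on Q f -> smooth_on Q w -> Q x ->
  divergence Q (fun y => f y *: w y) x = f x * divergence Q w x + dot (w x) (grad Q f x).
Proof.
move=> Sf Sw Qx; rewrite (divergenceE HQ (smooth_onZ Sf Sw) Qx) (divergenceE HQ Sw Qx).
rewrite mulr_sumr -big_split; apply: eq_bigr => i _ /=.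
by rewrite (dder_scale_coord HQ)// gradE.
Qed.

Lemma divergenceD a b (x : V3) : smooth_on Q a -> smooth_on Q b -> Q x ->
  divergence Q (fun y => a y + b y) x = divergence Q a x + divergence Q b x.
Proof.
move=> Sa Sb Qx; rewrite -big_split; apply: eq_bigr => i _ /=.
by rewrite /partial (dderD HQ Sa Sb _ Qx) mxE.
Qed.

Lemma curlD a b (x : V3) : smooth_on Q a -> smooth_on Q b -> Q x ->
  curl Q (fun y => a y + b y) x = curl Q a x + curl Q b x.
Proof.
move=> Sa Sb Qx.
have E j k : partial Q j (fun y => a y + b y) x 0 k = partial Q j a x 0 k + partial Q j b x 0 k.
  by rewrite -row_addE; congr (fun_of_matrix _ _ _); exact: (dderD HQ Sa Sb _ Qx).
have subE (r s r' s' : R) : r + s - (r' + s') = (r - r') + (s - s').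
  by rewrite opprD addrACA.
apply/rowP => i; rewrite row_addE.
apply: (etrans (curl_coord _ x i)).
apply: (etrans _ (esym (congr2 +%R (curl_coord a x i) (curl_coord b x i)))).
apply: (etrans _ (subE _ _ _ _)).
exact: (congr2 (fun r s => r - s) (E (i + 1) (i + 2)) (E (i + 2) (i + 1))).
Qed.

Lemma divergence_cross a b (x : V3) : smooth_on Q a -> smooth_on Q b -> Q x ->
  divergence Q (fun y => cross (a y) (b y)) x =
  dot (curl Q a x) (b x) - dot (a x) (curl Q b x).
Proof.
move=> Sa Sb Qx; rewrite (divergenceE HQ (smooth_on_cross Sa Sb) Qx).
under eq_bigr do rewrite dder_cross_coord//.
rewrite /dot !sum_I3 !(curlE HQ _ Sa Qx) !(curlE HQ _ Sb Qx) !I3E.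
move: (dder Q) => d; ring.
Qed.

Lemma curl_grad f (x : V3) : smooth_on Q f -> Q x -> curl Q (grad Q f) x = 0.
Proof.
move=> Sf Qx; apply/rowP => i; rewrite (curlE HQ _ (smooth_on_grad HQ Sf) Qx) mxE.
have E j k : dder Q (fun y => grad Q f y 0 j) x (e k) = dder Q (dder Q f ^~ (e j)) x (e k).
  by apply: eq_dder => y _; rewrite gradE.
by apply/eqP; rewrite !E subr_eq0; apply/eqP; exact: dder_Schwarz.
Qed.

Lemma curlZ f w (x : V3) : smooth_on Q f -> smooth_on Q w -> Q x ->
  curl Q (fun y => f y *: w y) x = f x *: curl Q w x + cross (grad Q f x) (w x).
Proof.
move=> Sf Sw Qx; apply/rowP => i; rewrite (curlE HQ _ (smooth_onZ Sf Sw) Qx).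
rewrite (row_addE (f x *: curl Q w x)) (row_scaleE (f x)) (cross_coord (grad Q f x)).
rewrite (curlE HQ _ Sw Qx) !gradE.
rewrite (dder_scale_coord HQ _ (i + 2) Sf Sw Qx) (dder_scale_coord HQ _ (i + 1) Sf Sw Qx).
move: (dder Q) => d; ring.
Qed.

Lemma curl_cross a b (x : V3) i : smooth_on Q a -> smooth_on Q b -> Q x ->
  curl Q (fun y => cross (a y) (b y)) x 0 i =
  a x 0 i * divergence Q b x - b x 0 i * divergence Q a x +
  (\sum_l b x 0 l * dder Q (fun y => a y 0 i) x (e l) -
   \sum_l a x 0 l * dder Q (fun y => b y 0 i) x (e l)).
Proof.
move=> Sa Sb Qx; rewrite (curlE HQ _ (smooth_on_cross Sa Sb) Qx).
rewrite (divergenceE HQ Sa Qx) (divergenceE HQ Sb Qx) !dder_cross_coord// !sum_I3.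
move: i; apply: forall_I3; rewrite !I3E; move: (dder Q) => d; ring.
Qed.

Lemma cross_dot (a b c : V3) : cross a (cross b c) = dot a c *: b - dot a b *: c.
Proof.
apply/rowP; apply: forall_I3; rewrite !mxE /dot !sum_I3 !I3E; ring.
Qed.

End VectorCalculus.

Lemma cof3_sym (R : realType) (G : 'I_3 -> 'I_3 -> R) i j :
  (forall i j, G i j = G j i) -> cof3 G j i = cof3 G i j.
Proof.
move=> GC; rewrite /cof3 (GC (j + 1) (i + 1)) (GC (j + 2) (i + 2)).
by rewrite (GC (j + 1) (i + 2)) (GC (j + 2) (i + 1)) [X in _ - X]mulrC.
Qed.

(** Cartan's formula at one index [i], with [X l] the derivative of [a i] in direction [l] and [Y l]
    that of [a l] in direction [i]: the pairing of [a] with [u] is constant and the Lie derivative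
    of [a] vanishes, so [u] contracts the exterior derivative of [a] to 0. *)
Lemma sum_contraction (R : comRingType) (I : finType) (a d u X Y : I -> R) :
  \sum_l (a l * d l + u l * Y l) = 0 -> \sum_l u l * X l = - \sum_l d l * a l ->
  \sum_l u l * (X l - Y l) = 0.
Proof.
move=> H1 H2; rewrite -[RHS]oppr0 -[in RHS]H1 big_split opprD /=.
under eq_bigr do rewrite mulrBr.
by rewrite sumrB H2; congr (- _ - _); apply: eq_bigr => l _; rewrite mulrC.
Qed.

Lemma crossv0 (R : realType) (v : 'rV[R]_3) : cross v 0 = 0.
Proof. by apply/rowP => i; rewrite !mxE !mulr0 subrr. Qed.

(** * Force balance *)

Section Equilibrium.
Context {R : realType}.
Local Notation V3 := 'rV[R]_3.
Local Notation e := (@Defs.basis R).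
Variables (Q : set V3) (Phi : R -> V3 -> V3).
Hypotheses (HQ : Q `<=` closure Q°) (act : circle_action Q Phi).
Hypothesis vp : volume_preserving Q Phi.
Local Notation u := (generator Phi).
Local Notation low := (low Q Phi).
Local Notation raise := (raise Q Phi).
Local Notation rho := (avg_density Q Phi).
Local Notation D := (avg_det Q Phi).
Hypothesis u_neq0 : forall x, Q x -> u x <> 0.

Let metric_sym (x : V3) i j : metric Q Phi i j x = metric Q Phi j i x := avg_metricC Q Phi _ _ _.

(** The adjugate of a symmetric matrix is its cofactor matrix, so [cross_low3] applies. *)
Lemma raise_cross (x v w : V3) :
  raise x (cross v w) = (D x)^-1 *: cross (low x v) (low x w).
Proof.
have E : (fun i j => cof3 (fun i j => metric Q Phi i j x) j i) = cof3 (fun i j => metric Q Phi i j x).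
  by apply/funext => i; apply/funext => j; exact: cof3_sym (metric_sym x).
by rewrite cross_low3 -E.
Qed.

Lemma low_cross (x v w : V3) : Q x ->
  low x (cross (low x v) (low x w)) = D x *: cross v w.
Proof.
move=> Qx; have D0 := avg_det_gt0 HQ act Qx.
rewrite -(raiseK HQ act (cross v w) Qx) raise_cross// lowZ scalerA divff ?scale1r//.
by rewrite gt_eqF.
Qed.

Lemma raiseZ (x c : V3) (k : R) : Q x -> raise x (k *: c) = k *: raise x c.
Proof. by move=> Qx; apply: (low_inj HQ act Qx); rewrite lowZ !(raiseK HQ act). Qed.

Local Notation R2 := (gen_norm2 Q Phi).

Lemma gen_norm2E (x : V3) : Q x -> R2 x = dot (low x (u x)) (u x).
Proof. exact: avg_metric_low. Qed.

Lemma gen_norm2_gt0 (x : V3) : Q x -> 0 < R2 x.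
Proof. by move=> Qx; apply: avg_metric_gt0 => //; apply/eqP; exact: u_neq0. Qed.

Lemma gen_norm2_neq0 (x : V3) : Q x -> R2 x != 0.
Proof. by move=> Qx; rewrite gt_eqF// gen_norm2_gt0. Qed.

Lemma eq_inv_scalar (f g : V3 -> R) : (forall x, Q x -> f x = g x) ->
  inv_scalar Q Phi f -> inv_scalar Q Phi g.
Proof.
move=> fg [Sf If]; split=> [|x Qx]; first exact: eq_smooth_on Sf.
by rewrite -(If x Qx); apply: eq_dder => y Qy; rewrite fg.
Qed.

Lemma inv_gen_norm2 : inv_scalar Q Phi R2.
Proof.
apply: (@eq_inv_scalar (fun x => dot (low x (u x)) (u x))).
  by move=> x Qx; rewrite gen_norm2E.
have Iu := inv_generator HQ act.
by apply: inv_dot => //; exact: inv_low.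
Qed.

Lemma inv_gen_norm2V : inv_scalar Q Phi (fun x => (R2 x)^-1).
Proof. by apply: inv_scalarV => //; [exact: inv_gen_norm2|exact: gen_norm2_neq0]. Qed.

Definition gen_form (x : V3) : V3 := (R2 x)^-1 *: low x (u x).
Local Notation a := gen_form.

Lemma inv_gen_form : inv_covector Q Phi a.
Proof.
apply: inv_covectorZ => //; first exact: inv_gen_norm2V.
by apply: inv_low => //; exact: inv_generator.
Qed.

Lemma dot_gen_form (x : V3) : Q x -> dot (a x) (u x) = 1.
Proof. by move=> Qx; rewrite dotZl -gen_norm2E// mulVf// gen_norm2_neq0. Qed.

Lemma curl_gen_form (x : V3) : Q x -> curl Q a x = dot (a x) (curl Q a x) *: u x.
Proof.
move=> Qx; have [Sa Ia] := inv_gen_form; have Sai i := smooth_on_coord i Sa.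
have Su i := smooth_on_gen HQ act i.
have E i : \sum_l u x 0 l * (dder Q (fun y => a y 0 i) x (e l) - dder Q (fun y => a y 0 l) x (e i)) = 0.
  have H1 : \sum_l (a x 0 l * dder Q (fun y => u y 0 l) x (e i) +
                    u x 0 l * dder Q (fun y => a y 0 l) x (e i)) = 0.
    transitivity (dder Q (fun y => dot (a y) (u y)) x (e i)).
      rewrite (dder_sum HQ)//; last by move=> l; exact: smooth_onM.
      by apply: eq_bigr => l _; rewrite (dderM HQ (Sai l) (Su l) (e i) Qx).
    rewrite -[RHS](dder_cst HQ (1 : R) (e i) Qx); apply: eq_dder => y Qy.
    exact: dot_gen_form.
  have := Ia i x Qx; rewrite (dder_gen_sum Phi HQ (Sai i) Qx) => H2.
  exact: (sum_contraction H1 H2).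
have cr : cross (u x) (curl Q a x) = 0.
  apply/rowP => i; rewrite cross_coord !(curlE HQ _ Sa Qx) mxE.
  rewrite -[RHS]oppr0 -(E i) sum_I3.
  move: (dder Q) => d; move: i; apply: forall_I3; rewrite !I3E; ring.
(* Since [a . u = 1], the cross product of [a] with the cross product of [u] and [curl a] is
   [(a . curl a) u - curl a]. *)
have := cross_dot (a x) (u x) (curl Q a x); rewrite cr (dot_gen_form Qx) scale1r.
rewrite crossv0 => /esym/eqP; rewrite subr_eq0 => /eqP E1.
exact: esym E1.
Qed.

Variable psi : V3 -> R.
Hypothesis Ipsi : inv_scalar Q Phi psi.
Let Spsi : smooth_on Q psi. Proof. by case: Ipsi. Qed.

Let k x := D x / R2 x.

Let Ik : inv_scalar Q Phi k.
Proof. by apply: inv_scalarM => //; [exact: inv_det|exact: inv_gen_norm2V]. Qed.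

Definition flux_gradient (x : V3) : V3 := k x *: raise x (grad Q psi x).
Local Notation q := flux_gradient.

Lemma inv_flux_gradient : inv_vector Q Phi q.
Proof. by apply: inv_vectorZ => //; apply: inv_raise => //; exact: inv_grad. Qed.

Lemma low_cross_form (x : V3) : Q x -> low x (cross (grad Q psi x) (a x)) = cross (q x) (u x).
Proof.
move=> Qx; rewrite -{1}(raiseK HQ act (grad Q psi x) Qx) /gen_form -lowZ low_cross//.
apply/rowP => i; rewrite row_scaleE !cross_coord !row_scaleE /k; ring.
Qed.

End Equilibrium.

(** * The Grad-Shafranov field in Euclidean terms *)

Section Field.
Context {R : realType}.
Local Notation V3 := 'rV[R]_3.
Local Notation e := (@Defs.basis R).
Variables (Q : set V3) (Phi : R -> V3 -> V3).
Hypotheses (HQ : Q `<=` closure Q°) (act : circle_action Q Phi).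
Hypothesis vp : volume_preserving Q Phi.
Local Notation u := (generator Phi).
Local Notation low := (low Q Phi).
Local Notation raise := (raise Q Phi).
Local Notation rho := (avg_density Q Phi).
Local Notation R2 := (gen_norm2 Q Phi).
Hypothesis u_neq0 : forall x, Q x -> u x <> 0.
Variables (psi : V3 -> R) (C p : R -> R).
Hypotheses (Ipsi : inv_scalar Q Phi psi) (SC : Cinfty setT C) (Sp : Cinfty setT p).
Local Notation a := (gen_form Q Phi).
Local Notation q := (flux_gradient Q Phi psi).
Local Notation B := (gs_field Q Phi C psi).

Let Spsi : smooth_on Q psi. Proof. by case: Ipsi. Qed.
Let Su : smooth_on Q u. Proof. exact: smooth_on_generator. Qed.
Let Sa : smooth_on Q a. Proof. by case: (inv_gen_form HQ act u_neq0). Qed.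
Let Sq : smooth_on Q q. Proof. by case: (inv_flux_gradient HQ act vp u_neq0 Ipsi). Qed.
Let R20 (x : V3) : Q x -> R2 x != 0. Proof. exact: (gen_norm2_neq0 HQ act u_neq0). Qed.
Let rho0 (x : V3) : Q x -> rho x != 0.
Proof. by move=> Qx; rewrite gt_eqF// (avg_density_gt0 HQ act). Qed.

Let f x := C (psi x) * (R2 x)^-1.

Definition gs_field_form (x : V3) : V3 := f x *: u x + cross (grad Q psi x) (a x).
Local Notation Bf := gs_field_form.

Lemma gs_fieldE (x : V3) : Q x -> B x = Bf x.
Proof.
move=> Qx; have [Sg gE] := avg_gradE HQ act Spsi.
rewrite /gs_field /gs_field_form /gen_normalized scalerA; congr (_ + _).
rewrite (avg_crossE HQ act Sg Su).2// gE// (raiseZ HQ act)// raise_cross//.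
rewrite (raiseK HQ act)// !scalerA; apply/rowP => i.
rewrite row_scaleE !cross_coord row_scaleE row_scaleE.
have := avg_density_sqr HQ act Qx; have := rho0 Qx; have := R20 Qx.
move: (R2 x) (rho x) (avg_det Q Phi x) => r s d r0 s0 <-.
move: (grad Q psi x) (low x (u x)) => v w; field; apply/andP; split=> //.
Qed.

Let If : inv_scalar Q Phi f.
Proof.
apply: inv_scalarM => //; last exact: inv_gen_norm2V.
exact: (inv_scalar_comp HQ SC Ipsi).
Qed.

Lemma inv_gs_field_form : inv_vector Q Phi Bf.
Proof.
apply: inv_vectorD => //.
  by apply: inv_vectorZ => //; exact: inv_generator.
apply: inv_cross => //; first exact: inv_grad.
exact: inv_gen_form.
Qed.

Let div_gen (x : V3) : Q x -> divergence Q u x = 0.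
Proof. by move=> Qx; rewrite (divergenceE HQ Su Qx) (div_u HQ act vp). Qed.

Let dot_grad_inv (g : V3 -> R) (x : V3) : inv_scalar Q Phi g -> Q x -> dot (u x) (grad Q g x) = 0.
Proof. by move=> [Sg Ig] Qx; rewrite (dot_grad HQ)// Ig. Qed.

(** The part along [u] is divergence-free because [u] is and [f] is constant along it; the other
    part has divergence minus [grad psi . curl a], and [curl a] is parallel to [u]. *)
Lemma div_gs_field_form (x : V3) : Q x -> divergence Q Bf x = 0.
Proof.
move=> Qx; have Sf := If.1; have Sg := smooth_on_grad HQ Spsi.
rewrite (divergenceD HQ (smooth_onZ Sf Su) (smooth_on_cross Sg Sa) Qx).
rewrite (divergenceZ HQ Sf Su Qx) div_gen// mulr0 add0r dot_grad_inv// add0r.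
rewrite (divergence_cross HQ Sg Sa Qx) (curl_grad HQ Spsi Qx).
rewrite (curl_gen_form HQ act u_neq0 Qx) [dot (grad _ _ _) _]dotC dotZl dot_grad_inv//.
by rewrite mulr0 subr0 /dot big1// => i _; rewrite mxE mul0r.
Qed.

Lemma low_gs_field_form (x : V3) : Q x ->
  low x (Bf x) = C (psi x) *: a x + cross (q x) (u x).
Proof.
move=> Qx; rewrite lowD lowZ (low_cross_form HQ act psi Qx); congr (_ + _).
by rewrite /gen_form scalerA.
Qed.

Lemma grad_comp (h : R -> R) (x : V3) : Cinfty setT h -> Q x ->
  grad Q (fun y => h (psi y)) x = derive1 h (psi x) *: grad Q psi x.
Proof.
move=> Sh Qx; apply/rowP => i; rewrite row_scaleE !gradE.
exact: (dder_comp HQ (O := setT) openT Sh Spsi).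
Qed.

Lemma curl_gs_form (x : V3) : Q x -> curl Q (fun y => low y (Bf y)) x =
  derive1 C (psi x) *: cross (grad Q psi x) (a x) +
  (C (psi x) * dot (a x) (curl Q a x) - divergence Q q x) *: u x.
Proof.
move=> Qx; rewrite (eq_curl x low_gs_field_form).
have SCpsi := (inv_scalar_comp HQ SC Ipsi).1.
rewrite (curlD HQ (smooth_onZ SCpsi Sa) (smooth_on_cross Sq Su) Qx).
rewrite (curlZ HQ SCpsi Sa Qx) (grad_comp SC Qx).
(* In the expansion of this curl the directional derivatives cancel because [q] commutes with [u],
   and [div u = 0] leaves the term in [div q]. *)
have -> : curl Q (fun y => cross (q y) (u y)) x = - divergence Q q x *: u x.
  apply/rowP => i; rewrite (curl_cross HQ i Sq Su Qx) div_gen// mulr0 sub0r row_scaleE.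
  have [_ Iq] := inv_flux_gradient HQ act vp u_neq0 Ipsi.
  rewrite -(dder_gen_sum Phi HQ (smooth_on_coord i Sq) Qx) Iq// subrr addr0.
  by rewrite mulNr mulrC.
have -> : C (psi x) *: curl Q a x = (C (psi x) * dot (a x) (curl Q a x)) *: u x.
  by rewrite {1}(curl_gen_form HQ act u_neq0 Qx) scalerA.
have -> : cross (derive1 C (psi x) *: grad Q psi x) (a x) =
    derive1 C (psi x) *: cross (grad Q psi x) (a x).
  by apply/rowP => i; rewrite row_scaleE !cross_coord !row_scaleE; ring.
by rewrite scalerBl scaleNr addrA; congr (_ - _); exact: addrC.
Qed.

Hypothesis GS : grad_shafranov Q Phi C p psi.

(** Multiplication of the equation by the density: the averaged divergence and the averaged curl
    each carry its inverse, and [rho ^+ 2] is the determinant entering [flux_gradient]. *)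
Lemma grad_shafranov_euclidean (x : V3) : Q x ->
  C (psi x) * dot (a x) (curl Q a x) - divergence Q q x =
  derive1 p (psi x) + (R2 x)^-1 * C (psi x) * derive1 C (psi x).
Proof.
move=> Qx; have := GS Qx; have [Sg gE] := avg_gradE HQ act Spsi.
have -> : avg_div Q Phi (fun y => ((R2 y)^-1 * rho y) *: avg_grad Q Phi psi y) x =
    (rho x)^-1 * divergence Q q x.
  congr (_ * _); apply: eq_divergence => y Qy; rewrite gE// scalerA /flux_gradient.
  by rewrite -(avg_density_sqr HQ act Qy) mulrCA mulrC.
have Seta : smooth_on Q (gen_normalized Q Phi).
  by apply: smooth_onZ => //; exact: (inv_gen_norm2V HQ act u_neq0).1.
have lowE y : low y (gen_normalized Q Phi y) = a y by rewrite /gen_normalized lowZ.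
have -> : avg_dot Q Phi (gen_normalized Q Phi) (avg_curl Q Phi (gen_normalized Q Phi)) x =
    (rho x)^-1 * dot (a x) (curl Q a x).
  rewrite /avg_dot (avg_metric_low HQ act)// lowE (avg_curlE HQ act Seta).2//.
  by rewrite (eq_curl (b := a) x (fun y _ => lowE y)) dotC dotZl dotC.
move: (R2 x) (divergence Q q x) (dot (a x) _) (rho x) (rho0 Qx) => r d l s s0 H.
apply: (mulfI (invr_neq0 s0)); rewrite [RHS]mulrC -H; ring.
Qed.

Lemma curl_gs_field (x : V3) : Q x -> curl Q (fun y => low y (Bf y)) x =
  derive1 C (psi x) *: Bf x + derive1 p (psi x) *: u x.
Proof.
move=> Qx; rewrite curl_gs_form// grad_shafranov_euclidean// /gs_field_form /f.
apply/rowP => i; rewrite !(row_addE, row_scaleE).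
move: (cross _ _) (u x) (R2 x)^-1 => v w r; ring.
Qed.

Lemma lorentz_force (x : V3) : Q x ->
  cross (curl Q (fun y => low y (Bf y)) x) (Bf x) = derive1 p (psi x) *: grad Q psi x.
Proof.
move=> Qx; rewrite curl_gs_field//.
(* Double cross product with [a . u = 1] and [u . grad psi = 0]. *)
have E : cross (u x) (cross (grad Q psi x) (a x)) = grad Q psi x.
  rewrite cross_dot dot_grad_inv// [dot (u x) _]dotC (dot_gen_form HQ act u_neq0 Qx).
  by rewrite scale1r scale0r subr0.
rewrite -[in RHS]E /gs_field_form; move: (u x) (cross (grad _ _ _) _) => v w.
apply/rowP => i; rewrite row_scaleE !cross_coord !(row_addE, row_scaleE); ring.
Qed.

End Field.

(** * Uniqueness for linear differential equations *)

Lemma is_derive_continuous (R : realType) (f df : R -> R) :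
  (forall t : R, is_derive t 1 f (df t)) -> continuous f.
Proof.
move=> dF t; apply/differentiable_continuous/derivable1_diffP.
exact: (is_derive_derivable (dF t)).
Qed.

Lemma continuous_segment_bound (R : realType) (f : R -> R) (T : R) : 0 <= T -> continuous f ->
  exists K, forall s, 0 <= s <= T -> `|f s| <= K.
Proof.
move=> T0 cf.
have cn : {within `[0, T], continuous (fun s => `|f s|)}.
  by apply: continuous_subspaceT => s; apply: continuous_comp; [exact: cf|exact: norm_continuous].
have [c _ fc] := EVT_max T0 cn; exists `|f c| => s sT.
by apply: fc; rewrite in_itv.
Qed.

(* Gronwall's inequality for [\sum_k y_k ^ 2]. *)
Lemma linear_ode_zero (R : realType) (A : 'I_3 -> 'I_3 -> R -> R) (y : 'I_3 -> R -> R) (T : R) :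
  (forall l k, continuous (A l k)) ->
  (forall k (s : R), is_derive s 1 (y k) (\sum_l y l s * A l k s)) ->
  (forall k, y k 0 = 0) -> 0 < T -> forall k, y k T = 0.
Proof.
move=> cA dy y0 T0.
have [K KA] : exists K, forall l k s, 0 <= s <= T -> `|A l k s| <= K.
  pose P l k K := forall s, 0 <= s <= T -> `|A l k s| <= K.
  have /choice[K' PK] : forall lk : 'I_3 * 'I_3, exists K, P lk.1 lk.2 K.
    by move=> lk; exact: continuous_segment_bound (ltW T0) (cA _ _).
  exists (\sum_lk `|K' lk|) => l k s sT.
  apply: le_trans (PK (l, k) s sT) _; apply: le_trans (ler_norm _) _.
  by rewrite (bigD1 (l, k))//= lerDl sumr_ge0.
have K0 : 0 <= K by apply: le_trans (normr_ge0 _) (KA 0 0 0 _); rewrite lexx ltW.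
pose f s := \sum_k y k s ^+ 2; pose df s := \sum_k 2 * (y k s * \sum_l y l s * A l k s).
have dF (s : R) : is_derive s 1 f (df s).
  have -> : f = (fun s => y 0 s * y 0 s + y 1 s * y 1 s + y 2 s * y 2 s).
    by apply/funext => r; rewrite /f sum_I3 !expr2.
  have D2 k := is_deriveM (dy k s) (dy k s).
  apply: (is_derive_eq (is_deriveD (is_deriveD (D2 0) (D2 1)) (D2 2))).
  have E k (z : R) : y k s *: z + y k s *: z = 2 * (y k s * z) by rewrite mulr_natl mulr2n.
  by rewrite !E /df [RHS]sum_I3.
have f0 : f 0 = 0 by rewrite /f big1// => k _; rewrite y0 expr0n.
have fge0 s : 0 <= f s by apply: sumr_ge0 => k _; exact: sqr_ge0.
have yf k s : y k s ^+ 2 <= f s.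
  by rewrite /f (bigD1 k)//= lerDl sumr_ge0// => i _; exact: sqr_ge0.
(* Nine terms in [df s], each at most [2 * K * f s]. *)
pose L := 18 * K.
have dfL s : 0 <= s <= T -> df s <= L * f s.
  move=> sT; have tE k l : 2 * (y k s * (y l s * A l k s)) <= 2 * K * f s.
    have := KA l k s sT; rewrite ler_norml => /andP[A1 A2].
    have := yf k s; have := yf l s; have := fge0 s.
    move: (y k s) (y l s) (A l k s) (f s) A1 A2 => a b r F A1 A2 F0 bF aF.
    have ab : `|a * b| <= F.
      by rewrite ler_norml; apply/andP; split; nra.
    have : `|a * (b * r)| <= F * K.
      by rewrite mulrA normrM ler_pM// ler_norml A1 A2.
    by rewrite ler_norml => /andP[_]; lra.
  have := (tE 0 0, tE 0 1, tE 0 2, (tE 1 0, tE 1 1, tE 1 2), (tE 2 0, tE 2 1, tE 2 2)).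
  move=> [[[[t1 t2] t3] [[t4 t5] t6]] [[t7 t8] t9]].
  rewrite /df !sum_I3 /L !mulrDr; lra.
(* Integrating factor: [g] has nonpositive derivative on the segment and vanishes at 0. *)
pose g s := expR (- L * s) * f s.
have dg (s : R) : is_derive s 1 g (expR (- L * s) * (df s - L * f s)).
  have h1 : is_derive s 1 (fun s : R => - L * s) (- L).
    by apply: (is_derive_eq (is_deriveZ (- L) (is_derive_id s 1))); rewrite [_ *: _]mulr1.
  have h2 := is_derive1_comp (is_derive_expR (- L * s)) h1.
  apply: (is_derive_eq (is_deriveM h2 (dF s))).
  rewrite /= /GRing.scale /=; ring.
have [c cT gE] := MVT T0 (fun s _ => dg s)
  (continuous_subspaceT (is_derive_continuous dg)).
have gT : g T <= 0.
  have -> : g T = g T - g 0 by rewrite {3}/g f0 mulr0 subr0.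
  rewrite gE subr0; apply: mulr_le0_ge0; last exact: ltW.
  apply: mulr_ge0_le0; first exact: expR_ge0.
  rewrite subr_le0; apply: dfL.
  by move: cT; rewrite in_itv/= => /andP[c0 cT]; rewrite !ltW.
have fT : f T <= 0 by move: gT; rewrite /g pmulr_rle0// expR_gt0.
move=> k; apply/eqP; rewrite -sqrf_eq0 eq_le sqr_ge0 andbT.
exact: le_trans (yf k T) fT.
Qed.

(** * Averaging along the flow *)

Section Push.
Context {R : realType}.
Local Notation V3 := 'rV[R]_3.
Local Notation e := (@Defs.basis R).
Variables (Q : set V3) (Phi : R -> V3 -> V3).
Hypotheses (HQ : Q `<=` closure Q°) (act : circle_action Q Phi).
Local Notation u := (generator Phi).
Local Notation S := (cylinder Q).
Let HS : S `<=` closure S° := @cylinder_closure_interior R _ Q HQ.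

Lemma is_derive_along (f : V3 -> R) (x : V3) (t : R) : smooth_on Q f -> Q x ->
  is_derive t 1 (fun s => f (Phi s x)) (dder Q f (Phi t x) (u (Phi t x))).
Proof.
move=> Sf Qx.
have SP : smooth_on [set: R] (fun s => Phi s x).
  exact: (smooth_on_fiber (H := orbit_map Phi) (action_smooth act) Qx).
have E := @dder_comp_rV R R 3 setT Q f (fun s => Phi s x) (@setT_closure_interior R R) HQ
  Sf SP (fun s _ => action_in act s Qx) t (1 : R) I.
have Ep : dder setT (fun s => Phi s x) t (1 : R) = u (Phi t x).
  have [_ <-] := is_derive_dderT t (1 : R) SP.
  by have [_ ->] := is_derive_orbit HQ act t Qx; exact: dder_orbit_time.
have Sc := smooth_on_comp_rV Sf SP (fun s _ => action_in act s Qx).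
by have := is_derive_dderT t (1 : R) Sc; rewrite E Ep.
Qed.

Lemma dder_comp_action (f : V3 -> R) (x v : V3) (t : R) : smooth_on Q f -> Q x ->
  dder Q (fun y => f (Phi t y)) x v = \sum_l dder Q (Phi t) x v 0 l * dder Q f (Phi t x) (e l).
Proof.
move=> Sf Qx; rewrite -(dder_sum_basis HQ _ Sf (action_in act t Qx)).
exact: (@dder_comp_rV R V3 3 Q Q f (Phi t) HQ HQ Sf (smooth_on_action act t)
  (fun y => @action_in _ _ _ act t y) x v Qx).
Qed.

(** The variational equation along the orbit: time and space derivatives are exchanged, and the flow
    equation is differentiated in space. *)
Lemma is_derive_push (x v : V3) (t : R) k : Q x ->
  is_derive t 1 (fun s => dder Q (Phi s) x v 0 k)
    (\sum_l dder Q (Phi t) x v 0 l * dder Q (fun y => u y 0 k) (Phi t x) (e l)).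
Proof.
move=> Qx; have Sphi := smooth_on_phi act k; have Sx : S (x, t) by [].
have Sd := smooth_on_dder HS (v, 0) Sphi.
have -> : (fun s => dder Q (Phi s) x v 0 k) =
    (fun s => (fun z => dder S (orbit_coord Phi k) z (v, 0)) (x, s)).
  by apply/funext => s; rewrite (dder_phi_space HQ act).
apply: (is_derive_eq (is_derive_fiber HQ t Sd Qx)).
apply: (etrans (dder_Schwarz HS (0, 1) (v, 0) Sphi Sx)).
have Su := smooth_on_gen HQ act k.
rewrite -(dder_comp_action v t Su Qx).
have Suo : smooth_on S (fun z => u (orbit_map Phi z) 0 k).
  apply: (@smooth_on_comp_rV R _ 3 S Q (fun y => u y 0 k) (orbit_map Phi)) => //.
    exact: action_smooth.
  by move=> [y s] [Qy _]; exact: (action_in act s Qy).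
rewrite [RHS](dder_slice HQ (H := fun z => u (orbit_map Phi z) 0 k) t v Suo Qx).
by apply: eq_dder => -[y s] [/= Qy _]; exact: (dder_phi_time HQ act k s Qy).
Qed.

(* Both sides solve the variational equation along the orbit. *)
Lemma push_inv_vector (w : V3 -> V3) (x : V3) (t : R) : inv_vector Q Phi w -> Q x -> 0 <= t ->
  w (Phi t x) = dder Q (Phi t) x (w x).
Proof.
move=> [Sw Iw] Qx; rewrite le_eqVlt => /orP[/eqP <-|t0].
  rewrite (action0 act Qx); apply/esym.
  rewrite -[RHS](dder_linear (L := idfun) HQ (w x) _ _ Qx)//.
    by apply: eq_dder => y; exact: (action0 act).
  by move=> ?; exact: cvg_id.
pose A l k s := dder Q (fun y => u y 0 k) (Phi s x) (e l).
pose y k s := w (Phi s x) 0 k - dder Q (Phi s) x (w x) 0 k.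
have cA l k : continuous (A l k).
  have Sd := smooth_on_dder HQ (e l) (smooth_on_gen HQ act k).
  exact: (is_derive_continuous (fun s => is_derive_along s Sd Qx)).
have dy k (s : R) : is_derive s 1 (y k) (\sum_l y l s * A l k s).
  have H1 := is_derive_along s (smooth_on_coord k Sw) Qx.
  apply: (is_derive_eq (is_deriveB H1 (is_derive_push (w x) s k Qx))).
  rewrite (Iw k _ (action_in act s Qx)) -sumrB; apply: eq_bigr => l _.
  by rewrite -mulrBl.
have y0 k : y k 0 = 0.
  rewrite /y (action0 act Qx).
  have -> : dder Q (Phi 0) x (w x) = w x; last exact: subrr.
  rewrite -[RHS](dder_linear (L := idfun) HQ (w x) _ _ Qx)//.
    by apply: eq_dder => z; exact: (action0 act).
  by move=> ?; exact: cvg_id.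
apply/rowP => k; apply/eqP; rewrite -subr_eq0; apply/eqP.
exact: (linear_ode_zero cA dy y0 t0 k).
Qed.

End Push.

(** Contraction commutes with pullback: [J] is the Jacobian, [M l j] the derivative of the [j]-th
    component in direction [l], and the vector contracted on the left is the push-forward of [W]. *)
Lemma pullback_contraction (R : comRingType) (J M : 'I_3 -> 'I_3 -> R) (W : 'I_3 -> R) i :
  \sum_j J i j * (\sum_l (\sum_m W m * J m l) * (M l j - M j l)) =
  \sum_m W m * (\sum_j J i j * (\sum_l J m l * M l j) - \sum_j J m j * (\sum_l J i l * M l j)).
Proof. rewrite !sum_I3; ring. Qed.

Lemma sumD_cancel (R : comRingType) (I : finType) (a b c d : I -> R) :
  (forall j, b j = d j) -> \sum_j (a j + b j) - \sum_j (c j + d j) = \sum_j a j - \sum_j c j.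
Proof.
move=> bd; rewrite !big_split /= opprD addrACA (eq_bigr d (fun j _ => bd j)).
by rewrite subrr addr0.
Qed.

Section AverageForce.
Context {R : realType}.
Local Notation V3 := 'rV[R]_3.
Local Notation e := (@Defs.basis R).
Variables (Q : set V3) (Phi : R -> V3 -> V3).
Hypotheses (HQ : Q `<=` closure Q°) (act : circle_action Q Phi).
Local Notation u := (generator Phi).
Local Notation S := (cylinder Q).
Local Notation jac := (jac Q Phi).
Local Notation pull := (pull Q Phi).
Local Notation low := (low Q Phi).
Let HS : S `<=` closure S° := @cylinder_closure_interior R _ Q HQ.

Lemma cross_curlE (w : V3 -> V3) (x v : V3) j : smooth_on Q w -> Q x ->
  cross (curl Q w x) v 0 j =
  \sum_l v 0 l * (dder Q (fun y => w y 0 j) x (e l) - dder Q (fun y => w y 0 l) x (e j)).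
Proof.
move=> Sw Qx; rewrite cross_coord !(curlE HQ _ Sw Qx) sum_I3.
move: (dder Q) => d; move: j; apply: forall_I3; rewrite !I3E; ring.
Qed.

Variables (w : V3 -> V3) (pr : V3 -> R).
Hypotheses (Iw : inv_vector Q Phi w) (Spr : smooth_on Q pr).
Hypothesis prP : forall t x, Q x -> pr (Phi t x) = pr x.

Let Sw : smooth_on Q w. Proof. by case: Iw. Qed.
Let Swi i : smooth_on Q (fun y => w y 0 i). Proof. exact: smooth_on_coord. Qed.

(* As [w] is invariant, this is the pullback by [Phi_t] of the covector field
   dual to [w] for the Euclidean metric, and its average over the circle is dual
   to [w] for the averaged metric. *)
Definition pull_form i (z : V3 * R) : R := \sum_k w z.1 0 k * pull i k z.
Local Notation beta := pull_form.

Lemma smooth_on_pull_form i : smooth_on S (beta i).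
Proof.
apply: smooth_on_sum => k; apply: smooth_onM; last exact: smooth_on_pull.
exact: (smooth_on_base (f := fun y => w y 0 k)).
Qed.

Let push_coord (x : V3) (t : R) l : Q x -> 0 <= t ->
  w (Phi t x) 0 l = \sum_m w x 0 m * jac m l (x, t).
Proof.
by move=> Qx t0; rewrite (push_inv_vector HQ act Iw Qx t0) (dder_action HQ act).
Qed.

Lemma pull_formE i (x : V3) (t : R) : Q x -> 0 <= t ->
  beta i (x, t) = \sum_j jac i j (x, t) * w (Phi t x) 0 j.
Proof.
move=> Qx t0; transitivity (\sum_j \sum_k jac i j (x, t) * (w x 0 k * jac k j (x, t))).
  rewrite exchange_big; apply: eq_bigr => k _; rewrite mulr_sumr; apply: eq_bigr => j _.
  by rewrite /= mulrCA.
by apply: eq_bigr => j _; rewrite push_coord// mulr_sumr.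
Qed.

Let D (x : V3) (t : R) l j := dder Q (fun y => w y 0 j) (Phi t x) (e l).

Lemma dder_pull_form i m (x : V3) (t : R) : Q x -> 0 <= t ->
  dder S (beta i) (x, t) (e m, 0) =
  \sum_j (jac i j (x, t) * (\sum_l jac m l (x, t) * D x t l j) +
          w (Phi t x) 0 j * dder S (jac i j) (x, t) (e m, 0)).
Proof.
move=> Qx t0; have Sj j := smooth_on_jac HQ act i j.
have Sjt j : smooth_on Q (fun y => jac i j (y, t)) by exact: smooth_on_slice.
have Swt j : smooth_on Q (fun y => w (Phi t y) 0 j).
  apply: (@smooth_on_comp_rV R _ 3 Q Q (fun y => w y 0 j) (Phi t)) => //.
    exact: smooth_on_action.
  by move=> y; exact: (action_in act t).
rewrite -(dder_slice HQ t (e m) (smooth_on_pull_form i) Qx).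
transitivity (dder Q (fun y => \sum_j jac i j (y, t) * w (Phi t y) 0 j) x (e m)).
  by apply: eq_dder => y Qy; exact: pull_formE.
rewrite (dder_sum HQ)//; last by move=> j; exact: smooth_onM.
apply: eq_bigr => j _; rewrite (dderM HQ (Sjt j) (Swt j) (e m) Qx).
rewrite (dder_comp_action HQ act (e m) t (Swi j) Qx).
apply: (congr2 (fun a b => jac i j (x, t) * a + w (Phi t x) 0 j * b)).
  by apply: eq_bigr => l _; rewrite (jacE HQ act).
exact: (dder_slice HQ t (e m) (Sj j) Qx).
Qed.

(** Pullback commutes with the exterior derivative: the terms with second derivatives of the flow
    are symmetric in [i] and [m] and cancel. *)
Lemma pull_form_curl i m (x : V3) (t : R) : Q x -> 0 <= t ->
  dder S (beta i) (x, t) (e m, 0) - dder S (beta m) (x, t) (e i, 0) =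
  \sum_j jac i j (x, t) * (\sum_l jac m l (x, t) * D x t l j) -
  \sum_j jac m j (x, t) * (\sum_l jac i l (x, t) * D x t l j).
Proof.
move=> Qx t0.
apply: (etrans (congr2 (fun r s => r - s) (dder_pull_form i m Qx t0) (dder_pull_form m i Qx t0))).
apply: sumD_cancel => j; apply: (congr1 ( *%R (w (Phi t x) 0 j))).
by apply: dder_jac_sym.
Qed.

(** Invariance of [w] and [pr] brings [w] and [grad pr] back to the fixed point [x], so that time
    enters only through [pull_form]. Nonnegative times are those covered by [push_inv_vector], and
    the integral uses no others. *)
Lemma pullback_force i (x : V3) (t : R) : Q x -> 0 <= t ->
  grad_map_apply Q (Phi t) x
    (cross (curl Q w (Phi t x)) (w (Phi t x)) - grad Q pr (Phi t x)) 0 i =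
  \sum_m w x 0 m * (dder S (beta i) (x, t) (e m, 0) - dder S (beta m) (x, t) (e i, 0))
  - grad Q pr x 0 i.
Proof.
move=> Qx t0; have Qtx := action_in act t Qx.
transitivity (\sum_j jac i j (x, t) * (cross (curl Q w (Phi t x)) (w (Phi t x)) 0 j)
   - \sum_j jac i j (x, t) * grad Q pr (Phi t x) 0 j).
  rewrite mxE -sumrB; apply: eq_bigr => j _; rewrite (jacE HQ act i j t Qx) -mulrBr.
  by congr (_ * _); rewrite !mxE.
congr (_ - _); last first.
  rewrite gradE; transitivity (dder Q (fun y => pr (Phi t y)) x (e i)).
    rewrite (dder_comp_action HQ act (e i) t Spr Qx); apply: eq_bigr => j _.
    by rewrite (jacE HQ act i j t Qx) gradE.
  by apply: eq_dder => y; exact: prP.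
transitivity (\sum_j jac i j (x, t) * (\sum_l (\sum_m w x 0 m * jac m l (x, t)) *
    (D x t l j - D x t j l))).
  apply: eq_bigr => j _; congr (_ * _); rewrite (cross_curlE _ j Sw Qtx).
  by apply: eq_bigr => l _; rewrite (push_coord l Qx t0).
rewrite pullback_contraction; apply: eq_bigr => m _.
by rewrite (pull_form_curl i m Qx t0).
Qed.

Lemma dder_itg_pull_form i (x v : V3) : Q x ->
  itg 0 (2 * pi) (fun t => dder S (beta i) (x, t) (v, 0)) =
  2 * pi * dder Q (fun y => low y (w y) 0 i) x v.
Proof.
move=> Qx; have Slow := smooth_on_coord i (smooth_on_low HQ act Sw).
rewrite -(dder_param HQ (ltW (@pi2_gt0 R)) (smooth_on_pull_form i) v Qx).
rewrite -(dderZ HQ (2 * pi) v Slow Qx); apply: eq_dder => y Qy.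
have cp k : {within `[0, 2 * pi], continuous (fun t => pull i k (y, t))}.
  exact: fiber_continuous (smooth_on_pull HQ act i k) Qy.
have cwp k : {within `[0, 2 * pi], continuous (fun t => w y 0 k * pull i k (y, t))}.
  exact: within_continuousZ.
etransitivity; first exact: (itg_sum _ cwp).
rewrite mxE mulr_sumr; apply: eq_bigr => k _.
etransitivity; first exact: (itgZ _ (cp k)).
rewrite (metricE HQ act i k Qy).
have E (I1 w1 p1 : R) : p1 != 0 -> w1 * I1 = p1 * (p1^-1 * I1 * w1) by move=> p0; field.
by apply: E; rewrite gt_eqF// pi2_gt0.
Qed.

(** The pulled-back force is affine in the derivatives of [pull_form], with coefficients independent
    of [t]; integration commutes with the space derivatives, and the mean of [pull_form] is
    [low y (w y)]. *)
Lemma average_force i (x : V3) : Q x ->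
  circle_integral (fun t => grad_map_apply Q (Phi t) x
    (cross (curl Q w (Phi t x)) (w (Phi t x)) - grad Q pr (Phi t x)) 0 i) =
  2 * pi * (cross (curl Q (fun y => low y (w y)) x) (w x) - grad Q pr x) 0 i.
Proof.
move=> Qx; rewrite -[circle_integral _]/(itg 0 (2 * pi) _).
pose F m t := dder S (beta i) (x, t) (e m, 0) - dder S (beta m) (x, t) (e i, 0).
have cb k v : {within `[0, 2 * pi], continuous (fun t => dder S (beta k) (x, t) v)}.
  exact: fiber_continuous (smooth_on_dder HS v (smooth_on_pull_form k)) Qx.
have cF m : {within `[0, 2 * pi], continuous (F m)} by exact: within_continuousB.
have cwF m : {within `[0, 2 * pi], continuous (fun t => w x 0 m * F m t)}.
  exact: within_continuousZ.
have cg : {within `[0, 2 * pi], continuous (fun _ : R => grad Q pr x 0 i)} by move=> ?; exact: cst_continuous.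
transitivity (itg 0 (2 * pi) (fun t => \sum_m w x 0 m * F m t - grad Q pr x 0 i)).
  by apply: eq_itg => t /andP[t0 _]; exact: pullback_force.
etransitivity; first exact: (itgB (f := fun t => \sum_m w x 0 m * F m t) (within_continuous_sum cwF) cg).
rewrite (itg_cst _ (ltW (@pi2_gt0 R))) subr0.
etransitivity; first exact: (congr1 (fun r => r - _) (itg_sum _ cwF)).
have -> : (cross (curl Q (fun y => low y (w y)) x) (w x) - grad Q pr x) 0 i =
   cross (curl Q (fun y => low y (w y)) x) (w x) 0 i - grad Q pr x 0 i by rewrite !mxE.
rewrite mulrBr [grad Q pr x 0 i * _]mulrC; congr (_ - _).
rewrite (cross_curlE _ i (smooth_on_low HQ act Sw) Qx) mulr_sumr.
apply: eq_bigr => m _.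
etransitivity; first exact: (itgZ _ (cF m)).
etransitivity; first exact: (congr1 ( *%R (w x 0 m)) (itgB (cb i (e m, 0)) (cb m (e i, 0)))).
apply: (etrans (congr2 (fun r s => w x 0 m * (r - s)) (dder_itg_pull_form i (e m) Qx)
  (dder_itg_pull_form m (e i) Qx))).
by rewrite -mulrBr mulrCA.
Qed.

End AverageForce.

Theorem theorem4 (R : realType) (Q : set 'rV[R]_3) (C p : R -> R)
    (Phi : R -> 'rV[R]_3 -> 'rV[R]_3) (psi : 'rV[R]_3 -> R) :
  diffeomorphic Q (@solid_torus R) ->
  Cinfty [set: R] C ->
  Cinfty [set: R] p ->
  circle_action Q Phi ->
  volume_preserving Q Phi ->
  (forall x, Q x -> generator Phi x <> 0) ->
  smooth_on Q psi ->
  (forall t x, Q x -> psi (Phi t x) = psi x) ->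
  grad_shafranov Q Phi C p psi ->
  let B := gs_field Q Phi C psi in
  let pr := fun x => p (psi x) in
  (forall x, Q x -> divergence Q B x = 0) /\
  (forall x, Q x ->
    avg_cross Q Phi (avg_curl Q Phi B) B x = avg_grad Q Phi pr x) /\
  (forall x, Q x -> forall i : 'I_3,
    circle_integral (fun t =>
      grad_map_apply Q (Phi t) x
        (cross (curl Q B (Phi t x)) (B (Phi t x)) - grad Q pr (Phi t x)) 0 i)
    = 0).
Proof.
move=> dQ SC Sp act vp u0 Spsi psiP GS B pr.
have HQ := solid_torus_closure_interior dQ.
have Ipsi := inv_scalar_orbit HQ act Spsi psiP.
pose Bf := gs_field_form Q Phi psi C.
have BE x : Q x -> B x = Bf x := @gs_fieldE _ _ _ HQ act u0 psi C Ipsi x.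
have IB : inv_vector Q Phi Bf by exact: inv_gs_field_form.
have SBf : smooth_on Q Bf by case: IB.
have SB : smooth_on Q B by apply: eq_smooth_on SBf => x Qx; rewrite BE.
have Spr : smooth_on Q pr := (inv_scalar_comp HQ Sp Ipsi).1.
have prP t x : Q x -> pr (Phi t x) = pr x by move=> Qx; rewrite /pr psiP.
have force x : Q x -> cross (curl Q (fun y => low Q Phi y (Bf y)) x) (Bf x) = grad Q pr x.
  by move=> Qx; rewrite (lorentz_force HQ act vp u0 Ipsi SC GS Qx) (grad_comp HQ Ipsi Sp Qx).
split=> [x Qx|]; last split=> [x Qx|x Qx i].
- by rewrite (eq_divergence x BE) div_gs_field_form.
- have [Sc cE] := avg_curlE HQ act SB; have [_ gE] := avg_gradE HQ act Spr.
  rewrite (avg_crossE HQ act Sc SB).2// gE// cE// BE//; congr raise.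
  rewrite (eq_curl (b := fun y => low Q Phi y (Bf y))); last by move=> y Qy; rewrite BE.
  (* The density in the averaged cross product cancels its inverse in the averaged curl. *)
  rewrite -force//; apply/rowP => i; rewrite row_scaleE !cross_coord !row_scaleE.
  have : avg_density Q Phi x != 0 by rewrite gt_eqF// (avg_density_gt0 HQ act).
  by move: (avg_density _ _ _) => r r0; field.
- transitivity (2 * pi * (cross (curl Q (fun y => low Q Phi y (Bf y)) x) (Bf x) - grad Q pr x) 0 i).
    rewrite -(average_force HQ act IB Spr prP i Qx); congr circle_integral.
    apply/funext => t; have Qtx := action_in act t Qx.
    by rewrite (BE _ Qtx) (eq_curl (Phi t x) BE).
  by rewrite force// subrr mxE mulr0.
Qed.
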